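(* Let $n\ge 2$. The Fourier transform $\mathcal{F}_G$, sending $f$ to the function $(r,\omega)\mapsto\mathcal{F}_G(f)_r(\omega)$ on $\mathbb{R}\times S^{n-1}$, is a topological isomorphism of the Schwartz space $\mathcal{S}(\mathbb{R}^n)$ onto $\mathcal{S}^{\mathbb{Z}_2}_H(\mathbb{R}\times S^{n-1})$.
   Context: $S^{n-1}$ is the unit sphere in $\mathbb{R}^n$. For $f\in\mathcal{S}(\mathbb{R}^n)$, $\mathcal{F}_G(f)_r(\omega)=\int_{\mathbb{R}^n}f(x)e^{-2\pi i r\,x\cdot\omega}\,dx$ for $r\in\mathbb{R}$, $\omega\in S^{n-1}$. $\mathcal{S}(\mathbb{R}^n)$ carries its usual Fréchet topology. $\mathcal{S}^{\mathbb{Z}_2}_H(\mathbb{R}\times S^{n-1})$ is the set of smooth functions $F:\mathbb{R}\times S^{n-1}\to\mathbb{C}$ which satisfy: (1) $F$ is even: $F(r,\omega)=F(-r,-\omega)$; (2) for each $k\in\mathbb{N}$ (with $0\in\mathbb{N}$), $\left(\frac{\partial}{\partial r}\right)^kF(r,\omega)\big|_{r=0}$ is (the restriction to $S^{n-1}$ of) a homogeneous polynomial of degree $k$ in $\omega$; (3) for all $k,l\in\mathbb{N}$ and each differential operator $D_\omega$ on the sphere, $$|F|_{k,l,D_\omega}:=\sup_{(r,\omega)\in\mathbb{R}\times S^{n-1}}(1+|r|^2)^k\left|\left(\frac{\partial}{\partial r}\right)^lD_\omega F(r,\omega)\right|<\infty.$$ Its topology is given by the seminorms $|\cdot|_{k,l,D_\omega}$.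 *)

(* Defs.v *)
From HB Require Import structures.
From mathcomp Require Import all_boot all_order all_algebra.
From mathcomp Require Import complex.
From mathcomp Require Import -(notations) mpoly.
From mathcomp Require Import all_classical all_reals all_analysis.

Set Implicit Arguments.
Unset Strict Implicit.
Unset Printing Implicit Defensive.

Import Order.TTheory GRing.Theory Num.Theory.
Import numFieldNormedType.Exports.

Local Open Scope classical_set_scope.
Local Open Scope ring_scope.
Local Open Scope complex_scope.

Section lebesgue_cons.
Context {R : realType} {n : nat}.
Local Notation RT := (measurableTypeR R).
Variable mu : {sigma_finite_measure set (n.-tuple RT) -> \bar R}.

Let consp (p : RT * n.-tuple RT) : n.+1.-tuple RT := [tuple of p.1 :: p.2].

Let measurable_consp : measurable_fun setT consp.
Proof. exact: measurable_cons. Qed.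

Definition lebesgue_cons : set (n.+1.-tuple RT) -> \bar R :=
  pushforward (lebesgue_measure \x mu)%E consp.

Let lebesgue_cons0 : lebesgue_cons set0 = 0%E.
Proof. by rewrite /lebesgue_cons /pushforward preimage_set0 measure0. Qed.

Let lebesgue_cons_ge0 A : (0 <= lebesgue_cons A)%E.
Proof. exact: measure_ge0. Qed.

Let lebesgue_cons_sigma_additive : semi_sigma_additive lebesgue_cons.
Proof.
move=> F mF tF mUF; rewrite /lebesgue_cons /pushforward preimage_bigcup.
have mpre k : measurable (consp @^-1` F k).
  by rewrite -[X in measurable X]setTI; exact: measurable_consp.
apply: measure_semi_sigma_additive => //.
- apply/trivIsetP => /= i j _ _ ij; rewrite -preimage_setI.
  by move/trivIsetP : tF => /(_ _ _ _ _ ij) ->//; rewrite preimage_set0.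
- exact: bigcup_measurable.
Qed.

HB.instance Definition _ := isMeasure.Build _ _ _ lebesgue_cons
  lebesgue_cons0 lebesgue_cons_ge0 lebesgue_cons_sigma_additive.

Let lebesgue_cons_sigma_finite : sigma_finite setT lebesgue_cons.
Proof.
have [F TF mF] : sigma_finite setT (lebesgue_measure \x mu)%E.
  have /sigma_finiteP[A [TA ndA Aoo]] := sigma_finiteT (@lebesgue_measure R).
  have /sigma_finiteP[B [TB ndB Boo]] := sigma_finiteT mu.
  exists (fun k => A k `*` B k).
    rewrite -setXTT TA TB predeqE => -[x y]; split; last first.
      by move=> [k _ []/= ? ?]; split; exists k.
    move=> [/= [k _ Akx] [l _ Bly]]; exists (maxn k l) => //; split.
    - by move: x Akx; exact/subsetPset/ndA/leq_maxl.
    - by move: y Bly; exact/subsetPset/ndB/leq_maxr.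
  move=> k; have [? ?] := Aoo k; have [? ?] := Boo k.
  split; first exact: measurableX.
  by rewrite product_measure1E// lte_mul_pinfty// ge0_fin_numE.
pose unc (t : n.+1.-tuple RT) : RT * n.-tuple RT :=
  (thead t, [tuple of behead t]).
have munc : measurable_fun setT unc.
  apply/measurable_fun_pairP; split; first exact: (measurable_tnth ord0).
  exact: measurable_behead.
have consK : cancel consp unc.
  by case=> x t; congr pair; apply/val_inj.
exists (fun k => unc @^-1` F k).
  by rewrite -preimage_bigcup -TF preimage_setT.
move=> k; have [mFk Fk] := mF k; split.
  by rewrite -[X in measurable X]setTI; exact: munc.
rewrite /lebesgue_cons /pushforward -comp_preimage.
by rewrite (_ : unc \o consp = id)//; apply/funext => p /=; exact: consK.
Qed.

HB.instance Definition _ := Measure_isSigmaFinite.Build _ _ _ lebesgue_cons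
  lebesgue_cons_sigma_finite.

End lebesgue_cons.

(* The [n]-fold product of the one-dimensional Lebesgue measure. *)
Fixpoint lebesgue_tuple (R : realType) (n : nat) :
    {sigma_finite_measure set (n.-tuple (measurableTypeR R)) -> \bar R} :=
  if n isn't m.+1 then \d_([tuple] : 0.-tuple (measurableTypeR R))
  else lebesgue_cons (lebesgue_tuple R m).

Definition tuple_row (R : realType) (n : nat) (t : n.-tuple R) : 'rV[R]_n :=
  \row_j tnth t j.

(* The integral over [R^n], taken componentwise on a complex-valued function. *)
Definition integral_Rn (R : realType) (n : nat) (f : 'rV[R]_n -> R[i]) : R[i] :=
  (\int[lebesgue_tuple R n]_t complex.Re (f (tuple_row t))) +i*
  (\int[lebesgue_tuple R n]_t complex.Im (f (tuple_row t))).

Section smoothness.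
Context {R : realType} {V : normedModType R}.
Implicit Types (f g : V -> R[i]) (U : set V).

Definition dirderive (v : V) f : V -> R[i] :=
  fun x => 'D_v (@complex.Re R \o f) x +i* 'D_v (@complex.Im R \o f) x.

Definition iter_dirderive (vs : seq V) f : V -> R[i] := foldr dirderive f vs.

(* For finite-dimensional [V] and open [U] this is membership in [C^oo(U)]: all
   iterated directional derivatives exist and are differentiable, hence
   continuous, at every point of [U]. *)
Definition smooth_on U f : Prop := forall (vs : seq V) (x : V), U x ->
  differentiable (@complex.Re R \o iter_dirderive vs f) x /\
  differentiable (@complex.Im R \o iter_dirderive vs f) x.

(* Smoothness of a function on a submanifold of [V], given by its inclusion
   [iota]: the function extends locally to a smooth function on an open subset
   of [V]. *)
Definition smooth_along (T : Type) (iota : T -> V) (F : T -> R[i]) : Prop :=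
  forall t : T, exists (U : set V) (g : V -> R[i]),
    [/\ open U, U (iota t), smooth_on U g &
        forall s : T, U (iota s) -> F s = g (iota s)].

End smoothness.

Section seminorm_topology.
Context {R : realType} {I : Type} {E : zmodType} {T : Type}.
Variables (emb : T -> E) (p : I -> E -> R).

Definition seminorm_open : set_system T :=
  [set U | forall f, U f -> exists (J : set I) (e : R), [/\ finite_set J, 0 < e &
     forall g, (forall i, J i -> p i (emb g - emb f) < e) -> U g]].

Lemma seminorm_openT : seminorm_open setT.
Proof. by move=> f _; exists set0, 1; split. Qed.

Lemma seminorm_openI : setI_closed seminorm_open.
Proof.
move=> U W oU oW f [Uf Wf].
have [J [e [finJ e0 JU]]] := oU f Uf; have [K [d [finK d0 KW]]] := oW f Wf.
exists (J `|` K), (Num.min e d); split.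
- by rewrite finite_setU.
- by rewrite lt_min e0.
- move=> g gfp; split; [apply: JU => i Ji|apply: KW => i Ki].
    by have := gfp i (or_introl Ji); rewrite lt_min => /andP[].
  by have := gfp i (or_intror Ki); rewrite lt_min => /andP[].
Qed.

Lemma seminorm_open_bigU (K : Type) (U : K -> set T) :
  (forall k, seminorm_open (U k)) -> seminorm_open (\bigcup_k U k).
Proof.
move=> oU f [k _ Ukf]; have [J [e [finJ e0 JU]]] := oU k f Ukf.
by exists J, e; split => // g /JU; exists k.
Qed.

End seminorm_topology.

Section schwartz.
Context {R : realType} {n : nat}.
Implicit Type f : 'rV[R]_n -> R[i].

(* The partial derivative of [f] along the coordinates listed in [s]; every
   mixed partial derivative arises from a sequence of coordinate indices. *)
Definition partial (s : seq 'I_n) f : 'rV[R]_n -> R[i] :=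
  iter_dirderive [seq delta_mx 0 j | j <- s] f.

(* The index [(a, s)] stands for the seminorm [sup_x |x^a (partial s f) x|]. *)
Definition schwartz_index : Type := (('I_n -> nat) * seq 'I_n)%type.

Definition schwartz_weight (i : schwartz_index) f (x : 'rV[R]_n) : R :=
  ComplexField.Normc.normc ((\prod_j x 0 j ^+ i.1 j)%:C * partial i.2 f x).

Definition schwartz_seminorm (i : schwartz_index) f : R :=
  sup (range (schwartz_weight i f)).

Definition is_schwartz f : Prop :=
  smooth_on setT f /\ forall i, has_ubound (range (schwartz_weight i f)).

End schwartz.

Record schwartz (R : realType) (n : nat) : Type := Schwartz {
  schwartz_fun :> 'rV[R]_n -> R[i];
  schwartzP : is_schwartz schwartz_fun }.

HB.instance Definition _ R n := gen_eqMixin (schwartz R n).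
HB.instance Definition _ R n := gen_choiceMixin (schwartz R n).
HB.instance Definition _ (R : realType) n :=
  @isOpenTopological.Build (schwartz R n)
    (seminorm_open (@schwartz_fun R n) schwartz_seminorm)
    (seminorm_openT _ _) (@seminorm_openI _ _ _ _ _ _)
    (@seminorm_open_bigU _ _ _ _ _ _).

(* The library norm on ['rV[R]_n] is the sup norm, hence the explicit Euclidean
   product. *)
Definition dotp (R : realType) (n : nat) (x y : 'rV[R]_n) : R :=
  \sum_j x 0 j * y 0 j.

Definition sphere (R : realType) (n : nat) : Type :=
  {x : 'rV[R]_n | dotp x x == 1}.

Section sphere.
Context {R : realType} {n : nat}.
Local Notation S := (sphere R n).

Lemma sphere_oppP (w : S) : dotp (- val w) (- val w) == 1.
Proof.
apply/eqP; rewrite -[RHS](eqP (valP w)).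
by apply: eq_bigr => j _; rewrite !mxE mulrNN.
Qed.

Definition sphere_opp (w : S) : S := exist _ (- val w) (sphere_oppP w).

Definition smooth_sphere (u : S -> R[i]) : Prop :=
  smooth_along (val : S -> 'rV[R]_n) u.

Definition smooth_tangent_field (X : S -> 'rV[R]_n) : Prop :=
  (forall w, dotp (X w) (val w) = 0) /\
  (forall j, smooth_sphere (fun w => (X w 0 j)%:C)).

(* [x |-> u (x / |x|)], with value [0] at the origin. *)
Definition radial_extension (u : S -> R[i]) (x : 'rV[R]_n) : R[i] :=
  oapp u 0 (insub ((Num.sqrt (dotp x x))^-1 *: x) : option S).

(* The action of a tangent vector field on functions. As [X w] is tangent at
   [w], the derivative does not depend on the choice of the extension of [u]. *)
Definition field_derive (X : S -> 'rV[R]_n) (u : S -> R[i]) (w : S) : R[i] :=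
  dirderive (X w) (radial_extension u) (val w).

(* The linear differential operators with smooth coefficients form the algebra
   generated by the multiplications by smooth functions and by the smooth vector
   fields. *)
Inductive sphere_diffop : ((S -> R[i]) -> S -> R[i]) -> Prop :=
| diffop_mul a : smooth_sphere a -> sphere_diffop (fun u w => a w * u w)
| diffop_field X : smooth_tangent_field X -> sphere_diffop (field_derive X)
| diffop_add D1 D2 : sphere_diffop D1 -> sphere_diffop D2 ->
    sphere_diffop (fun u w => D1 u w + D2 u w)
| diffop_comp D1 D2 : sphere_diffop D1 -> sphere_diffop D2 ->
    sphere_diffop (fun u => D1 (D2 u)).

Implicit Type F : R * S -> R[i].

Definition smooth_cylinder F : Prop :=
  smooth_along (fun q : R * S => (q.1, val q.2) : R * 'rV[R]_n) F.

Definition radial_derive (l : nat) F : R * S -> R[i] := fun q =>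
  derive1n l (fun r => complex.Re (F (r, q.2))) q.1 +i*
  derive1n l (fun r => complex.Im (F (r, q.2))) q.1.

Definition spherical_derive (D : (S -> R[i]) -> S -> R[i]) F : R * S -> R[i] :=
  fun q => D (fun w => F (q.1, w)) q.2.

(* The index [(k, l, D)] stands for the seminorm [|.|_{k,l,D}]. *)
Definition schwartzH_index : Type :=
  (nat * nat * {D : (S -> R[i]) -> S -> R[i] | sphere_diffop D})%type.

Definition schwartzH_weight (i : schwartzH_index) F (q : R * S) : R :=
  (1 + q.1 ^+ 2) ^+ i.1.1 *
  ComplexField.Normc.normc (radial_derive i.1.2 (spherical_derive (sval i.2) F) q).

Definition schwartzH_seminorm (i : schwartzH_index) F : R :=
  sup (range (schwartzH_weight i F)).

Definition is_schwartzH F : Prop :=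
  [/\ smooth_cylinder F,
      forall r w, F (r, w) = F (- r, sphere_opp w),
      forall k : nat, exists2 P : mpoly n R[i], P \is ishomog1 k (@mdeg n) &
        forall w, radial_derive k F (0, w) =
          meval (fun j => ((val w : 'rV[R]_n) 0 j)%:C) P &
      forall i, has_ubound (range (schwartzH_weight i F))].

End sphere.

Record schwartzH (R : realType) (n : nat) : Type := SchwartzH {
  schwartzH_fun :> R * sphere R n -> R[i];
  schwartzHP : is_schwartzH schwartzH_fun }.

HB.instance Definition _ R n := gen_eqMixin (schwartzH R n).
HB.instance Definition _ R n := gen_choiceMixin (schwartzH R n).
HB.instance Definition _ (R : realType) n :=
  @isOpenTopological.Build (schwartzH R n)
    (seminorm_open (@schwartzH_fun R n) schwartzH_seminorm)
    (seminorm_openT _ _) (@seminorm_openI _ _ _ _ _ _)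
    (@seminorm_open_bigU _ _ _ _ _ _).

Definition expi (R : realType) (t : R) : R[i] := cos t +i* sin t.

Definition fourierG (R : realType) (n : nat) (f : 'rV[R]_n -> R[i]) :
    R * sphere R n -> R[i] :=
  fun q => integral_Rn
    (fun x => f x * expi (- (2 * pi * q.1 * dotp x (val q.2)))).

(* Main.v *)
(* The transform factors as polar coordinates after the Euclidean Fourier
   transform: [F_G f (r, w)] is the value of the transform of [f] at [r w]. The
   Fourier transform is an isomorphism of the Schwartz space: inversion in one
   variable comes from damping the inverse integral by [exp (- e |t|)], which
   turns it into a convolution with the Poisson kernel, and in [n] variables from
   Fubini and induction. It remains to see that [g |-> g (r w)] is an isomorphism
   of the Schwartz space onto the space on the cylinder. Given [F] there, put
   [g x = F (|x|, x / |x|)]. Off the origin,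
   [d_j g (r w) = w_j d_r F (r, w) + r^-1 X_j F (r, w)] with [X_j] the tangential
   part of the [j]-th coordinate field. As [F (0, .)] is constant, [X_j F] vanishes
   at [r = 0] and may be divided smoothly by [r] (Hadamard), with control of the
   seminorms; by Euler's identity the Taylor coefficients of the result at [r = 0]
   are the partial derivatives of those of [F], so it satisfies the homogeneity
   condition again. Hence [F |-> d_j g] maps the cylinder space to itself
   continuously, and iterating it gives smoothness of [g] at the origin and all
   the Schwartz bounds. *)

From HB Require Import structures.
From mathcomp Require Import all_boot all_order all_algebra.
From mathcomp Require Import complex.
From mathcomp Require Import -(notations) mpoly.
From mathcomp Require Import all_classical all_reals all_analysis.
From mathcomp Require Import measurable_realfun ring lra.
Require Import Defs.

Set Implicit Arguments.
Unset Strict Implicit.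
Unset Printing Implicit Defensive.

Import Order.TTheory GRing.Theory Num.Theory.
Import numFieldNormedType.Exports.

Local Open Scope classical_set_scope.
Local Open Scope ring_scope.

(** * Differentiable functions of class C^k *)

(** Polar coordinates are singular at the origin, and the chain rule gives the derivatives of [g]
    only off [0]. Differentiability there comes from a C^1 criterion that asks for continuity at the
    point and, elsewhere, for derivatives with a uniform limit; the stability of the cylinder space
    allows it to be applied again to every derivative. On the side of the integrals, all integrands
    over [R^n] are continuous and bounded by a multiple of the product of the [1 / (1 + x_j^2)]. The
    product form makes slices and partial integrals dominated in the same way, so that Fubini holds
    with every slice integrable and the induction on [n] goes through. The damping is exponential
    because its cosine and sine integrals have elementary primitives, while the mass of the Poisson
    kernel is read off from the arctangent. Continuity of operators is handled by pointwise
    estimates of weights against finitely many weights, which compose; suprema and topologies return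
    only at the very end. *)

Section line_derivative.
Context {R : realType} {V : normedModType R}.
Implicit Types (f : V -> R) (x v : V).

Lemma line_quotient f x v (s : R) :
  (fun h => h^-1 *: (((fun t => f (x + t *: v)) \o shift s) (h *: 1) -
                      f (x + s *: v))) =
  (fun h => h^-1 *: ((f \o shift (x + s *: v)) (h *: v) - f (x + s *: v))).
Proof.
apply/funext => h /=; congr (_ *: (f _ - _)).
by rewrite [h *: 1]mulr1 scalerDl addrCA.
Qed.

Lemma is_derive_line f x v s d :
  is_derive (x + s *: v) v f d -> is_derive s 1 (fun t => f (x + t *: v)) d.
Proof.
move=> [df fd]; split; first by rewrite /derivable line_quotient.
by rewrite /derive line_quotient.
Qed.

(** Differentiability is asked inside the segment and continuity up to its ends, so that an end may
    be a point where no derivative is known, as [x] in [differentiable_of_derive]. *)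
Lemma MVT_line f x v (d : R -> R) :
  (forall s, s \in `]0, 1[%R -> is_derive (x + s *: v) v f (d s)) ->
  {within `[0, 1]%classic, continuous (fun s => f (x + s *: v))} ->
  exists2 s, s \in `]0, 1[%R & f (x + v) - f x = d s.
Proof.
move=> df cf.
have [s s01|s s01] := @MVT _ (fun t => f (x + t *: v)) d 0 1 ltr01 _ cf.
  by apply: is_derive_line; exact: df.
by rewrite scale1r scale0r addr0 subr0 mulr1; exists s.
Qed.

Lemma continuous_line f x v s : {for x + s *: v, continuous f} ->
  {for s, continuous (fun t : R => f (x + t *: v))}.
Proof.
move=> cf; apply: continuous_comp => //.
apply: cvgD; first exact: cvg_cst.
by apply: cvgZr_tmp; exact: cvg_id.
Qed.

Lemma is_derive_continuous_line f x v s d :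
  is_derive (x + s *: v) v f d ->
  {for s, continuous (fun t : R => f (x + t *: v))}.
Proof.
move=> /is_derive_line[/derivable1_diffP df _].
exact: differentiable_continuous df.
Qed.

End line_derivative.

Section C1_criterion.
Context {R : realType} {V : normedModType R}.

(** By the mean value theorem the increment [f (x + h) - f x] is [L y h] for some [y] on the
    segment, and [L y h] differs from [L x h] by at most [e |h|]. No derivative at [x] itself is
    assumed, which is what the origin of polar coordinates requires. *)
Lemma differentiable_of_derive (f : V -> R) (x : V) (L : V -> V -> R)
    (Lx : {linear V -> R}) :
  Lx =1 L x -> continuous Lx -> {for x, continuous f} ->
  (\forall y \near x, y != x -> forall v, is_derive y v f (L y v)) ->
  (forall e, 0 < e -> \forall y \near x, forall v,
     `|L y v - L x v| <= e * `|v|) ->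
  differentiable f x /\ 'd f x = L x :> (V -> R).
Proof.
move=> LxE cL cf df cLy.
have H : f \o shift x = cst (f x) + Lx +o_ (0 : V) id.
  apply/eqaddoP => _/posnumP[e].
  have /nbhs_ballP[d /= d0 Hd] : \forall y \near x,
      (y != x -> forall v, is_derive y v f (L y v)) /\
      (forall v, `|L y v - L x v| <= e%:num * `|v|).
    by apply: filterI => //; exact: cLy.
  apply/nbhs_ballP; exists d => // h; rewrite -ball_normE /ball_ /= sub0r normrN => hd.
  have [->|h0] := eqVneq h 0.
    by rewrite !fctE /cst /= add0r linear0 addr0 subrr !normr0 mulr0.
  have near_seg s : s \in `[0, 1]%R -> ball x d (x + s *: h).
    move=> /[!in_itv]/= /andP[s0 s1]; rewrite -ball_normE /ball_ /=.
    rewrite opprD addNKr normrN normrZ ger0_norm//.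
    by rewrite (le_lt_trans _ hd)// ler_piMl.
  have der s : s \in `]0, 1[%R -> is_derive (x + s *: h) h f (L (x + s *: h) h).
    move=> s01; have [H1 _] := Hd _ (near_seg _ (subset_itv_oo_cc s01)).
    apply: H1; rewrite -subr_eq0 addrC addKr scaler_eq0 negb_or h0 andbT.
    by move: s01; rewrite in_itv/= => /andP[/lt0r_neq0].
  have [|s s01 E] := MVT_line der.
    apply: continuous_in_subspaceT => s.
    rewrite mem_setE => s01.
    have [->|s0] := eqVneq s 0.
      by apply: continuous_line; rewrite scale0r addr0.
    have [H1 _] := Hd _ (near_seg _ s01).
    apply: (@is_derive_continuous_line _ _ f x h s); apply: H1.
    by rewrite -subr_eq0 addrC addKr scaler_eq0 negb_or s0.
  have [_ H2] := Hd _ (near_seg _ (subset_itv_oo_cc s01)).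
  rewrite !fctE /cst /= opprD addrA [h + x]addrC E LxE.
  exact: H2.
by have dE := diff_unique cL H; split; [apply/diff_locallyP; rewrite dE; split|rewrite dE; apply/funext].
Qed.

End C1_criterion.

Section Clairaut.
Context {R : realType} {V : normedModType R}.

(** The mean value theorem for [y |-> f (y + v) - f y] along [u], then for ['D_u f] along [v]. *)
Lemma derive_second_difference (f : V -> R) (x u v : V) (U : set V) :
  (forall s t, s \in `[0, 1]%R -> t \in `[0, 1]%R -> U (x + s *: u + t *: v)) ->
  (forall y, U y -> differentiable f y) ->
  (forall y, U y -> differentiable ('D_u f) y) ->
  exists s t, [/\ s \in `[0, 1]%R, t \in `[0, 1]%R &
    f (x + u + v) - f (x + u) - (f (x + v) - f x) =
    'D_v ('D_u f) (x + s *: u + t *: v)].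
Proof.
move=> Uxy df ddf.
have I0 : 0 \in `[0, 1 : R]%R by rewrite in_itv/= lexx ler01.
have I1 : 1 \in `[0, 1 : R]%R by rewrite in_itv/= lexx ler01.
have Ux s : s \in `[0, 1]%R -> U (x + s *: u).
  by move=> s01; have := Uxy _ _ s01 I0; rewrite scale0r addr0.
have Uxv s : s \in `[0, 1]%R -> U (x + s *: u + v).
  by move=> s01; have := Uxy _ _ s01 I1; rewrite scale1r.
pose g (y : V) := f (y + v) - f y.
have dg s : s \in `[0, 1]%R ->
    is_derive (x + s *: u) u g ('D_u f (x + s *: u + v) - 'D_u f (x + s *: u)).
  move=> s01.
  have dfv : is_derive (x + s *: u) u (fun y => f (y + v)) ('D_u f (x + s *: u + v)).
    have : derivable f (x + s *: u + v) u by apply: diff_derivable; apply: df; exact: Uxv.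
    rewrite /derivable => cv.
    have E : (fun h : R => h^-1 *: (((fun y => f (y + v)) \o shift (x + s *: u)) (h *: u) - f (x + s *: u + v)))
      = (fun h => h^-1 *: ((f \o shift (x + s *: u + v)) (h *: u) - f (x + s *: u + v))).
      by apply/funext => h /=; rewrite -addrA.
    by split; rewrite /derivable /derive E.
  apply: is_deriveB; apply: derivableP; apply: diff_derivable; apply: df.
  exact: Ux.
have dg' s (s01 : s \in `]0, 1[%R) := dg s (subset_itv_oo_cc s01).
have [|s s01 E] := MVT_line dg'.
  apply: continuous_in_subspaceT => s; rewrite mem_setE => s01.
  exact: is_derive_continuous_line (dg _ s01).
have {}s01 := subset_itv_oo_cc s01.
have ddg t : t \in `]0, 1[%R -> is_derive (x + s *: u + t *: v) v ('D_u f)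
    ('D_v ('D_u f) (x + s *: u + t *: v)).
  move=> t01; apply: derivableP; apply: diff_derivable; apply: ddf; apply: Uxy => //.
  exact: subset_itv_oo_cc.
have [|t t01 E'] := MVT_line ddg.
  apply: continuous_in_subspaceT => t; rewrite mem_setE => t01.
  apply: (@continuous_line _ _ ('D_u f) (x + s *: u) v t).
  by apply: differentiable_continuous; apply: ddf; exact: Uxy.
exists s, t; split => //; first exact: subset_itv_oo_cc.
by rewrite -E' -E /g.
Qed.

(** The second difference is symmetric in [u] and [v]. With sides [r u] and [r v] it is [r^2] times
    either mixed derivative, each at some point near [x]; after cancelling [r^2], continuity at [x]
    concludes. *)
Lemma derive_comm (f : V -> R) (x u v : V) (U : set V) : open U -> U x ->
  (forall y, U y -> differentiable f y) ->
  (forall w y, U y -> differentiable ('D_w f) y) ->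
  {for x, continuous ('D_v ('D_u f))} -> {for x, continuous ('D_u ('D_v f))} ->
  'D_v ('D_u f) x = 'D_u ('D_v f) x.
Proof.
move=> oU Ux df ddf cvu cuv.
apply/eqP; rewrite -subr_eq0 -normr_le0; apply/ler_addgt0Pl => e e0; rewrite addr0.
have e20 : 0 < e / 2 by rewrite divr_gt0.
have /nbhs_ballP[d /= d0 Hd] : \forall y \near x,
    (U y /\ `|'D_v ('D_u f) x - 'D_v ('D_u f) y| <= e / 2) /\
    `|'D_u ('D_v f) x - 'D_u ('D_v f) y| <= e / 2.
  apply: filterI; last by move/cvgrPdist_le: cuv; exact.
  by apply: filterI; [exact: open_nbhs_nbhs|move/cvgrPdist_le: cvu; exact].
(* The [+ 1] keeps [M] positive; with [r * M < d] the parallelogram on [r u] and [r v] lies in the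
   ball of radius [d]. *)
pose M := `|u| + `|v| + 1.
have M0 : 0 < M by rewrite /M ltr_wpDl// addr_ge0.
have [r r0 rM] : exists2 r, 0 < r & r * M < d.
  exists (d / 2 / M); first by rewrite !divr_gt0.
  by rewrite divfK ?gt_eqF// ltr_pdivrMr// mulr2n mulrDr mulr1 ltrDl.
have inb a b s t : `|a| + `|b| <= M -> s \in `[0, 1]%R -> t \in `[0, 1]%R ->
    ball x d (x + s *: (r *: a) + t *: (r *: b)).
  move=> abM; rewrite !in_itv/= => /andP[s0 s1] /andP[t0 t1].
  rewrite -ball_normE /ball_ /= -addrA opprD addNKr normrN.
  rewrite (le_lt_trans (ler_normD _ _))// !normrZ !ger0_norm// ?(ltW r0)//.
  apply: le_lt_trans rM; rewrite (le_trans _ (ler_wpM2l (ltW r0) abM))// mulrDr.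
  by apply: lerD; rewrite ler_piMl// mulr_ge0// ltW.
have DZ w g y : differentiable g y -> 'D_(r *: w) g y = r * 'D_w g y.
  by move=> dg; rewrite !deriveE// linearZ.
have DDZ a b p : U p -> 'D_(r *: b) ('D_(r *: a) f) p = r ^+ 2 * 'D_b ('D_a f) p.
  move=> Up; rewrite (@near_eq_derive _ _ _ _ (r \*: 'D_a f)); last first.
    by near=> y; rewrite DZ//; apply: df; near: y; exact: open_nbhs_nbhs.
  rewrite deriveZ; last by apply: diff_derivable; exact: ddf.
  by rewrite DZ; [rewrite [LHS]mulrA -expr2|exact: ddf].
have key a b : `|a| + `|b| <= M -> exists p, [/\ ball x d p &
    f (x + r *: a + r *: b) - f (x + r *: a) - (f (x + r *: b) - f x) =
    r ^+ 2 * 'D_b ('D_a f) p].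
  move=> abM.
  have [|||s [t [s01 t01 ->]]] := @derive_second_difference f x (r *: a) (r *: b) U.
  - by move=> s t s01 t01; have [[]] := Hd _ (inb _ _ _ _ abM s01 t01).
  - exact: df.
  - by move=> y Uy; exact: ddf.
  have bp := inb _ _ _ _ abM s01 t01.
  exists (x + s *: (r *: a) + t *: (r *: b)); split => //; apply: DDZ.
  by have [[]] := Hd _ bp.
have [|p [bp Ep]] := key u v; first by rewrite /M lerDl.
have [|q [bq]] := key v u; first by rewrite /M [`|u| + _]addrC lerDl.
rewrite (_ : x + r *: v + r *: u = x + r *: u + r *: v); last by rewrite addrAC.
have [[_ H1] _] := Hd _ bp; have [_ H2] := Hd _ bq.
move: H1 H2 Ep; move: ('D_v _ p) ('D_u _ q).
move: ('D_v _ x) ('D_u _ x) => A B C D AC BD EC ED.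
have CD : C = D.
  apply: (@mulfI _ (r ^+ 2)); first by rewrite expf_neq0 ?gt_eqF.
  by rewrite -EC -ED; ring.
rewrite [e]splitr (le_trans (ler_distD C A B))// lerD// distrC CD.
exact: BD.
Unshelve. all: by end_near. Qed.

End Clairaut.

Section Ck.
Context {R : realType}.

(** Level [0] already asks for differentiability, so the conjunction over all levels is the
    condition in [smooth_on] (see [CooP]). The finite levels serve induction: the derivative of a
    product or a composite at level [k.+1] involves functions known at level [k]. *)
Fixpoint Ck (V : normedModType R) (k : nat) (U : set V) (f : V -> R) : Prop :=
  (forall x, U x -> differentiable f x) /\
  (if k is k'.+1 then forall v, Ck k' U ('D_v f) else True).

Definition Coo (V : normedModType R) (U : set V) (f : V -> R) : Prop :=
  forall k, Ck k U f.

Section basics.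
Context {V : normedModType R}.
Implicit Types (f g : V -> R) (U W : set V) (k : nat).

Lemma Ck_differentiable k U f x : Ck k U f -> U x -> differentiable f x.
Proof. by case: k => [|k] [+ _]; apply. Qed.

Lemma CkS k U f : Ck k.+1 U f -> Ck k U f.
Proof.
elim: k f => [|k IH] f [df ddf]; first by split.
by split => // v; apply: IH; exact: ddf.
Qed.

Lemma near_open U (P : V -> Prop) x : open U -> U x -> (forall y, U y -> P y) ->
  \forall y \near x, P y.
Proof.
by move=> oU Ux UP; apply: filterS UP _; exact: open_nbhs_nbhs.
Qed.

Lemma near_eq_differentiable f g x :
  (\forall y \near x, f y = g y) -> differentiable f x -> differentiable g x.
Proof.
move=> fg df.
suff [] : differentiable g x /\ 'd g x = 'd f x :> (V -> R) by [].
have H : g \o shift x = cst (g x) + 'd f x +o_ (0 : V) id.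
  apply/eqaddoP => _/posnumP[e].
  have /diff_locallyP[_ /eqaddoP/(_ e%:num [gt0 of e%:num])] := df.
  apply: filter_app.
  have : \forall h \near 0 , f (h + x) = g (h + x).
    move: fg; rewrite [in X in X -> _](near_shift 0 x).
    by apply: filterS => h /=; rewrite subr0.
  apply: filterS => h fgh.
  by rewrite !fctE /= fgh /cst (nbhs_singleton fg).
have dE := diff_unique (diff_continuous df) H.
by split => //; apply/diff_locallyP; rewrite dE; split => //; exact: diff_continuous.
Qed.

Lemma Ck_eq k U f g : open U -> (forall x, U x -> f x = g x) -> Ck k U f -> Ck k U g.
Proof.
move=> oU; elim: k f g => [|k IH] f g fg [df ddf]; split => //.
- move=> x Ux; apply: (@near_eq_differentiable f); last exact: df.
  exact: near_open fg.
- move=> x Ux; apply: (@near_eq_differentiable f); last exact: df.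
  exact: near_open fg.
- move=> v; apply: IH (ddf v) => x Ux.
  by apply: near_eq_derive; exact: near_open fg.
Qed.

Lemma Ck_cst k U (c : R) : Ck k U (fun=> c).
Proof.
elim: k c => [|k IH] c; split => //; try by move=> x _; exact: differentiable_cst.
move=> v; rewrite (_ : 'D_v _ = fun=> 0)//.
by apply/funext => x; rewrite derive_cst.
Qed.

Lemma CkD k U f g : open U -> Ck k U f -> Ck k U g -> Ck k U (fun x => f x + g x).
Proof.
move=> oU; elim: k f g => [|k IH] f g [df ddf] [dg ddg]; split => //.
- by move=> x Ux; apply: differentiableD; [exact: df|exact: dg].
- by move=> x Ux; apply: differentiableD; [exact: df|exact: dg].
- move=> v; apply: Ck_eq (IH _ _ (ddf v) (ddg v)) => // x Ux.
  by rewrite deriveD//; apply: diff_derivable; [exact: df|exact: dg].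
Qed.

Lemma CkM k U f g : open U -> Ck k U f -> Ck k U g -> Ck k U (fun x => f x * g x).
Proof.
move=> oU; elim: k f g => [|k IH] f g.
  move=> [df _] [dg _]; split => // x Ux.
  by apply: differentiableM; [exact: df|exact: dg].
move=> Cf Cg; have [df ddf] := Cf; have [dg ddg] := Cg; split.
  by move=> x Ux; apply: differentiableM; [exact: df|exact: dg].
move=> v; apply: (@Ck_eq _ _ (fun x => f x * 'D_v g x + g x * 'D_v f x)) => //.
  move=> x Ux; rewrite deriveM//; apply: diff_derivable; [exact: df|exact: dg].
by apply: CkD => //; apply: IH => //; by [exact: ddf|exact: ddg|exact: CkS].
Qed.

Lemma CkZ k U (c : R) f : open U -> Ck k U f -> Ck k U (fun x => c * f x).
Proof. by move=> oU; apply: CkM => //; exact: Ck_cst. Qed.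

Lemma CkN k U f : open U -> Ck k U f -> Ck k U (fun x => - f x).
Proof.
move=> oU Cf; apply: (@Ck_eq _ _ (fun x => (-1) * f x)) => //.
  by move=> x _; rewrite mulN1r.
exact: CkZ.
Qed.

Lemma CkB k U f g : open U -> Ck k U f -> Ck k U g -> Ck k U (fun x => f x - g x).
Proof. by move=> oU Cf Cg; apply: CkD => //; exact: CkN. Qed.

Lemma Ck_sum k U (I : Type) (s : seq I) (f : I -> V -> R) : open U ->
  (forall i, Ck k U (f i)) -> Ck k U (fun x => \sum_(i <- s) f i x).
Proof.
move=> oU Cf; elim: s => [|i s IH].
  by apply: (@Ck_eq _ _ (fun=> 0)) => //; [move=> x _; rewrite big_nil|exact: Ck_cst].
apply: (@Ck_eq _ _ (fun x => f i x + \sum_(i <- s) f i x)) => //.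
  by move=> x _; rewrite big_cons.
exact: CkD.
Qed.

Lemma CkV k U f : open U -> (forall x, U x -> f x != 0) -> Ck k U f ->
  Ck k U (fun x => (f x)^-1).
Proof.
move=> oU f0; elim: k => [|k IH] Cf.
  by split => // x Ux; apply: differentiableV; [exact: Ck_differentiable Cf Ux|exact: f0].
have [df ddf] := Cf; split.
  by move=> x Ux; apply: differentiableV; [exact: df|exact: f0].
have CV := IH (CkS Cf).
move=> v; apply: (@Ck_eq _ _ (fun x => - ((f x)^-1 * (f x)^-1 * 'D_v f x))) => //.
  move=> x Ux; rewrite deriveV ?f0//; last by apply: diff_derivable; exact: df.
  by rewrite -[RHS]/(_ * _) mulNr expr2 invfM.
by apply: CkN => //; apply: CkM => //; [exact: CkM|exact: ddf].
Qed.

Lemma Ck_linear k U (f : {linear V -> R}) : continuous f -> Ck k U f.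
Proof.
move=> cf.
have df x : differentiable f x by exact: linear_differentiable.
case: k => [|k]; split => // v.
rewrite (_ : 'D_v f = fun=> f v); first exact: Ck_cst.
by apply/funext => x; rewrite deriveE// diff_lin.
Qed.

End basics.

Section composition.
Context {V W : normedModType R}.

(** Maps between normed spaces are written as combinations of fixed vectors with scalar
    coefficients. The chain rule then only involves real-valued functions, and no notion of
    smoothness for vector-valued maps has to be developed. *)
Lemma derive_lincomb m (b : 'I_m -> W) (phi : 'I_m -> V -> R) (x v : V) :
  (forall j, differentiable (phi j) x) ->
  differentiable (fun y => \sum_j phi j y *: b j) x /\
  'd (fun y => \sum_j phi j y *: b j) x v = \sum_j 'D_v (phi j) x *: b j.
Proof.
move=> dphi.
have dj j : differentiable (fun y => phi j y *: b j) x by exact: differentiableZl.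
have -> : (fun y => \sum_j phi j y *: b j) = \sum_j (fun y => phi j y *: b j).
  by apply/funext => y; rewrite fct_sumE.
split; first by apply: differentiable_sum.
rewrite -deriveE; last by apply: differentiable_sum.
rewrite derive_sum; last by move=> j; exact: diff_derivable.
apply: eq_bigr => j _; rewrite deriveE// diffZl//=.
by rewrite deriveE.
Qed.

Lemma derive_comp_lincomb m (b : 'I_m -> W) (phi : 'I_m -> V -> R) (g : W -> R)
    (x v : V) :
  (forall j, differentiable (phi j) x) ->
  differentiable g (\sum_j phi j x *: b j) ->
  differentiable (fun y => g (\sum_j phi j y *: b j)) x /\
  'D_v (fun y => g (\sum_j phi j y *: b j)) x =
    \sum_j 'D_v (phi j) x * 'D_(b j) g (\sum_j phi j x *: b j).
Proof.
move=> dphi dg.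
have [d1 d2] := derive_lincomb b v dphi.
have dc : differentiable (fun y => g (\sum_j phi j y *: b j)) x.
  by apply: (@differentiable_comp _ _ _ _ (fun y => \sum_j phi j y *: b j) g).
split => //; rewrite deriveE//.
rewrite (@diff_comp _ _ _ _ (fun y => \sum_j phi j y *: b j) g)//= d2 linear_sum.
by apply: eq_bigr => j _; rewrite linearZ/= -deriveE.
Qed.

Lemma Ck_comp_lincomb k m (U : set V) (U' : set W) (b : 'I_m -> W)
    (phi : 'I_m -> V -> R) (g : W -> R) : open U ->
  (forall x, U x -> U' (\sum_j phi j x *: b j)) ->
  (forall j, Ck k U (phi j)) -> Ck k U' g ->
  Ck k U (fun y => g (\sum_j phi j y *: b j)).
Proof.
move=> oU UU'; elim: k g => [|k IH] g Cphi Cg.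
  split => // x Ux; have [] // := @derive_comp_lincomb _ b phi g x 0.
    by move=> j; exact: Ck_differentiable (Cphi j) Ux.
  exact: Ck_differentiable Cg (UU' _ Ux).
have E x v : U x -> _ := fun Ux : U x => @derive_comp_lincomb _ b phi g x v
  (fun j => Ck_differentiable (Cphi j) Ux) (Ck_differentiable Cg (UU' _ Ux)).
split; first by move=> x Ux; exact: (E x 0 Ux).1.
move=> v.
apply: (@Ck_eq _ _ _ (fun x => \sum_j 'D_v (phi j) x * 'D_(b j) g (\sum_j phi j x *: b j))) => //.
  by move=> x Ux; rewrite (E x v Ux).2.
apply: Ck_sum => // j; apply: CkM => //; first exact: (Cphi j).2.
apply: (IH ('D_(b j) g)); last exact: Cg.2.
by move=> i; apply: CkS.
Qed.

End composition.

Lemma Ck_comp1 {V : normedModType R} k (U : set V) (U' : set R) (phi : V -> R)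
    (g : R -> R) : open U -> (forall x, U x -> U' (phi x)) ->
  Ck k U phi -> Ck k (U' : set R^o) g -> Ck k U (fun y => g (phi y)).
Proof.
move=> oU UU' Cphi Cg.
have E y : \sum_(j < 1) phi y *: (1 : R^o) = phi y.
  by rewrite big_ord1 -[LHS]/(_ * _) mulr1.
have := @Ck_comp_lincomb V R^o k 1 U U' (fun=> 1) (fun=> phi) g oU.
under eq_fun do rewrite E; apply => //.
by move=> x Ux; rewrite E; exact: UU'.
Qed.

Lemma derive_comp1 {V : normedModType R} (phi : V -> R) (g : R -> R) (x v : V) :
  differentiable phi x -> differentiable g (phi x) ->
  'D_v (fun y => g (phi y)) x = 'D_v phi x * 'D_1 g (phi x).
Proof.
move=> dphi dg; have := @derive_comp_lincomb V R^o 1 (fun=> 1) (fun=> phi) g x v (fun=> dphi).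
have E y : \sum_(j < 1) phi y *: (1 : R^o) = phi y.
  by rewrite big_ord1 -[LHS]/(_ * _) mulr1.
rewrite E => /(_ dg)[_]; rewrite big_ord1 => <-.
by congr ('D_v _ x); apply/funext => y; rewrite E.
Qed.

Lemma derive_scal1 (f : R^o -> R) (x v : R^o) :
  differentiable f x -> 'D_v f x = v * 'D_1 f x.
Proof.
move=> df; rewrite !deriveE// -[RHS]linearZ/=; congr ('d f x _).
by rewrite -[RHS]/(_ * _) mulr1.
Qed.

Lemma Ck_sqrt k : Ck k ([set x : R | 0 < x] : set R^o) Num.sqrt.
Proof.
have oU : open ([set x : R | 0 < x] : set R^o) by exact: open_gt.
have df (x : R^o) : 0 < x -> differentiable (Num.sqrt : R^o -> R) x.
  by move=> x0; apply/derivable1_diffP; have [] := is_derive1_sqrt x0.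
elim: k => [|k IH]; split => // v.
apply: (@Ck_eq _ _ _ (fun x : R^o => v * (2 * Num.sqrt x)^-1)) => //.
  by move=> x x0; rewrite derive_scal1 ?derive_sqrt//; exact: df.
apply: CkZ => //; apply: CkV => //; last by apply: CkZ.
by move=> x x0; rewrite mulf_neq0// gt_eqF// sqrtr_gt0.
Qed.

End Ck.

Local Open Scope complex_scope.

Notation cRe := (@complex.Re _).
Notation cIm := (@complex.Im _).

Section complex_parts.
Context {R : realType}.
Implicit Types x y : R[i].

Lemma Re_addc x y : complex.Re (x + y) = complex.Re x + complex.Re y.
Proof. by case: x => a b; case: y. Qed.
Lemma Im_addc x y : complex.Im (x + y) = complex.Im x + complex.Im y.
Proof. by case: x => a b; case: y. Qed.
Lemma Re_mulc x y : complex.Re (x * y) =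
  complex.Re x * complex.Re y - complex.Im x * complex.Im y.
Proof. by case: x => a b; case: y. Qed.
Lemma Im_mulc x y : complex.Im (x * y) =
  complex.Re x * complex.Im y + complex.Im x * complex.Re y.
Proof. by case: x => a b; case: y. Qed.
Lemma Re_sum (I : Type) (s : seq I) (P : pred I) (F : I -> R[i]) :
  complex.Re (\sum_(i <- s | P i) F i) = \sum_(i <- s | P i) complex.Re (F i).
Proof. by apply: (big_morph _ Re_addc). Qed.
Lemma Im_sum (I : Type) (s : seq I) (P : pred I) (F : I -> R[i]) :
  complex.Im (\sum_(i <- s | P i) F i) = \sum_(i <- s | P i) complex.Im (F i).
Proof. by apply: (big_morph _ Im_addc). Qed.
Lemma eta_complex x : x = complex.Re x +i* complex.Im x.
Proof. by case: x. Qed.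
Lemma complex_eq x y : complex.Re x = complex.Re y -> complex.Im x = complex.Im y ->
  x = y.
Proof. by case: x => a b; case: y => c d /= -> ->. Qed.

End complex_parts.

Section smooth_on_theory.
Context {R : realType} {V : normedModType R}.
Implicit Types (f g : V -> R[i]) (U : set V).

Definition cdiff f x := differentiable (cRe \o f) x /\
  differentiable (cIm \o f) x.

Lemma Coo_iter U (f : V -> R) (vs : seq V) : Coo U f ->
  Coo U (foldr (fun v (h : V -> R) => 'D_v h) f vs).
Proof. by move=> Cf; elim: vs => [|v vs IH] //= k; have [_ ] := IH k.+1; exact. Qed.

Lemma CooP U (f : V -> R) : Coo U f <->
  forall vs x, U x -> differentiable (foldr (fun v (h : V -> R) => 'D_v h) f vs) x.
Proof.
split=> [Cf vs x Ux|H k].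
  exact: (Ck_differentiable (Coo_iter vs Cf 0) Ux).
elim: k f H => [|k IH] f H.
  by split => // x Ux; exact: (H [::]).
split; first by move=> x Ux; exact: (H [::]).
by move=> v; apply: IH => vs x Ux; have := H (rcons vs v) x Ux; rewrite foldr_rcons.
Qed.

Lemma Re_iter_dirderive f vs : cRe \o iter_dirderive vs f =
  foldr (fun v (h : V -> R) => 'D_v h) (cRe \o f) vs.
Proof. by elim: vs => //= v vs <-. Qed.

Lemma Im_iter_dirderive f vs : cIm \o iter_dirderive vs f =
  foldr (fun v (h : V -> R) => 'D_v h) (cIm \o f) vs.
Proof. by elim: vs => //= v vs <-. Qed.

Lemma smooth_onP U f :
  smooth_on U f <-> Coo U (cRe \o f) /\ Coo U (cIm \o f).
Proof.
split=> [H|[/CooP Hr /CooP Hi] vs x Ux].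
  split; apply/CooP => vs x Ux; have [Hr Hi] := H vs x Ux.
    by rewrite -Re_iter_dirderive.
  by rewrite -Im_iter_dirderive.
by rewrite Re_iter_dirderive Im_iter_dirderive; split; [exact: Hr|exact: Hi].
Qed.

Lemma smooth_on_cdiff U f x : smooth_on U f -> U x -> cdiff f x.
Proof. by move=> sf Ux; exact: (sf [::]). Qed.

Lemma smooth_on_dirderive U f v : smooth_on U f -> smooth_on U (dirderive v f).
Proof.
by move=> sf vs x Ux; have := sf (rcons vs v) x Ux; rewrite /iter_dirderive foldr_rcons.
Qed.

Lemma smooth_on_iter U f vs : smooth_on U f -> smooth_on U (iter_dirderive vs f).
Proof. by move=> sf; elim: vs => //= v vs; exact: smooth_on_dirderive. Qed.

Lemma smooth_on_local U f :
  (forall x, U x -> exists W, [/\ open W, W x & smooth_on W f]) -> smooth_on U f.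
Proof. by move=> H vs x /H[W [_ Wx]]; exact. Qed.

Lemma smooth_on_eq U f g : open U -> (forall x, U x -> f x = g x) ->
  smooth_on U f -> smooth_on U g.
Proof.
move=> oU fg /smooth_onP[Cr Ci]; apply/smooth_onP; split=> k.
  by apply: Ck_eq (Cr k) => // x Ux /=; rewrite fg.
by apply: Ck_eq (Ci k) => // x Ux /=; rewrite fg.
Qed.

Lemma dirderive_eq f g x v : (\forall y \near x, f y = g y) ->
  dirderive v f x = dirderive v g x.
Proof.
move=> fg; rewrite /dirderive; congr (_ +i* _); apply: near_eq_derive.
  by apply: filterS fg => y /= ->.
by apply: filterS fg => y /= ->.
Qed.

Lemma dirderive_eq_open U f g x v : open U -> U x -> (forall y, U y -> f y = g y) ->
  dirderive v f x = dirderive v g x.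
Proof. by move=> oU Ux fg; apply: dirderive_eq; exact: near_open fg. Qed.

Lemma smooth_on_cst U (c : R[i]) : smooth_on U (fun=> c).
Proof. by apply/smooth_onP; split=> k; exact: Ck_cst. Qed.

Lemma smooth_on_real U (f : V -> R) : Coo U f -> smooth_on U (fun x => (f x)%:C).
Proof. by move=> Cf; apply/smooth_onP; split=> //= k; exact: Ck_cst. Qed.

Lemma smooth_onD U f g : open U -> smooth_on U f -> smooth_on U g ->
  smooth_on U (fun x => f x + g x).
Proof.
move=> oU /smooth_onP[fr fi] /smooth_onP[gr gi]; apply/smooth_onP; split=> k.
  by apply: Ck_eq (CkD oU (fr k) (gr k)) => // x _ /=; rewrite Re_addc.
by apply: Ck_eq (CkD oU (fi k) (gi k)) => // x _ /=; rewrite Im_addc.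
Qed.

Lemma smooth_onM U f g : open U -> smooth_on U f -> smooth_on U g ->
  smooth_on U (fun x => f x * g x).
Proof.
move=> oU /smooth_onP[fr fi] /smooth_onP[gr gi]; apply/smooth_onP; split=> k.
  apply: Ck_eq (CkB oU (CkM oU (fr k) (gr k)) (CkM oU (fi k) (gi k))) => // x _ /=.
  by rewrite Re_mulc.
apply: Ck_eq (CkD oU (CkM oU (fr k) (gi k)) (CkM oU (fi k) (gr k))) => // x _ /=.
by rewrite Im_mulc.
Qed.

Lemma smooth_on_sum U (I : Type) (s : seq I) (f : I -> V -> R[i]) : open U ->
  (forall i, smooth_on U (f i)) -> smooth_on U (fun x => \sum_(i <- s) f i x).
Proof.
move=> oU sf; elim: s => [|i s IH].
  by under eq_fun do rewrite big_nil; exact: smooth_on_cst.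
by under eq_fun do rewrite big_cons; exact: smooth_onD.
Qed.

Lemma dirderive_cst (c : R[i]) (x v : V) : dirderive v (fun=> c) x = 0.
Proof. by rewrite /dirderive /comp !derive_cst. Qed.

Lemma dirderiveD f g x v : cdiff f x -> cdiff g x ->
  dirderive v (fun y => f y + g y) x = dirderive v f x + dirderive v g x.
Proof.
move=> [fr fi] [gr gi]; rewrite /dirderive.
have -> : cRe \o (fun y => f y + g y) = (cRe \o f) + (cRe \o g).
  by apply/funext => y; rewrite /= Re_addc.
have -> : cIm \o (fun y => f y + g y) = (cIm \o f) + (cIm \o g).
  by apply/funext => y; rewrite /= Im_addc.
by rewrite !deriveD//; exact: diff_derivable.
Qed.

Lemma dirderiveM f g x v : cdiff f x -> cdiff g x ->
  dirderive v (fun y => f y * g y) x = dirderive v f x * g x + f x * dirderive v g x.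
Proof.
move=> [fr fi] [gr gi]; rewrite /dirderive.
pose fR := cRe \o f; pose fI := cIm \o f.
pose gR := cRe \o g; pose gI := cIm \o g.
have -> : cRe \o (fun y => f y * g y) = fR * gR - fI * gI.
  by apply/funext => y; rewrite /= Re_mulc.
have -> : cIm \o (fun y => f y * g y) = fR * gI + fI * gR.
  by apply/funext => y; rewrite /= Im_mulc.
have [d1 d2 d3 d4] : [/\ derivable fR x v, derivable fI x v, derivable gR x v & derivable gI x v].
  by split; apply: diff_derivable.
rewrite (deriveB (derivableM d1 d3) (derivableM d2 d4)).
rewrite (deriveD (derivableM d1 d4) (derivableM d2 d3)).
rewrite (deriveM d1 d3) (deriveM d2 d4) (deriveM d1 d4) (deriveM d2 d3).
rewrite -/fR -/fI -/gR -/gI.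
rewrite (eta_complex (g x)) (eta_complex (f x)).
rewrite -[complex.Re (f x)]/(fR x) -[complex.Im (f x)]/(fI x).
rewrite -[complex.Re (g x)]/(gR x) -[complex.Im (g x)]/(gI x).
move: ('D_v fR x) ('D_v fI x) ('D_v gR x) ('D_v gI x) (fR x) (fI x) (gR x) (gI x).
move=> a b c d p q r s; apply: complex_eq.
  by rewrite Re_addc !Re_mulc /= -![_ *: _]/(_ * _); ring.
by rewrite Im_addc !Im_mulc /= -![_ *: _]/(_ * _); ring.
Qed.

Lemma cdiff_cst (c : R[i]) x : cdiff (fun=> c) x.
Proof. by split; exact: differentiable_cst. Qed.

Lemma cdiffD f g x : cdiff f x -> cdiff g x -> cdiff (fun y => f y + g y) x.
Proof.
move=> [fr fi] [gr gi]; split.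
  have -> : cRe \o (fun y => f y + g y) = (cRe \o f) + (cRe \o g).
    by apply/funext => y; rewrite /= Re_addc.
  exact: differentiableD.
have -> : cIm \o (fun y => f y + g y) = (cIm \o f) + (cIm \o g).
  by apply/funext => y; rewrite /= Im_addc.
exact: differentiableD.
Qed.

Lemma cdiffM f g x : cdiff f x -> cdiff g x -> cdiff (fun y => f y * g y) x.
Proof.
move=> [fr fi] [gr gi]; split.
  have -> : cRe \o (fun y => f y * g y) = (cRe \o f) * (cRe \o g) -
      (cIm \o f) * (cIm \o g) by apply/funext => y; rewrite /= Re_mulc.
  by apply: differentiableB; exact: differentiableM.
have -> : cIm \o (fun y => f y * g y) = (cRe \o f) * (cIm \o g) +
      (cIm \o f) * (cRe \o g) by apply/funext => y; rewrite /= Im_mulc.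
by apply: differentiableD; exact: differentiableM.
Qed.

Lemma dirderiveZ (c : R[i]) f x v : cdiff f x ->
  dirderive v (fun y => c * f y) x = c * dirderive v f x.
Proof.
move=> df; rewrite (dirderiveM _ (cdiff_cst c x) df).
by rewrite dirderive_cst mul0r add0r.
Qed.

Lemma dirderive_sum (I : Type) (s : seq I) (f : I -> V -> R[i]) x v :
  (forall i, cdiff (f i) x) -> cdiff (fun y => \sum_(i <- s) f i y) x /\
  dirderive v (fun y => \sum_(i <- s) f i y) x = \sum_(i <- s) dirderive v (f i) x.
Proof.
move=> df; elim: s => [|i s [IH1 IH2]].
  under eq_fun do rewrite big_nil.
  by rewrite dirderive_cst big_nil; split => //; exact: cdiff_cst.
under eq_fun do rewrite big_cons; rewrite big_cons dirderiveD// IH2.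
by split => //; exact: cdiffD.
Qed.

Lemma dirderive_lin (I : Type) (s : seq I) (c : I -> R) (b : I -> V) f x :
  cdiff f x ->
  dirderive (\sum_(i <- s) c i *: b i) f x =
  \sum_(i <- s) (c i)%:C * dirderive (b i) f x.
Proof.
move=> [fr fi]; rewrite /dirderive !deriveE// !linear_sum.
apply: complex_eq; rewrite ?Re_sum ?Im_sum /=; apply: eq_bigr => i _.
  by rewrite linearZ/= mul0r subr0 deriveE.
by rewrite linearZ/= mul0r addr0 deriveE.
Qed.

Lemma dirderive_comm U f x u v : open U -> U x -> smooth_on U f ->
  dirderive v (dirderive u f) x = dirderive u (dirderive v f) x.
Proof.
move=> oU Ux sf.
have cD w1 w2 : cdiff (dirderive w1 (dirderive w2 f)) x.
  by apply: smooth_on_cdiff Ux; do 2 apply: smooth_on_dirderive.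
have dD w y : U y -> cdiff (dirderive w f) y.
  by move=> Uy; exact: smooth_on_cdiff (smooth_on_dirderive w sf) Uy.
have df y : U y -> cdiff f y by exact: smooth_on_cdiff.
have Hr : 'D_v ('D_u (cRe \o f)) x = 'D_u ('D_v (cRe \o f)) x.
  apply: (@derive_comm R V (cRe \o f) x u v U oU Ux).
  - by move=> y /df[].
  - by move=> w y /(dD w)[].
  - by have [d _] := cD v u; exact: differentiable_continuous d.
  - by have [d _] := cD u v; exact: differentiable_continuous d.
have Hi : 'D_v ('D_u (cIm \o f)) x = 'D_u ('D_v (cIm \o f)) x.
  apply: (@derive_comm R V (cIm \o f) x u v U oU Ux).
  - by move=> y /df[].
  - by move=> w y /(dD w)[].
  - by have [_ d] := cD v u; exact: differentiable_continuous d.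
  - by have [_ d] := cD u v; exact: differentiable_continuous d.
exact: (f_equal2 (@Complex R) Hr Hi).
Qed.

Lemma cdiff_continuous f x : cdiff f x ->
  {for x, continuous (cRe \o f)} /\ {for x, continuous (cIm \o f)}.
Proof. by move=> [fr fi]; split; exact: differentiable_continuous. Qed.

End smooth_on_theory.

Section smooth_on_comp.
Context {R : realType} {V W : normedModType R}.

Lemma dirderive_comp m (b : 'I_m -> W) (phi : 'I_m -> V -> R) (g : W -> R[i])
    (x v : V) :
  (forall j, differentiable (phi j) x) -> cdiff g (\sum_j phi j x *: b j) ->
  cdiff (fun y => g (\sum_j phi j y *: b j)) x /\
  dirderive v (fun y => g (\sum_j phi j y *: b j)) x =
    \sum_j ('D_v (phi j) x)%:C * dirderive (b j) g (\sum_j phi j x *: b j).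
Proof.
move=> dphi [gr gi].
have [d1 e1] := derive_comp_lincomb v dphi gr.
have [d2 e2] := derive_comp_lincomb v dphi gi.
split; first by split.
apply: complex_eq; rewrite ?Re_sum ?Im_sum /=.
  by rewrite [LHS]e1; apply: eq_bigr => j _; rewrite mul0r subr0.
by rewrite [LHS]e2; apply: eq_bigr => j _; rewrite mul0r addr0.
Qed.

Lemma smooth_on_comp m (U : set V) (U' : set W) (b : 'I_m -> W)
    (phi : 'I_m -> V -> R) (g : W -> R[i]) : open U ->
  (forall x, U x -> U' (\sum_j phi j x *: b j)) ->
  (forall j, Coo U (phi j)) -> smooth_on U' g ->
  smooth_on U (fun y => g (\sum_j phi j y *: b j)).
Proof.
move=> oU UU' Cphi /smooth_onP[gr gi]; apply/smooth_onP; split=> k.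
  by apply: (Ck_comp_lincomb oU UU' _ (gr k)) => j; exact: Cphi.
by apply: (Ck_comp_lincomb oU UU' _ (gi k)) => j; exact: Cphi.
Qed.

End smooth_on_comp.

(** * Integrals depending on a parameter *)

Section parameter_integral.
Context {R : realType} {V : normedModType R} {d : measure_display}
  {Y : measurableType d} {mu : {measure set Y -> \bar R}}.
Variables (B : set Y) (mB : measurable B).

(** Brings continuity of parameter integrals within reach of dominated convergence, which speaks of
    sequences. *)
Lemma sequential_continuity (f : V -> R) (x : V) :
  (forall u : nat -> V, u n @[n --> \oo] --> x -> f (u n) @[n --> \oo] --> f x) ->
  {for x, continuous f}.
Proof.
move=> H; apply: contrapT => /cvgrPdist_lt/existsNP[e /not_implyP[e0 ne]].
have /choice[u hu] n : exists y, ball x n.+1%:R^-1 y /\ e <= `|f x - f y|.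
  apply: contrapT => nex; apply: ne.
  near=> y; rewrite ltNge; apply/negP => ley; apply: nex; exists y; split => //.
  by near: y; apply: nbhsx_ballx; rewrite invr_gt0.
have ux : u n @[n --> \oo] --> x.
  apply/cvgrPdist_lt => r r0.
  have := near_infty_natSinv_lt (PosNum r0); apply: filterS => n /= nr.
  have [] := hu n; rewrite -ball_normE /ball_ /= => h _.
  exact: lt_trans nr.
have /cvgrPdist_lt/(_ e e0)[N _ /(_ N (leqnn N))/=] := H u ux.
by rewrite ltNge (hu N).2.
Unshelve. all: by end_near. Qed.

Lemma integrable_dominated (f g : Y -> R) : measurable_fun B f ->
  (forall y, B y -> `|f y| <= g y) -> mu.-integrable B (EFin \o g) ->
  mu.-integrable B (EFin \o f).
Proof.
move=> mf fg; apply: le_integrable => //; first exact/measurable_EFinP.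
by move=> y By; rewrite /= lee_fin (le_trans (fg y By))// ler_norm.
Qed.

Lemma integrable_realD (f g : Y -> R) :
  mu.-integrable B (EFin \o f) -> mu.-integrable B (EFin \o g) ->
  mu.-integrable B (EFin \o (fun y => f y + g y)).
Proof.
move=> fi gi; have := integrableD mB fi gi.
by congr (_.-integrable _ _); apply/funext => y; rewrite /= EFinD.
Qed.

Lemma integrable_realZ (k : R) (f : Y -> R) : mu.-integrable B (EFin \o f) ->
  mu.-integrable B (EFin \o (fun y => k * f y)).
Proof.
move=> fi; have := integrableZl mB k fi.
by congr (_.-integrable _ _); apply/funext => y; rewrite /= EFinM.
Qed.

Lemma continuous_integral_param (F : V -> Y -> R) (G : Y -> R) (x : V) :
  (\forall z \near x, mu.-integrable B (EFin \o F z)) ->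
  (forall y, B y -> {for x, continuous (F ^~ y)}) ->
  mu.-integrable B (EFin \o G) ->
  (\forall z \near x, forall y, B y -> `|F z y| <= G y) ->
  {for x, continuous (fun z => \int[mu]_(y in B) F z y)}.
Proof.
move=> iF cF iG FG; apply: sequential_continuity => u ux.
(* The hypotheses hold only near [x], so the first [N] terms of the sequence are dropped. *)
have [N _ uN] : \forall n \near \oo, mu.-integrable B (EFin \o F (u n)) /\
    (forall y, B y -> `|F (u n) y| <= G y).
  have : \forall z \near x, mu.-integrable B (EFin \o F z) /\
    (forall y, B y -> `|F z y| <= G y) by exact: filterI.
  exact: ux.
have uN' n : mu.-integrable B (EFin \o F (u (n + N)%N)) /\
    (forall y, B y -> `|F (u (n + N)%N) y| <= G y) by apply: uN; exact: leq_addl.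
rewrite -(cvg_shiftn N); apply: fine_cvg.
rewrite fineK; last by apply: integrable_fin_num => //; exact: (nbhs_singleton iF).
apply: (@dominated_cvg _ _ _ mu B mB (fun n y => (F (u (n + N)%N) y)%:E)
   (fun y => (F x y)%:E) (EFin \o G)) => //.
- by move=> n; have [/integrableP[]] := uN' n.
- move=> y By; apply: cvg_EFin; first exact: nearW.
  have cFy : F (u n) y @[n --> \oo] --> F x y := cvg_comp _ _ ux (cF y By).
  by rewrite -(cvg_shiftn N) in cFy.
- by move=> n y By; rewrite /= lee_fin; exact: (uN' n).2.
Qed.

Lemma is_derive_line0 (f : V -> R) (x v : V) (l : R) :
  is_derive (0 : R) 1 (fun t : R => f (x + t *: v)) l -> is_derive x v f l.
Proof.
have E : (fun h => h^-1 *: (((fun t : R => f (x + t *: v)) \o shift 0) (h *: 1) -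
                      f (x + 0 *: v))) =
  (fun h => h^-1 *: ((f \o shift x) (h *: v) - f x)).
  by rewrite line_quotient scale0r addr0.
move=> [df fd]; split.
  by move: df; rewrite /derivable [X in cvg (X @ _)]E.
by rewrite -fd /derive E.
Qed.

Lemma is_derive_integral_param (F : V -> Y -> R) (G : Y -> R) (x v : V) (r : R) :
  0 < r ->
  (forall s, s \in `]- r, r[%R -> mu.-integrable B (EFin \o F (x + s *: v))) ->
  (forall s y, s \in `]- r, r[%R -> B y -> derivable (F ^~ y) (x + s *: v) v) ->
  mu.-integrable B (EFin \o G) -> (forall y, 0 <= G y) ->
  (forall s y, s \in `]- r, r[%R -> B y -> `|'D_v (F ^~ y) (x + s *: v)| <= G y) ->
  is_derive x v (fun z => \int[mu]_(y in B) F z y)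
    (\int[mu]_(y in B) 'D_v (F ^~ y) x).
Proof.
move=> r0 iF dF iG G0 bF; apply: is_derive_line0.
pose f (s : R) y := F (x + s *: v) y.
have I0 : `]- r, r[%classic 0 by rewrite /= in_itv/= oppr_lt0 r0.
have df s y : s \in `]- r, r[%R -> B y -> is_derive s 1 (f ^~ y) ('D_v (F ^~ y) (x + s *: v)).
  by move=> sr By; apply: (@is_derive_line _ _ (F ^~ y)); apply: derivableP; exact: dF.
have derf s y : `]- r, r[%classic s -> B y -> derivable (f ^~ y) s 1.
  by move=> sr By; have [] := df s y sr By.
have d1f s y : s \in `]- r, r[%R -> B y -> partial1of2 f s y = 'D_v (F ^~ y) (x + s *: v).
  by move=> sr By; rewrite partial1of2E; have [_] := df s y sr By.
have bf s y : `]- r, r[%classic s -> B y -> `|partial1of2 f s y| <= G y.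
  by move=> sr By; rewrite d1f//; exact: bF.
split; first exact: (derivable_under_integral mB I0 iF derf G0 iG bf).
rewrite -derive1E (differentiation_under_integral mB I0 iF derf G0 iG bf).
apply: eq_Rintegral => y; rewrite inE => By.
by rewrite -[LHS]/(partial1of2 f 0 y) d1f// scale0r addr0.
Qed.

(** [V] enters only through a finite basis whose coordinates are bounded by the norm; the instances
    are [R^n] and [R * R^n]. *)
Variables (m : nat) (b : 'I_m -> V) (c : 'I_m -> {linear V -> R}).
Hypotheses (bc : forall v, v = \sum_j c j v *: b j)
  (c_le : forall j v, `|c j v| <= `|v|).

Lemma derive_coord (f : V -> R) (x v : V) : differentiable f x ->
  'D_v f x = \sum_j c j v * 'D_(b j) f x.
Proof.
move=> df; rewrite deriveE// {1}(bc v) linear_sum.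
by apply: eq_bigr => j _; rewrite linearZ/= deriveE.
Qed.

(** Domination is assumed along the basis vectors and spreads by linearity to every direction [v],
    with a factor [m |v|]. Differentiation under the integral along lines and dominated convergence
    then supply the hypotheses of [differentiable_of_derive]. *)
Lemma differentiable_integral_param (F : V -> Y -> R) (G : Y -> R) (x : V) (r : R) :
  0 < r ->
  (forall z, ball x r z -> mu.-integrable B (EFin \o F z)) ->
  (forall z y, ball x r z -> B y -> differentiable (F ^~ y) z) ->
  mu.-integrable B (EFin \o G) -> (forall y, 0 <= G y) ->
  (forall z y, ball x r z -> B y -> `|F z y| <= G y) ->
  (forall j z y, ball x r z -> B y -> `|'D_(b j) (F ^~ y) z| <= G y) ->
  (forall j y, B y -> {for x, continuous ('D_(b j) (F ^~ y))}) ->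
  differentiable (fun z => \int[mu]_(y in B) F z y) x /\
  forall v, mu.-integrable B (EFin \o (fun y => 'D_v (F ^~ y) x)) /\
    'D_v (fun z => \int[mu]_(y in B) F z y) x = \int[mu]_(y in B) 'D_v (F ^~ y) x.
Proof.
move=> r0 iF dF iG G0 bF0 bF cF.
pose Phi z := \int[mu]_(y in B) F z y.
have near_ball z : ball x r z -> \forall y \near z, ball x r y.
  by move=> zr; apply: open_nbhs_nbhs; split => //; exact: ball_open.
have bD z v y : ball x r z -> B y -> `|'D_v (F ^~ y) z| <= m%:R * `|v| * G y.
  move=> zr By; rewrite derive_coord; last exact: dF.
  rewrite (le_trans (ler_norm_sum _ _ _))//.
  have -> : m%:R * `|v| * G y = \sum_(j < m) `|v| * G y.
    by rewrite sumr_const card_ord -mulrA mulr_natl.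
  by apply: ler_sum => j _; rewrite normrM; apply: ler_pM => //; exact: bF.
have iGm v : mu.-integrable B (EFin \o (fun y => m%:R * `|v : V| * G y)) by exact: integrable_realZ.
have dPhi z v : ball x r z -> is_derive z v Phi (\int[mu]_(y in B) 'D_v (F ^~ y) z).
  move=> zr.
  have /nbhs_ballP[e /= e0 ze] := near_ball z zr.
  pose r' := e / (`|v| + 1).
  have v1 : 0 < `|v| + 1 by rewrite ltr_wpDl.
  have r'0 : 0 < r' by rewrite divr_gt0.
  have zs s : s \in `]- r', r'[%R -> ball x r (z + s *: v).
    rewrite in_itv/= -ltr_norml => sr; apply: ze; rewrite -ball_normE /ball_ /=.
    rewrite opprD addNKr normrN normrZ.
    move: sr; rewrite /r' ltr_pdivlMr//; apply: le_lt_trans.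
    by rewrite ler_wpM2l// lerDl.
  apply: (@is_derive_integral_param F (fun y => m%:R * `|v| * G y) z v r' r'0) => //.
  - by move=> s /zs; exact: iF.
  - by move=> s y /zs zr' By; apply: diff_derivable; exact: dF.
  - by move=> y; rewrite !mulr_ge0.
  - by move=> s y /zs zr' By; exact: bD.
have mD z v : ball x r z -> mu.-integrable B (EFin \o (fun y => 'D_v (F ^~ y) z)).
  move=> zr.
  (* A pointwise limit of difference quotients with steps [1 / (N + k + 1)], where [N] is large
     enough for the shifted points to stay in the ball. *)
  have mDz : measurable_fun B (fun y => 'D_v (F ^~ y) z).
    have /nbhs_ballP[e /= e0 ze] := near_ball z zr.
    have [N Nle] : exists N : nat, `|v| < e * N.+1%:R.
      have [N hN] : exists N : nat, `|v| / e < N%:R.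
        by exists (Num.truncn (`|v| / e)).+1; exact: truncnS_gt.
      exists N; rewrite mulrC -ltr_pdivrMr//; apply: lt_trans hN _.
      by rewrite ltr_nat.
    have h0 k : (N + k).+1%:R^-1 != 0 :> R by rewrite invr_neq0// pnatr_eq0.
    apply: (@measurable_fun_cvg d Y R B (fun k y => (N + k).+1%:R *
        (F (z + (N + k).+1%:R^-1 *: v) y - F z y))) => //.
      move=> k.
      have zk : ball x r (z + (N + k).+1%:R^-1 *: v).
        apply: ze; rewrite -ball_normE /ball_ /= opprD addNKr normrN normrZ.
        rewrite ger0_norm// mulrC ltr_pdivrMr//; apply: (lt_le_trans Nle).
        by rewrite ler_pM2l// ler_nat ltnS leq_addr.
      apply: measurable_funM; first exact: measurable_cst.
      apply: measurable_funB.
        by have /integrableP[/measurable_EFinP] := iF _ zk.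
      by have /integrableP[/measurable_EFinP] := iF _ zr.
    move=> y By.
    have : derivable (F ^~ y) z v by apply: diff_derivable; exact: dF.
    rewrite /derivable => /cvg_ex[l hl].
    have El : 'D_v (F ^~ y) z = l by apply/cvg_lim.
    rewrite El.
    have := (cvgr_dnbhsP _ _ _).1 hl (fun k => (N + k).+1%:R^-1).
    have hs : (forall n : nat, (N + n).+1%:R^-1 != 0 :> R) /\
       ((N + n).+1%:R^-1 : R) @[n --> \oo] --> 0.
      split=> //; apply/cvgrPdist_lt => e' e'0.
      have := near_infty_natSinv_lt (PosNum e'0); apply: filterS => n /= h.
      rewrite sub0r normrN ger0_norm//; apply: le_lt_trans h.
      by rewrite lef_pV2// ?posrE// ler_nat ltnS leq_addl.
    move=> /(_ hs); apply: cvg_trans; apply: near_eq_cvg; apply: nearW => n /=.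
    by rewrite invrK [z + _]addrC.
  by apply: integrable_dominated (iGm v) => // y By; exact: bD.
have xr : ball x r x by exact: ballxx.
pose L (z v : V) := \int[mu]_(y in B) 'D_v (F ^~ y) z.
have LE z v : ball x r z -> L z v = \sum_j c j v * L z (b j).
  move=> zr; rewrite /L.
  have -> : \int[mu]_(y in B) 'D_v (F ^~ y) z =
      \int[mu]_(y in B) (\sum_j c j v * 'D_(b j) (F ^~ y) z).
    by apply: eq_Rintegral => y; rewrite inE => By; apply: derive_coord; exact: dF.
  have [] // : mu.-integrable B (EFin \o (fun y => \sum_j c j v * 'D_(b j) (F ^~ y) z)) /\
      \int[mu]_(y in B) (\sum_j c j v * 'D_(b j) (F ^~ y) z) =
      \sum_j c j v * \int[mu]_(y in B) 'D_(b j) (F ^~ y) z.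
  elim: (index_enum _) => [|j s [IH1 IH2]].
    under eq_fun do rewrite big_nil; rewrite big_nil; split.
      exact: integrable0.
    by rewrite /Rintegral integral0.
  under eq_fun do rewrite big_cons; rewrite big_cons -IH2.
  have iD : mu.-integrable B (EFin \o (fun y => c j v * 'D_(b j) (F ^~ y) z)).
    by apply: integrable_realZ; exact: mD.
  split; first exact: integrable_realD.
  by rewrite RintegralD// RintegralZl//; exact: mD.
have cL j : {for x, continuous (fun z => L z (b j))}.
  apply: (@continuous_integral_param (fun z y => 'D_(b j) (F ^~ y) z) G).
  - by apply: filterS (near_ball x xr) => z zr; exact: mD.
  - by move=> y By; exact: cF.
  - exact: iG.
  - by apply: filterS (near_ball x xr) => z zr y By; exact: bF.
pose Lx v := \sum_j c j v * L x (b j).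
have linLx : linear Lx.
  move=> a u v; rewrite /Lx scaler_sumr -big_split/=.
  by apply: eq_bigr => j _; rewrite linearP/= mulrDl -scalerAl.
pose LLx : {linear V -> R} := HB.pack Lx (GRing.isLinear.Build _ _ _ _ _ linLx).
have LxE : LLx =1 L x by move=> v; rewrite LE.
have [dPhix dE] : differentiable Phi x /\ 'd Phi x = L x :> (V -> R).
  apply: (differentiable_of_derive LxE).
  - apply: bounded_linear_continuous.
    pose M0 := \sum_j `|L x (b j)|.
    rewrite /bounded_near; near=> M; apply/nbhs_ballP; exists 1 => //= v.
    rewrite -ball_normE /ball_ /= sub0r normrN => v1.
    rewrite (le_trans (ler_norm_sum _ _ _))// (@le_trans _ _ M0)//.
      apply: ler_sum => j _; rewrite normrM ler_piMl// (le_trans (c_le _ _))//.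
      exact: ltW.
  - apply: (@continuous_integral_param F G).
    + by apply: filterS (near_ball x xr).
    + by move=> y By; apply: differentiable_continuous; exact: dF.
    + exact: iG.
    + by apply: filterS (near_ball x xr) => z zr y By; exact: bF0.
  - by apply: filterS (near_ball x xr) => z zr _ v; exact: dPhi.
  - move=> e e0.
    (* [m.+1] rather than [m], so that the tolerance is positive also for [m = 0]. *)
    have e'0 : 0 < e / m.+1%:R by rewrite divr_gt0.
    have : \forall z \near x, forall j, `|L z (b j) - L x (b j)| <= e / m.+1%:R.
      suff : \forall z \near x, forall j, j \in index_enum 'I_m ->
          `|L z (b j) - L x (b j)| <= e / m.+1%:R.
        by apply: filterS => z h j; apply: h; rewrite mem_index_enum.
      elim: (index_enum _) => [|j s IH]; first by apply: filterS filterT => z _ j; rewrite in_nil.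
      have h : \forall z \near x, `|L x (b j) - L z (b j)| <= e / m.+1%:R.
        by move/cvgrPdist_le: (cL j); exact.
      move: h IH; apply: filterS2 => z h1 h2 i; rewrite inE => /predU1P[->|/h2//].
      by rewrite distrC.
    move: (near_ball x xr); apply: filterS2 => z zr h v.
    rewrite !LE// -sumrB (le_trans (ler_norm_sum _ _ _))//.
    apply: (@le_trans _ _ (\sum_(j < m) `|v| * (e / m.+1%:R))).
      by apply: ler_sum => j _; rewrite -mulrBr normrM ler_pM.
    rewrite sumr_const card_ord -[leLHS]mulr_natl.
    rewrite (_ : m%:R * _ = m%:R / m.+1%:R * e * `|v|); last by ring.
    rewrite ler_wpM2r// ler_piMl ?(ltW e0)// ler_pdivrMr// mul1r ler_nat.
    exact: leqnSn.
split => // v; split; first exact: mD.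
by rewrite deriveE// dE.
Unshelve. all: by end_near. Qed.

End parameter_integral.

(** * Integration over R^n *)

Section row_cons.
Context {R : realType}.

Definition row_cons n (s : R) (x : 'rV[R]_n) : 'rV[R]_n.+1 :=
  \row_j oapp (fun k => x 0 k) s (unlift ord0 j).

Definition row_tail n (x : 'rV[R]_n.+1) : 'rV[R]_n := \row_j x 0 (lift ord0 j).

Lemma row_cons0 n s (x : 'rV[R]_n) : row_cons s x 0 ord0 = s.
Proof. by rewrite mxE unlift_none. Qed.

Lemma row_consS n s (x : 'rV[R]_n) j : row_cons s x 0 (lift ord0 j) = x 0 j.
Proof. by rewrite mxE liftK. Qed.

Lemma row_cons_eta n (x : 'rV[R]_n.+1) : x = row_cons (x 0 ord0) (row_tail x).
Proof.
apply/rowP => j; rewrite mxE; case: unliftP => [k ->|->] //=.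
by rewrite mxE.
Qed.

Lemma row_consE n s (x : 'rV[R]_n) : row_cons s x =
  s *: delta_mx 0 ord0 + \sum_j x 0 j *: delta_mx 0 (lift ord0 j).
Proof.
apply/rowP => j; rewrite !mxE summxE; case: unliftP => [k ->|->] /=.
  rewrite mulr0 add0r.
  rewrite (bigD1 k)//= !mxE !eqxx/= mulr1 big1 ?addr0// => i ik.
  by rewrite !mxE (inj_eq lift_inj) eq_sym (negbTE ik) mulr0.
rewrite ?eqxx mulr1 big1 ?addr0// => i _; rewrite !mxE.
by rewrite ?(negbTE (neq_lift _ _)) mulr0.
Qed.

Lemma continuous_row_consl n (x : 'rV[R]_n) : continuous (fun s => row_cons s x).
Proof.
move=> s; under eq_fun do rewrite row_consE.
apply: cvgD; last exact: cvg_cst.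
by apply: cvgZr_tmp; exact: cvg_id.
Qed.

Lemma continuous_sum_coord n m (b : 'I_n -> 'rV[R]_m) :
  continuous (fun x : 'rV[R]_n => \sum_j x 0 j *: b j).
Proof.
move=> x; apply: differentiable_continuous.
by have [] := @derive_lincomb _ _ _ _ b (fun j (y : 'rV[R]_n) => y 0 j) x 0
  (fun j => @differentiable_coord _ _ _ x 0 j).
Qed.

Lemma continuous_row_consr n s : continuous (@row_cons n s).
Proof.
have -> : @row_cons n s = cst (s *: delta_mx 0 ord0) +
    (fun x : 'rV[R]_n => \sum_j x 0 j *: delta_mx 0 (lift ord0 j)) by apply/funext => x; exact: row_consE.
by move=> x; apply: continuousD; [exact: cst_continuous|exact: continuous_sum_coord].
Qed.

Lemma tuple_row_cons n (s : R) (t : n.-tuple R) :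
  tuple_row [tuple of s :: t] = row_cons s (tuple_row t).
Proof.
apply/rowP => j; rewrite !mxE; case: unliftP => [k ->|->] /=.
  by rewrite tnthS mxE.
by rewrite tnth0.
Qed.

End row_cons.

Section measurability.
Context {R : realType}.
Local Notation RT := (measurableTypeR R).

(** Tuples carry a product sigma-algebra and rows a topology; the induction links the two. Rounding
    the first coordinate to a grid exhibits [f] as a limit of functions for which that coordinate
    takes countably many values, and the induction hypothesis treats each value. *)
Lemma measurable_fun_continuous_row n (f : 'rV[R]_n -> R) : continuous f ->
  measurable_fun setT (fun t : n.-tuple RT => f (tuple_row t)).
Proof.
elim: n f => [|n IH] f cf.
  rewrite (_ : (fun _ => _) = cst (f (tuple_row [tuple])))//.
  by apply/funext => t; rewrite (tuple0 t).
pose g (q : RT * n.-tuple RT) := f (row_cons q.1 (tuple_row q.2)).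
suff mg : measurable_fun setT g.
  pose unc (t : n.+1.-tuple RT) : RT * n.-tuple RT :=
    (thead t, [tuple of behead t]).
  have munc : measurable_fun setT unc.
    apply/measurable_fun_pairP; split; first exact: (measurable_tnth ord0).
    exact: measurable_behead.
  rewrite (_ : (fun _ => _) = g \o unc); first exact: measurableT_comp.
  by apply/funext => t; rewrite /g /= -tuple_row_cons -tuple_eta.
(* The first coordinate is rounded down to a multiple of [1 / (k + 1)]. *)
pose G k (q : RT * n.-tuple RT) :=
  f (row_cons ((Num.floor (k.+1%:R * q.1 : R))%:~R / k.+1%:R) (tuple_row q.2)).
apply: (@measurable_fun_cvg _ _ _ setT G).
  move=> k _ B mB; rewrite setTI.
  rewrite (_ : G k @^-1` B = \bigcup_(z : int)
    ([set s : RT | Num.floor (k.+1%:R * s : R) = z] `*`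
     [set t | B (f (row_cons (z%:~R / k.+1%:R) (tuple_row t)))])); last first.
    apply/seteqP; split => [[s t] /= Bst|[s t] [z _ [/= <-]]//].
    by exists (Num.floor (k.+1%:R * s : R)).
  apply: countable_bigcupT_measurable => [|z]; first exact: countableP.
  apply: measurableX.
    have -> : [set s : RT | Num.floor (k.+1%:R * s : R) = z] =
      `[(z%:~R / k.+1%:R : R), ((z + 1)%:~R / k.+1%:R)[%classic.
      apply/seteqP; split => s /=; rewrite in_itv/= ler_pdivrMr// ltr_pdivlMr// [s * _]mulrC.
        by move=> <-; rewrite floor_itv.
      by move=> h; exact: floor_def.
    exact: measurable_itv.
  have := IH (fun x => f (row_cons (z%:~R / k.+1%:R) x)).
  rewrite -[X in measurable X]setTI; apply => //.
  by move=> x; apply: continuous_comp; [exact: continuous_row_consr|exact: cf].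
move=> [s t] _; rewrite /G /g /=.
apply: (cvg_comp _ f); last exact: cf.
apply: (cvg_comp _ (fun s => row_cons s (tuple_row t))); last exact: continuous_row_consl.
apply/cvgrPdist_lt => e e0.
have := near_infty_natSinv_lt (PosNum e0); apply: filterS => k /= h.
apply: le_lt_trans h.
have k0 : 0 < k.+1%:R :> R by [].
rewrite -[X in `|X - _|](mulfK (lt0r_neq0 k0)) -mulrBl normrM (@gtr0_norm _ k.+1%:R^-1) ?invr_gt0//.
rewrite ler_piMl ?invr_ge0// ger0_norm; last by rewrite subr_ge0 mulrC floor_le.
have /andP[_ /ltW] := floor_itv (k.+1%:R * s : R); rewrite intrD mulrC.
by rewrite lerBlDr addrC.
Qed.

End measurability.

Section tuple_integral.
Context {R : realType}.
Local Notation RT := (measurableTypeR R).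
Local Notation leb := (@lebesgue_measure R).

Definition integral_row n (f : 'rV[R]_n -> R) : R :=
  \int[lebesgue_tuple R n]_t f (tuple_row t).

Definition integrable_row n (f : 'rV[R]_n -> R) : Prop :=
  (lebesgue_tuple R n).-integrable setT (EFin \o (fun t => f (tuple_row t))).

Let consp n (q : RT * n.-tuple RT) : n.+1.-tuple RT := [tuple of q.1 :: q.2].

Let measurable_consp n : measurable_fun setT (@consp n).
Proof. exact: measurable_cons. Qed.

Lemma ge0_integral_cons n (f : n.+1.-tuple RT -> \bar R) :
  measurable_fun setT f -> (forall t, 0 <= f t)%E ->
  (\int[lebesgue_tuple R n.+1]_t f t =
   \int[leb]_s \int[lebesgue_tuple R n]_t f [tuple of s :: t])%E.
Proof.
move=> mf f0; rewrite [LHS](ge0_integral_pushforward (@measurable_consp n))//.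
rewrite preimage_setT (fubini_tonelli1 (f \o @consp n))//.
  by apply: measurableT_comp => //; exact: measurable_consp.
by move=> q; exact: f0.
Qed.

(** All slices are assumed integrable, not almost all, so that the inner integrals are finite
    everywhere and agree with their real versions. *)
Lemma integral_cons n (f : n.+1.-tuple RT -> R) :
  (lebesgue_tuple R n.+1).-integrable setT (EFin \o f) ->
  (forall s, (lebesgue_tuple R n).-integrable setT
     (EFin \o (fun t : n.-tuple RT => f [tuple of s :: t]))) ->
  (forall t : n.-tuple RT, leb.-integrable setT (EFin \o (fun s : RT => f [tuple of s :: t]))) ->
  \int[lebesgue_tuple R n.+1]_t f t =
    \int[leb]_s \int[lebesgue_tuple R n]_t f [tuple of s :: t] /\
  \int[lebesgue_tuple R n.+1]_t f t =
    \int[lebesgue_tuple R n]_t \int[leb]_s f [tuple of s :: t].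
Proof.
move=> fi fi1 fi2.
have mf : measurable_fun setT (EFin \o f) by case/integrableP: fi.
have mfc : measurable_fun setT ((EFin \o f) \o @consp n).
  by apply: measurableT_comp => //; exact: measurable_consp.
have fic : (leb \x lebesgue_tuple R n)%E.-integrable setT ((EFin \o f) \o @consp n).
  apply/integrableP; split => //.
  have /integrableP[_] := fi.
  rewrite [X in (X < _)%E -> _](ge0_integral_pushforward (@measurable_consp n))//.
  exact: measurableT_comp.
have E : (\int[lebesgue_tuple R n.+1]_t (f t)%:E =
   \int[leb \x lebesgue_tuple R n]_q (f (consp q))%:E)%E.
  by rewrite [LHS](integral_pushforward (@measurable_consp n))// preimage_setT.
split; rewrite /Rintegral E.
  rewrite -(integral12_prod_meas1 fic); congr fine; apply: eq_integral => s _.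
  by rewrite /fubini_F fineK//; apply: integrable_fin_num => //; exact: fi1.
rewrite -(integral21_prod_meas1 fic); congr fine; apply: eq_integral => t _.
by rewrite /fubini_G fineK//; apply: integrable_fin_num => //; exact: fi2.
Qed.

(* All the integrands below are dominated by a multiple of these weights. *)
Definition wt1 (s : R) : R := (1 + s ^+ 2)^-1.
Definition wt n (x : 'rV[R]_n) : R := \prod_j wt1 (x 0 j).

Lemma wt1_gt0 s : 0 < wt1 s.
Proof. by rewrite invr_gt0 ltr_pwDl// sqr_ge0. Qed.

Lemma wt1_ge0 s : 0 <= wt1 s. Proof. exact: ltW (wt1_gt0 s). Qed.

Lemma wt1_le1 s : wt1 s <= 1.
Proof. by rewrite invf_le1 ?lerDl ?sqr_ge0// ltr_pwDl// sqr_ge0. Qed.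

Lemma continuous_wt1 : continuous wt1.
Proof. exact: continuous_oneDsqrV. Qed.

Lemma wt_gt0 n (x : 'rV_n) : 0 < wt x.
Proof. by apply: prodr_gt0 => j _; exact: wt1_gt0. Qed.

Lemma wt_ge0 n (x : 'rV_n) : 0 <= wt x. Proof. exact: ltW (wt_gt0 x). Qed.

Lemma wt_le1 n (x : 'rV_n) : wt x <= 1.
Proof. by apply: prodr_ile1 => j _; rewrite wt1_ge0 wt1_le1. Qed.

Lemma wt_cons n s (x : 'rV_n) : wt (row_cons s x) = wt1 s * wt x.
Proof.
rewrite /wt big_ord_recl row_cons0; congr (_ * _).
by apply: eq_bigr => j _; rewrite row_consS.
Qed.

Lemma continuous_prod_coord n (g : R -> R) : continuous g ->
  continuous (fun x : 'rV[R]_n => \prod_j g (x 0 j)).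
Proof.
move=> cg x; elim: (index_enum _) => [|j s IH].
  by under eq_fun do rewrite big_nil; exact: cst_continuous.
have -> : (fun x : 'rV[R]_n => \prod_(i <- j :: s) g (x 0 i)) =
    (fun x : 'rV[R]_n => g (x 0 j)) * (fun x => \prod_(i <- s) g (x 0 i)).
  by apply/funext => y; rewrite big_cons.
apply: continuousM => //.
by apply: (@continuous_comp _ _ _ (fun y : 'rV[R]_n => y 0 j) g); [exact: coord_continuous|exact: cg].
Qed.

Lemma continuous_wt n : continuous (@wt n).
Proof. by apply: continuous_prod_coord; exact: continuous_wt1. Qed.

Let eintegral_wt1 : (\int[leb]_s (wt1 s)%:E = pi%:E)%E.
Proof.
rewrite ge0_symfun_integralT.
- rewrite (_ : [set x | 0 <= x] = `[0, +oo[%classic); last first.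
    by apply/seteqP; split => x /=; rewrite in_itv/= andbT.
  by rewrite [X in (_ * X)%E]integral0y_oneDsqr -EFinM mulrC divfK.
- exact: wt1_ge0.
- exact: continuous_wt1.
- by move=> s; rewrite /= /wt1 sqrrN.
Qed.

Lemma integrable_wt1 : leb.-integrable setT (EFin \o wt1).
Proof.
apply/integrableP; split.
  by apply/measurable_EFinP; apply: continuous_measurable_fun; exact: continuous_wt1.
rewrite (_ : integral _ _ _ = \int[leb]_x (wt1 x)%:E)%E; last first.
  by apply: eq_integral => x _; rewrite /= ger0_norm// wt1_ge0.
by rewrite eintegral_wt1 ltry.
Qed.

Lemma integral_wt1 : \int[leb]_s wt1 s = pi.
Proof. by rewrite /Rintegral eintegral_wt1. Qed.

Lemma integrable_wt n : integrable_row (@wt n).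
Proof.
have mwt k : measurable_fun setT (fun t : k.-tuple RT => wt (tuple_row t)).
  by apply: measurable_fun_continuous_row; exact: continuous_wt.
elim: n => [|n IH]; apply/integrableP; (split; first by apply/measurable_EFinP; exact: mwt).
  rewrite (_ : integral _ _ _ = \int[lebesgue_tuple R 0]_t 1)%E; last first.
    by apply: eq_integral => t _; rewrite /wt /= big_ord0 normr1.
  by rewrite integral_dirac// diracT mul1e ltry.
rewrite (_ : integral _ _ _ = \int[lebesgue_tuple R n.+1]_t (wt (tuple_row t))%:E)%E; last first.
  by apply: eq_integral => x _; rewrite /= ger0_norm// wt_ge0.
rewrite ge0_integral_cons; first last.
- by move=> t; rewrite lee_fin wt_ge0.
- by apply/measurable_EFinP; exact: mwt.
rewrite (_ : (fun _ => _) = (fun s => (wt1 s)%:E * (integral_row (@wt n))%:E)%E); last first.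
  apply/funext => s.
  under eq_integral do rewrite tuple_row_cons wt_cons EFinM.
  rewrite integralZl// /integral_row /Rintegral fineK//.
  exact: integrable_fin_num.
rewrite integralZr//; last exact: integrable_wt1.
by rewrite [X in (X * _)%E]eintegral_wt1 -EFinM ltry.
Qed.

(** Continuity with an explicit constant replaces integrability: slices and partial integrals of a
    dominated function are dominated again, with constants that can be followed, so Fubini can be
    iterated. *)
Definition dominated1 (A : R) (g : R -> R) : Prop :=
  continuous g /\ forall s, `|g s| <= A * wt1 s.

Definition dominated n (A : R) (f : 'rV[R]_n -> R) : Prop :=
  continuous f /\ forall x, `|f x| <= A * wt x.

Lemma dominated1_integrable A g : dominated1 A g -> leb.-integrable setT (EFin \o g).
Proof.
move=> [cg gA]; apply: (@integrable_dominated R _ RT leb setT measurableT g (fun s => A * wt1 s)).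
- exact: continuous_measurable_fun.
- by move=> s _; exact: gA.
- by apply: integrable_realZ => //; exact: integrable_wt1.
Qed.

Lemma dominated_integrable n A (f : 'rV_n -> R) : dominated A f -> integrable_row f.
Proof.
move=> [cf fA].
apply: (@integrable_dominated R _ (n.-tuple RT) (lebesgue_tuple R n) setT measurableT
  (fun t => f (tuple_row t)) (fun t => A * wt (tuple_row t))).
- exact: measurable_fun_continuous_row.
- by move=> t _; exact: fA.
- by apply: integrable_realZ => //; exact: integrable_wt.
Qed.

Lemma integral_row_le n (f g : 'rV_n -> R) : integrable_row f -> integrable_row g ->
  (forall x, `|f x| <= g x) -> `|integral_row f| <= integral_row g.
Proof.
move=> fi gi fg; rewrite (le_trans (le_normr_Rintegral measurableT fi))//.
apply: le_Rintegral => //; exact: integrable_norm.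
Qed.

Lemma integral_rowZ n k (f : 'rV_n -> R) : integrable_row f ->
  integral_row (fun x => k * f x) = k * integral_row f.
Proof. by move=> fi; rewrite /integral_row RintegralZl. Qed.

Lemma integral_rowD n (f g : 'rV_n -> R) : integrable_row f -> integrable_row g ->
  integral_row (fun x => f x + g x) = integral_row f + integral_row g.
Proof. by move=> fi gi; rewrite /integral_row RintegralD. Qed.

Lemma integral_rowB n (f g : 'rV_n -> R) : integrable_row f -> integrable_row g ->
  integral_row (fun x => f x - g x) = integral_row f - integral_row g.
Proof. by move=> fi gi; rewrite /integral_row RintegralB. Qed.

Lemma dominated_integral_le n A (f : 'rV_n -> R) : dominated A f ->
  `|integral_row f| <= A * integral_row (@wt n).
Proof.
move=> Df; rewrite -integral_rowZ; last exact: integrable_wt.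
apply: integral_row_le; first exact: dominated_integrable Df.
  by apply: integrable_realZ => //; exact: integrable_wt.
exact: Df.2.
Qed.

Lemma dominated1_integral_le A g : dominated1 A g ->
  `|\int[leb]_s g s| <= A * pi.
Proof.
move=> Dg; have gi := dominated1_integrable Dg.
have iA : leb.-integrable setT (EFin \o (fun s => A * wt1 s)).
  by apply: integrable_realZ => //; exact: integrable_wt1.
rewrite (le_trans (le_normr_Rintegral measurableT gi))//.
rewrite -integral_wt1 -RintegralZl//; last exact: integrable_wt1.
by apply: le_Rintegral => //; [exact: integrable_norm|move=> s _; exact: Dg.2].
Qed.

Lemma dominated_consr n A (f : 'rV_n.+1 -> R) s : dominated A f ->
  dominated (A * wt1 s) (f \o row_cons s).
Proof.
move=> [cf fA]; split.
  by move=> x; apply: continuous_comp; [exact: continuous_row_consr|exact: cf].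
by move=> x; rewrite -mulrA -wt_cons; exact: fA.
Qed.

Lemma dominated_consl n A (f : 'rV_n.+1 -> R) x : dominated A f ->
  dominated1 (A * wt x) (fun s => f (row_cons s x)).
Proof.
move=> [cf fA]; split.
  move=> s; apply: (@continuous_comp _ _ _ (fun s => row_cons s x) f).
    exact: continuous_row_consl.
  exact: cf.
by move=> s; rewrite -mulrA [wt x * _]mulrC -wt_cons; exact: fA.
Qed.

Lemma integral_row_cons n A (f : 'rV_n.+1 -> R) : dominated A f ->
  integral_row f = \int[leb]_s integral_row (f \o row_cons s) /\
  integral_row f = integral_row (fun x => \int[leb]_s f (row_cons s x)).
Proof.
move=> Df; have [] := @integral_cons n (fun t => f (tuple_row t)).
- exact: dominated_integrable Df.
- move=> s; have := dominated_integrable (dominated_consr s Df).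
  by congr (_.-integrable _ _); apply/funext => t; rewrite /= tuple_row_cons.
- move=> t; have := dominated1_integrable (dominated_consl (tuple_row t) Df).
  by congr (_.-integrable _ _); apply/funext => s; rewrite /= tuple_row_cons.
move=> E1 E2; split.
  rewrite [LHS]E1; apply: eq_Rintegral => s _; apply: eq_Rintegral => t _.
  by rewrite tuple_row_cons.
rewrite [LHS]E2; apply: eq_Rintegral => t _; apply: eq_Rintegral => s _.
by rewrite tuple_row_cons.
Qed.

Lemma dominated_ge0 n A (f : 'rV_n -> R) : dominated A f -> 0 <= A.
Proof. by move=> [_ /(_ 0)/(le_trans (normr_ge0 _))]; rewrite pmulr_lge0// wt_gt0. Qed.

Lemma dominated1_ge0 A f : dominated1 A f -> 0 <= A.
Proof. by move=> [_ /(_ 0)/(le_trans (normr_ge0 _))]; rewrite pmulr_lge0// wt1_gt0. Qed.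

Lemma continuous_integral_row (V : normedModType R) n (A : R) (F : V -> 'rV[R]_n -> R) :
  (forall z, dominated A (F z)) -> (forall x, continuous (F ^~ x)) ->
  continuous (fun z => integral_row (F z)).
Proof.
move=> DF cF z.
apply: (@continuous_integral_param _ _ _ _ _ _ measurableT
   (fun z (t : n.-tuple RT) => F z (tuple_row t)) (fun t => A * wt (tuple_row t))).
- by near=> y; exact: dominated_integrable (DF y).
- by move=> t _; exact: cF.
- by apply: integrable_realZ => //; exact: integrable_wt.
- by near=> y => t _; exact: (DF y).2.
Unshelve. all: by end_near. Qed.

Lemma continuous_integral1 (V : normedModType R) (A : R) (F : V -> R -> R) :
  (forall z, dominated1 A (F z)) -> (forall x, continuous (F ^~ x)) ->
  continuous (fun z => \int[leb]_s F z s).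
Proof.
move=> DF cF z.
apply: (@continuous_integral_param R V _ RT leb setT measurableT F (fun t => A * wt1 t)).
- by near=> y; exact: dominated1_integrable (DF y).
- by move=> t _; exact: cF.
- by apply: integrable_realZ => //; exact: integrable_wt1.
- by near=> y => t _; exact: (DF y).2.
Unshelve. all: by end_near. Qed.

Lemma dominated_le n A B (f : 'rV_n -> R) : A <= B -> dominated A f -> dominated B f.
Proof.
move=> AB [cf fA]; split=> // x; rewrite (le_trans (fA x))// ler_wpM2r//.
exact: wt_ge0.
Qed.

Lemma dominated1_le A B f : A <= B -> dominated1 A f -> dominated1 B f.
Proof.
move=> AB [cf fA]; split=> // x; rewrite (le_trans (fA x))// ler_wpM2r//.
exact: wt1_ge0.
Qed.

Lemma dominated_integral_consr n A (f : 'rV_n.+1 -> R) : dominated A f ->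
  dominated1 (A * integral_row (@wt n)) (fun s => integral_row (f \o row_cons s)).
Proof.
move=> Df; have A0 := dominated_ge0 Df; split.
  apply: (@continuous_integral_row R^o n A).
    move=> s; apply: dominated_le (dominated_consr s Df).
    by rewrite ler_piMr// wt1_le1.
  by move=> x; exact: (dominated_consl x Df).1.
move=> s; rewrite mulrAC; exact: dominated_integral_le (dominated_consr s Df).
Qed.

Lemma dominated_integral_consl n A (f : 'rV_n.+1 -> R) : dominated A f ->
  dominated (A * pi) (fun x => \int[leb]_s f (row_cons s x)).
Proof.
move=> Df; have A0 := dominated_ge0 Df; split.
  apply: (@continuous_integral1 _ A (fun x s => f (row_cons s x))).
    move=> x; apply: dominated1_le (dominated_consl x Df).
    by rewrite ler_piMr// wt_le1.
  by move=> s; exact: (dominated_consr s Df).1.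
move=> x; rewrite mulrAC; exact: dominated1_integral_le (dominated_consl x Df).
Qed.

End tuple_integral.

(** * Integrals of derivatives *)

Section integral_of_derivative.
Context {R : realType}.
Local Notation leb := (@lebesgue_measure R).

Lemma continuous_addf (T : topologicalType) (f g : T -> R) x :
  {for x, continuous f} -> {for x, continuous g} ->
  {for x, continuous (fun y => f y + g y)}.
Proof. by move=> cf cg; exact: continuousD. Qed.

Lemma continuous_mulf (T : topologicalType) (f g : T -> R) x :
  {for x, continuous f} -> {for x, continuous g} ->
  {for x, continuous (fun y => f y * g y)}.
Proof. by move=> cf cg; exact: continuousM. Qed.

Lemma continuous_add_wt1 (A : R) (g : R -> R) : continuous g ->
  continuous (fun x => g x + A * wt1 x).
Proof.
move=> cg; suff h (x : R) : {for x, continuous (fun x => g x + A * wt1 x)} by exact: h.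
apply: continuous_addf; first exact: cg.
by apply: continuous_mulf; [exact: cst_continuous|exact: continuous_wt1].
Qed.

(** Adding [A * wt1] makes the integrand nonnegative, as the fundamental theorem on a half-line
    asks; the primitive becomes [G + A * atan], whence the term [A * (pi / 2)]. *)
Lemma integral_half_line (A : R) (g G : R -> R) : dominated1 A g ->
  (forall x : R, 0 < x -> is_derive x 1 G (g x)) -> {for 0, continuous G} ->
  G x @[x --> +oo%R] --> (0 : R) ->
  (\int[leb]_(x in `[0%R, +oo[) (g x + A * wt1 x)%:E = (A * (pi / 2) - G 0)%:E)%E.
Proof.
move=> [cg gA] dG cG0 Goo.
pose F x := G x + A * atan x.
have dF (x : R) : 0 < x -> is_derive x 1 F (g x + A * wt1 x).
  move=> x0; apply: is_deriveD; first exact: dG.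
rewrite (@ge0_continuous_FTC2y _ (fun x => g x + A * wt1 x) F 0 (A * (pi / 2))).
- by rewrite /F atan0 mulr0 addr0.
- move=> x _; rewrite addrC -[g x]opprK subr_ge0 (le_trans _ (gA x))//.
  by rewrite -normrN ler_norm.
- by apply: continuous_in_subspaceT => x _; exact: continuous_add_wt1.
- rewrite -[X in _ --> X]add0r; apply: cvgD; first exact: Goo.
  by apply: cvgMr; exact: cvgy_atan.
- by move=> x /dF[].
- have cF : {for 0, continuous F}.
    apply: continuous_addf; first exact: cG0.
    by apply: continuous_mulf; [exact: cst_continuous|exact: continuous_atan].
  exact: cvg_at_right_filter.
- by move=> x; rewrite in_itv/= andbT => /dF[_ h]; rewrite derive1E.
Qed.

(** One primitive for each half-line, the left one reflected, because the damped integrands depend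
    on [|t|]. The added weight contributes [A * pi] in all, which is subtracted at the end. *)
Lemma integral_line (A : R) (g G1 G2 : R -> R) : dominated1 A g ->
  (forall x : R, 0 < x -> is_derive x 1 G1 (g x)) -> {for 0, continuous G1} ->
  G1 x @[x --> +oo%R] --> (0 : R) ->
  (forall x : R, 0 < x -> is_derive x 1 G2 (g (- x))) -> {for 0, continuous G2} ->
  G2 x @[x --> +oo%R] --> (0 : R) ->
  \int[leb]_x g x = - G1 0 - G2 0.
Proof.
move=> Dg dG1 cG1 G1oo dG2 cG2 G2oo.
have Dg' : dominated1 A (g \o -%R).
  split => [x|x]; last by rewrite (le_trans (Dg.2 _))// /wt1 sqrrN.
  by apply: continuous_comp; [exact: opp_continuous|exact: Dg.1].
pose f x := g x + A * wt1 x.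
have f0 x : 0 <= f x.
  rewrite /f addrC -[g x]opprK subr_ge0 (le_trans _ (Dg.2 x))//.
  by rewrite -normrN ler_norm.
have cf : continuous f by exact: continuous_add_wt1 Dg.1.
have mf : measurable_fun setT (EFin \o f).
  by apply/measurable_EFinP; exact: continuous_measurable_fun.
have H1 := integral_half_line Dg dG1 cG1 G1oo.
have H2 := integral_half_line Dg' dG2 cG2 G2oo.
have E : (\int[leb]_x (f x)%:E = (A * pi - G1 0 - G2 0)%:E)%E.
  have -> : setT = `]-oo, 0[%classic `|` `[0, +oo[%classic :> set R.
    apply/seteqP; split => // x _ /=; rewrite !in_itv/= andbT.
    by have [x0|x0] := ltP x 0; [left|right].
  rewrite ge0_integral_setU//=; first last.
  - rewrite disj_set2E; apply/eqP/seteqP; split => // x /= [].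
    by rewrite !in_itv/= andbT ltNge => /negP.
  - by move=> x _; rewrite lee_fin.
  - exact: measurable_funS mf.
  rewrite [X in (_ + X)%E]H1 integral_itv_bndo_bndc; last exact: measurable_funS mf.
  have := @ge0_integration_by_substitution0 R (fun x => (f (- x))%:E).
  under [X in _ -> _ -> _ = X]eq_integral do rewrite opprK.
  move=> <-; last 2 first.
  - apply/measurable_EFinP; apply: continuous_measurable_fun => x.
    by apply: (@continuous_comp _ _ _ (@GRing.opp R) f); [exact: opp_continuous|exact: cf].
  - by move=> x; rewrite lee_fin.
  rewrite (_ : integral _ _ _ = \int[leb]_(x in `[0%R, +oo[) (g (- x) + A * wt1 x)%:E)%E.
    by rewrite H2 -EFinD; congr EFin; field.
  by apply: eq_integral => x _; rewrite /f /wt1 sqrrN.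
have iA : leb.-integrable setT (EFin \o (fun s => A * wt1 s)).
  by apply: integrable_realZ => //; exact: integrable_wt1.
have : \int[leb]_x f x = A * pi - G1 0 - G2 0 by rewrite /Rintegral E.
rewrite RintegralD//; last exact: dominated1_integrable Dg.
rewrite RintegralZl//; last exact: integrable_wt1.
rewrite integral_wt1 => h; apply: (@addIr _ (A * pi)); rewrite h; ring.
Qed.

Lemma dominated1_cvgy A (g : R -> R) : dominated1 A g ->
  g x @[x --> +oo%R] --> (0 : R) /\ g (- x) @[x --> +oo%R] --> (0 : R).
Proof.
move=> Dg; have A0 := dominated1_ge0 Dg.
have H (h : R -> R) : (forall x, `|h x| <= A * wt1 x) -> h x @[x --> +oo%R] --> (0 : R).
  move=> hA; apply/cvgrPdist_le => e e0.
  near=> x; rewrite sub0r normrN (le_trans (hA x))//.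
  have x1 : 1 <= x by near: x; apply: nbhs_pinfty_ge; rewrite num_real.
  have xA : A / e <= x by near: x; apply: nbhs_pinfty_ge; rewrite num_real.
  rewrite /wt1 ler_pdivrMr ?ltr_pwDl ?sqr_ge0//.
  move: xA; rewrite ler_pdivrMr// mulrC => xA; rewrite (le_trans xA)// ler_wpM2l ?(ltW e0)//.
  by rewrite expr2 -[leLHS]add0r lerD// ler_peMl// (le_trans ler01).
split; apply: H; first exact: Dg.2.
by move=> x; rewrite (le_trans (Dg.2 _))// /wt1 sqrrN.
Unshelve. all: by end_near. Qed.

Lemma integral_derive0 (A : R) (g G : R -> R) : dominated1 A g -> dominated1 A G ->
  (forall x : R, is_derive x 1 G (g x)) -> \int[leb]_x g x = 0.
Proof.
move=> Dg DG dG; have [Gy GNy] := dominated1_cvgy DG.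
transitivity (- G 0 - (- G (- 0))); last by rewrite oppr0 opprK addNr.
apply: (@integral_line A g G (fun x => - G (- x)) Dg) => //.
- exact: DG.1.
- move=> x _.
  have h := @is_derive1_comp R G (-%R) x (g (- x)) (-1) (dG (- x)) (is_deriveNid x 1).
  by have := is_deriveN h; rewrite mulrN1 opprK.
- apply: continuousN; apply: continuous_comp; first exact: opp_continuous.
  exact: DG.1.
- by rewrite -[X in _ --> X]oppr0; exact: cvgN.
Qed.

Lemma row_cons_line n (s : R) (x : 'rV[R]_n) :
  row_cons s x = row_cons 0 x + s *: delta_mx 0 ord0.
Proof. by rewrite !row_consE scale0r add0r addrC. Qed.

Lemma row_consDr n (s : R) (x y : 'rV[R]_n) h j : y = h *: delta_mx 0 j + x ->
  row_cons s y = h *: delta_mx 0 (lift ord0 j) + row_cons s x.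
Proof.
move=> ->; apply/rowP => i; rewrite !mxE /=; case: unliftP => [k ->|->] /=.
  by rewrite !mxE (inj_eq lift_inj).
by rewrite mulr0 add0r.
Qed.

Lemma is_derive_consl n (f : 'rV[R]_n.+1 -> R) (s : R) (x : 'rV[R]_n) d :
  is_derive (row_cons s x) (delta_mx 0 ord0) f d ->
  is_derive s 1 (fun s => f (row_cons s x)) d.
Proof.
rewrite {1}row_cons_line => /is_derive_line.
by congr (is_derive _ _ _ _); apply/funext => t; rewrite [in RHS]row_cons_line.
Qed.

Lemma is_derive_consr n (f : 'rV[R]_n.+1 -> R) (s : R) (x : 'rV[R]_n) j d :
  is_derive (row_cons s x) (delta_mx 0 (lift ord0 j)) f d ->
  is_derive x (delta_mx 0 j) (f \o row_cons s) d.
Proof.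
have E : (fun h : R => h^-1 *: (((f \o row_cons s) \o shift x) (h *: delta_mx 0 j) -
       (f \o row_cons s) x)) =
   (fun h => h^-1 *: ((f \o shift (row_cons s x)) (h *: delta_mx 0 (lift ord0 j)) -
       f (row_cons s x))).
  by apply/funext => h /=; rewrite (row_consDr s (erefl (h *: delta_mx 0 j + x))).
by move=> [df fd]; split; rewrite /derivable /derive E.
Qed.

(** Fubini in the order that puts the differentiated variable inside: the inner integral vanishes
    for every value of the outer variable. *)
Lemma integral_row_partial0 n (j : 'I_n) (A : R) (f df : 'rV[R]_n -> R) :
  dominated A f -> dominated A df ->
  (forall x, is_derive x (delta_mx 0 j) f (df x)) -> integral_row df = 0.
Proof.
elim: n j A f df => [[]//|n IH] j A f df Df Ddf dE.
have A0 := dominated_ge0 Df.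
have [E1 E2] := integral_row_cons Ddf.
case: (unliftP ord0 j) => [k jk|j0].
  have H s : integral_row (df \o row_cons s) = 0.
    apply: (IH k (A * wt1 s) (f \o row_cons s)).
    - exact: dominated_consr.
    - exact: dominated_consr.
    - by move=> x; apply: is_derive_consr; rewrite -jk.
  by rewrite E1 /Rintegral; under eq_integral do rewrite H; rewrite integral0.
have H x : \int[leb]_s df (row_cons s x) = 0.
  apply: (@integral_derive0 (A * wt x) _ (fun s => f (row_cons s x))).
  - exact: (dominated_consl _ Ddf).
  - exact: (dominated_consl _ Df).
  - by move=> s; apply: is_derive_consl; rewrite -j0.
rewrite E2 (_ : (fun x => _) = cst 0); first by rewrite /integral_row /Rintegral integral0.
by apply/funext => x; exact: H.
Qed.

End integral_of_derivative.

Notation normc := ComplexField.Normc.normc.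

(** * The Fourier transform *)

Section complex_integral.
Context {R : realType}.
Local Notation leb := (@lebesgue_measure R).
Implicit Types z k : R[i].

Lemma Re_le_normc z : `|cRe z| <= normc z.
Proof.
case: z => a b /=; rewrite -[`|a|]sqrtr_sqr ler_wsqrtr// lerDl; exact: sqr_ge0.
Qed.

Lemma Im_le_normc z : `|cIm z| <= normc z.
Proof.
case: z => a b /=; rewrite -[`|b|]sqrtr_sqr ler_wsqrtr// lerDr; exact: sqr_ge0.
Qed.

Lemma normc_ge0 z : 0 <= normc z.
Proof. by case: z => a b; exact: sqrtr_ge0. Qed.

Lemma normc_real (a : R) : normc a%:C = `|a|.
Proof. by rewrite /= expr0n addr0 sqrtr_sqr. Qed.

Lemma normc_le_ReIm z : normc z <= `|cRe z| + `|cIm z|.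
Proof.
case: z => a b /=; rewrite -[leRHS]ger0_norm ?addr_ge0// -[leRHS]sqrtr_sqr.
apply: ler_wsqrtr; rewrite sqrrD !real_normK ?num_real// addrAC lerDl.
by rewrite mulrn_wge0// mulr_ge0.
Qed.

Lemma normcZr (a : R) z : normc (a%:C * z) = `|a| * normc z.
Proof. by rewrite ComplexField.Normc.normcM normc_real. Qed.

Lemma normc_sum (I : Type) (s : seq I) (F : I -> R[i]) :
  normc (\sum_(i <- s) F i) <= \sum_(i <- s) normc (F i).
Proof.
elim: s => [|i s IH]; first by rewrite !big_nil ComplexField.Normc.normc0.
by rewrite !big_cons (le_trans (le_normcD _ _))// lerD2l.
Qed.

Lemma normc_expi (t : R) : normc (expi t) = 1.
Proof. by rewrite /= cos2Dsin2 sqrtr1. Qed.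

Lemma expiD (s t : R) : expi (s + t) = expi s * expi t.
Proof.
apply: complex_eq; rewrite ?Re_mulc ?Im_mulc /=; first exact: cosD.
by rewrite sinD addrC.
Qed.

Lemma expi0 : expi (0 : R) = 1.
Proof. by rewrite /expi cos0 sin0. Qed.

Definition cdom n (A : R) (f : 'rV[R]_n -> R[i]) : Prop :=
  dominated A (cRe \o f) /\ dominated A (cIm \o f).

Definition cdom1 (A : R) (g : R -> R[i]) : Prop :=
  dominated1 A (cRe \o g) /\ dominated1 A (cIm \o g).

Definition integral1 (g : R -> R[i]) : R[i] :=
  (\int[leb]_s cRe (g s)) +i* (\int[leb]_s cIm (g s)).

Definition ccontinuous (V : topologicalType) (f : V -> R[i]) : Prop :=
  continuous (cRe \o f) /\ continuous (cIm \o f).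

Lemma cdom_continuous n A (f : 'rV[R]_n -> R[i]) : cdom A f -> ccontinuous f.
Proof. by move=> [[cr _] [ci _]]. Qed.

Lemma cdom1_continuous A (f : R -> R[i]) : cdom1 A f -> ccontinuous f.
Proof. by move=> [[cr _] [ci _]]. Qed.

Lemma ccontinuousM (V : topologicalType) (f g : V -> R[i]) :
  ccontinuous f -> ccontinuous g -> ccontinuous (fun x => f x * g x).
Proof.
move=> [fr fi] [gr gi]; split.
  have -> : cRe \o (fun y => f y * g y) = (cRe \o f) * (cRe \o g) - (cIm \o f) * (cIm \o g).
    by apply/funext => y; rewrite /= Re_mulc.
  move=> x; apply: continuousB; apply: continuousM; [exact: fr|exact: gr|exact: fi|exact: gi].
have -> : cIm \o (fun y => f y * g y) = (cRe \o f) * (cIm \o g) + (cIm \o f) * (cRe \o g).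
  by apply/funext => y; rewrite /= Im_mulc.
move=> x; apply: continuousD; apply: continuousM; [exact: fr|exact: gi|exact: fi|exact: gr].
Qed.

Lemma ccontinuous_expi (V : topologicalType) (t : V -> R) :
  continuous t -> ccontinuous (fun x => expi (t x)).
Proof.
move=> ct; split => x.
  by apply: (@continuous_comp _ _ _ t (@cos R)); [exact: ct|exact: continuous_cos].
by apply: (@continuous_comp _ _ _ t (@sin R)); [exact: ct|exact: continuous_sin].
Qed.

Lemma cdom_intro n A (f : 'rV[R]_n -> R[i]) : ccontinuous f ->
  (forall x, normc (f x) <= A * wt x) -> cdom A f.
Proof.
move=> [cr ci] fA; split; split => // x; apply: le_trans (fA x).
  exact: Re_le_normc.
exact: Im_le_normc.
Qed.

Lemma cdom1_intro A (f : R -> R[i]) : ccontinuous f ->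
  (forall x, normc (f x) <= A * wt1 x) -> cdom1 A f.
Proof.
move=> [cr ci] fA; split; split => // x; apply: le_trans (fA x).
  exact: Re_le_normc.
exact: Im_le_normc.
Qed.

Lemma cdom_normc n A (f : 'rV[R]_n -> R[i]) x : cdom A f -> normc (f x) <= 2 * A * wt x.
Proof.
move=> [[_ fr] [_ fi]]; rewrite (le_trans (normc_le_ReIm _))//.
by rewrite -mulrA mulr2n mulrDl mul1r lerD//; [exact: fr|exact: fi].
Qed.

Lemma cdom1_normc A (f : R -> R[i]) x : cdom1 A f -> normc (f x) <= 2 * A * wt1 x.
Proof.
move=> [[_ fr] [_ fi]]; rewrite (le_trans (normc_le_ReIm _))//.
by rewrite -mulrA mulr2n mulrDl mul1r lerD//; [exact: fr|exact: fi].
Qed.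

Lemma cdomM n A (f g : 'rV[R]_n -> R[i]) : cdom A f -> ccontinuous g ->
  (forall x, normc (g x) <= 1) -> cdom (2 * A) (fun x => f x * g x).
Proof.
move=> Df cg g1; apply: cdom_intro.
  by apply: ccontinuousM => //; exact: cdom_continuous Df.
move=> x; rewrite ComplexField.Normc.normcM (le_trans _ (cdom_normc x Df))//.
by rewrite ler_piMr// normc_ge0.
Qed.

Lemma cdom1M A (f g : R -> R[i]) : cdom1 A f -> ccontinuous g ->
  (forall x, normc (g x) <= 1) -> cdom1 (2 * A) (fun x => f x * g x).
Proof.
move=> Df cg g1; apply: cdom1_intro.
  by apply: ccontinuousM => //; exact: cdom1_continuous Df.
move=> x; rewrite ComplexField.Normc.normcM (le_trans _ (cdom1_normc x Df))//.
by rewrite ler_piMr// normc_ge0.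
Qed.

Lemma cdom_ge0 n A (f : 'rV[R]_n -> R[i]) : cdom A f -> 0 <= A.
Proof. by move=> [/dominated_ge0]. Qed.

Lemma cdom1_ge0 A (f : R -> R[i]) : cdom1 A f -> 0 <= A.
Proof. by move=> [/dominated1_ge0]. Qed.

Lemma cdom_integral_le n A (f : 'rV[R]_n -> R[i]) : cdom A f ->
  normc (integral_Rn f) <= 2 * A * integral_row (@wt R n).
Proof.
move=> [fr fi]; rewrite (le_trans (normc_le_ReIm _))//.
by rewrite -mulrA mulr2n mulrDl mul1r lerD//; [exact: (dominated_integral_le fr)|exact: (dominated_integral_le fi)].
Qed.

Lemma integral_RnD n A B (f g : 'rV[R]_n -> R[i]) : cdom A f -> cdom B g ->
  integral_Rn (fun x => f x + g x) = integral_Rn f + integral_Rn g.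
Proof.
move=> [fr fi] [gr gi]; apply: complex_eq; rewrite ?Re_addc ?Im_addc /=.
  have <- := integral_rowD (dominated_integrable fr) (dominated_integrable gr).
  by apply: eq_Rintegral => t _; rewrite /= Re_addc.
have <- := integral_rowD (dominated_integrable fi) (dominated_integrable gi).
by apply: eq_Rintegral => t _; rewrite /= Im_addc.
Qed.

Lemma integral_RnZ n A k (f : 'rV[R]_n -> R[i]) : cdom A f ->
  integral_Rn (fun x => k * f x) = k * integral_Rn f.
Proof.
move=> [fr fi].
have ir := dominated_integrable fr; have ii := dominated_integrable fi.
have irk a : integrable_row (fun x => a * (cRe \o f) x) by exact: integrable_realZ.
have iik a : integrable_row (fun x => a * (cIm \o f) x) by exact: integrable_realZ.
apply: complex_eq; rewrite ?Re_mulc ?Im_mulc /=.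
  transitivity (integral_row (fun x => cRe k * (cRe \o f) x - cIm k * (cIm \o f) x)).
    by apply: eq_Rintegral => t _; rewrite /= Re_mulc.
  by rewrite integral_rowB// !integral_rowZ.
transitivity (integral_row (fun x => cRe k * (cIm \o f) x + cIm k * (cRe \o f) x)).
  by apply: eq_Rintegral => t _; rewrite /= Im_mulc.
by rewrite integral_rowD// !integral_rowZ.
Qed.

Lemma integral1Z A k (f : R -> R[i]) : cdom1 A f ->
  integral1 (fun x => k * f x) = k * integral1 f.
Proof.
move=> [fr fi].
have ir := dominated1_integrable fr; have ii := dominated1_integrable fi.
have irk a : leb.-integrable setT (EFin \o (fun x => a * (cRe \o f) x)) by exact: integrable_realZ.
have iik a : leb.-integrable setT (EFin \o (fun x => a * (cIm \o f) x)) by exact: integrable_realZ.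
apply: complex_eq; rewrite ?Re_mulc ?Im_mulc /=.
  transitivity (\int[leb]_x (cRe k * (cRe \o f) x - cIm k * (cIm \o f) x)).
    by apply: eq_Rintegral => t _; rewrite /= Re_mulc.
  by rewrite RintegralB// !RintegralZl.
transitivity (\int[leb]_x (cRe k * (cIm \o f) x + cIm k * (cRe \o f) x)).
  by apply: eq_Rintegral => t _; rewrite /= Im_mulc.
by rewrite RintegralD// !RintegralZl.
Qed.

Lemma cdom_consr n A (f : 'rV[R]_n.+1 -> R[i]) s : cdom A f ->
  cdom (A * wt1 s) (f \o row_cons s).
Proof. by move=> [fr fi]; split; [exact: (dominated_consr s fr)|exact: (dominated_consr s fi)]. Qed.

Lemma cdom_consl n A (f : 'rV[R]_n.+1 -> R[i]) x : cdom A f ->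
  cdom1 (A * wt x) (fun s => f (row_cons s x)).
Proof.
by move=> [fr fi]; split; [exact: (dominated_consl x fr)|exact: (dominated_consl x fi)].
Qed.

Lemma integral_Rn_cons n A (f : 'rV[R]_n.+1 -> R[i]) : cdom A f ->
  integral_Rn f = integral1 (fun s => integral_Rn (f \o row_cons s)) /\
  integral_Rn f = integral_Rn (fun x => integral1 (fun s => f (row_cons s x))).
Proof.
move=> [fr fi]; have [r1 r2] := integral_row_cons fr.
have [i1 i2] := integral_row_cons fi.
split; first exact: (f_equal2 (@Complex R) r1 i1).
exact: (f_equal2 (@Complex R) r2 i2).
Qed.

Lemma cdom_integral_consr n A (f : 'rV[R]_n.+1 -> R[i]) : cdom A f ->
  cdom1 (A * integral_row (@wt R n)) (fun s => integral_Rn (f \o row_cons s)).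
Proof. by move=> [fr fi]; split; [exact: (dominated_integral_consr fr)|exact: (dominated_integral_consr fi)]. Qed.

Lemma cdom_integral_consl n A (f : 'rV[R]_n.+1 -> R[i]) : cdom A f ->
  cdom (A * pi) (fun x => integral1 (fun s => f (row_cons s x))).
Proof.
by move=> [fr fi]; split; [exact: (dominated_integral_consl fr)|exact: (dominated_integral_consl fi)].
Qed.

End complex_integral.

Section dotp_theory.
Context {R : realType}.

Lemma dotp_cons n (s t : R) (x y : 'rV[R]_n) :
  dotp (row_cons s x) (row_cons t y) = s * t + dotp x y.
Proof.
rewrite /dotp big_ord_recl !row_cons0; congr (_ + _).
by apply: eq_bigr => j _; rewrite !row_consS.
Qed.

Lemma dotpC n (x y : 'rV[R]_n) : dotp x y = dotp y x.
Proof. by apply: eq_bigr => j _; rewrite mulrC. Qed.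

Lemma dotpDl n (x y z : 'rV[R]_n) : dotp (x + y) z = dotp x z + dotp y z.
Proof. by rewrite /dotp -big_split/=; apply: eq_bigr => j _; rewrite mxE mulrDl. Qed.

Lemma dotpZl n a (x z : 'rV[R]_n) : dotp (a *: x) z = a * dotp x z.
Proof. by rewrite /dotp mulr_sumr; apply: eq_bigr => j _; rewrite mxE mulrA. Qed.

Lemma dotpZr n a (x z : 'rV[R]_n) : dotp z (a *: x) = a * dotp z x.
Proof. by rewrite dotpC dotpZl dotpC. Qed.

Lemma dotp_delta n (x : 'rV[R]_n) j : dotp x (delta_mx 0 j) = x 0 j.
Proof.
rewrite /dotp (bigD1 j)//= mxE !eqxx mulr1 big1 ?addr0// => i ij.
by rewrite mxE (negbTE ij) andbF mulr0.
Qed.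

Lemma dotp_linear_proof n (x : 'rV[R]_n) : linear (dotp x : 'rV[R]_n -> R).
Proof. by move=> a u v; rewrite dotpC dotpDl dotpZl ![dotp _ x]dotpC. Qed.

Lemma differentiable_dotp n (x y : 'rV[R]_n) : differentiable (dotp x) y.
Proof.
rewrite (_ : dotp x = \sum_j (fun z : 'rV[R]_n => x 0 j * z 0 j)); last first.
  by apply/funext => z; rewrite fct_sumE.
apply: differentiable_sum => j; apply: differentiableM; first exact: differentiable_cst.
exact: differentiable_coord.
Qed.

Lemma continuous_dotp n (x : 'rV[R]_n) : continuous (dotp x).
Proof. by move=> y; exact: differentiable_continuous (differentiable_dotp x y). Qed.

End dotp_theory.

Section continuous_fun.
Context {R : realType} {T : topologicalType}.

Lemma continuous_funD (f g : T -> R) : continuous f -> continuous g ->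
  continuous (fun x => f x + g x).
Proof. by move=> cf cg x; exact: (continuousD (cf x) (cg x)). Qed.

Lemma continuous_funM (f g : T -> R) : continuous f -> continuous g ->
  continuous (fun x => f x * g x).
Proof. by move=> cf cg x; exact: (continuousM (cf x) (cg x)). Qed.

End continuous_fun.

Section fourier.
Context {R : realType} {n : nat}.
Implicit Types (f g : 'rV[R]_n -> R[i]) (x xi : 'rV[R]_n) (c : R).

(** The frequency [c] stays free: [- (2 * pi)] gives the transform of the statement and [2 * pi] its
    inverse. *)
Definition fourier c f xi : R[i] :=
  integral_Rn (fun x => f x * expi (c * dotp x xi)).

Definition mulx (j : 'I_n) f x : R[i] := (x 0 j)%:C * f x.

Lemma ccontinuous_wave c xi : ccontinuous (fun x => expi (c * dotp x xi)).
Proof.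
apply: ccontinuous_expi; apply: continuous_funM; first exact: cst_continuous.
have -> : (fun y : 'rV[R]_n => dotp y xi) = dotp xi by apply/funext => y; exact: dotpC.
exact: continuous_dotp.
Qed.

Lemma cdom_wave A f c xi : cdom A f -> cdom (2 * A) (fun x => f x * expi (c * dotp x xi)).
Proof.
move=> Df; apply: cdomM => //; first exact: ccontinuous_wave.
by move=> x; rewrite normc_expi.
Qed.

Lemma fourier_le A f c xi : cdom A f ->
  normc (fourier c f xi) <= 4 * A * integral_row (@wt R n).
Proof.
move=> Df; rewrite (le_trans (cdom_integral_le (cdom_wave c xi Df)))//.
by rewrite mulrA -natrM.
Qed.

Lemma fourierZ A k f c xi : cdom A f ->
  fourier c (fun x => k * f x) xi = k * fourier c f xi.
Proof.
move=> Df; rewrite /fourier -(integral_RnZ _ (cdom_wave c xi Df)).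
by congr integral_Rn; apply/funext => x; rewrite mulrA.
Qed.

Lemma fourierD A B f g c xi : cdom A f -> cdom B g ->
  fourier c (fun x => f x + g x) xi = fourier c f xi + fourier c g xi.
Proof.
move=> Df Dg; rewrite /fourier -(integral_RnD (cdom_wave c xi Df) (cdom_wave c xi Dg)).
by congr integral_Rn; apply/funext => x; rewrite mulrDl.
Qed.

Lemma derive_dotp x xi (v : 'rV[R]_n) : 'D_v (dotp x) xi = dotp x v.
Proof.
pose L : {linear 'rV[R]_n -> R} :=
  HB.pack (dotp x) (GRing.isLinear.Build _ _ _ _ _ (dotp_linear_proof x)).
rewrite -[RHS]/(L v) -[in LHS]/(L : 'rV[R]_n -> R) deriveE; last exact: differentiable_dotp.
by have -> := @diff_lin _ _ _ L xi (@continuous_dotp _ _ x).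
Qed.

Lemma dirderive_wave c x xi (v : 'rV[R]_n) :
  cdiff (fun xi => expi (c * dotp x xi)) xi /\
  dirderive v (fun xi => expi (c * dotp x xi)) xi =
    (0 +i* (c * dotp x v)) * expi (c * dotp x xi).
Proof.
have dl : differentiable (fun xi => c * dotp x xi) xi.
  by apply: differentiableM; [exact: differentiable_cst|exact: differentiable_dotp].
have dcos (t : R) : differentiable (@cos R) t.
  by apply/derivable1_diffP; exact: derivable_cos.
have dsin (t : R) : differentiable (@sin R) t.
  by apply/derivable1_diffP; exact: derivable_sin.
have Dl : 'D_v (fun xi => c * dotp x xi) xi = c * dotp x v.
  rewrite -(derive_dotp x xi) -[RHS]/(c *: _) -deriveZ//.
  by apply: diff_derivable; exact: differentiable_dotp.
split.
  split.
    by apply: (@differentiable_comp _ _ _ _ (fun xi => c * dotp x xi) (@cos R)).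
  by apply: (@differentiable_comp _ _ _ _ (fun xi => c * dotp x xi) (@sin R)).
apply: complex_eq; rewrite ?Re_mulc ?Im_mulc [LHS]/= ?[RHS]/=.
  by rewrite [LHS](derive_comp1 v dl (dcos _)) Dl derive_val /= mul0r sub0r mulrN.
by rewrite [LHS](derive_comp1 v dl (dsin _)) Dl derive_val /= mul0r add0r.
Qed.

Lemma row_coord_le (j : 'I_n) x : `|x 0 j| <= `|x|.
Proof.
rewrite [leRHS]mx_normrE.
exact: (le_bigmax _ (fun ij : 'I_1 * 'I_n => `|x ij.1 ij.2|) (0, j)).
Qed.

Lemma coord_linear (j : 'I_n) : linear (fun x : 'rV[R]_n => x 0 j : R).
Proof. by move=> a u v; rewrite !mxE. Qed.

Definition coord_lin (j : 'I_n) : {linear 'rV[R]_n -> R} :=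
  HB.pack (fun x : 'rV[R]_n => x 0 j : R) (GRing.isLinear.Build _ _ _ _ _ (coord_linear j)).

(** Differentiating the wave brings out [c x_j]; a common domination of [f] and all the [x_j f]
    therefore permits differentiation under the integral. *)
Lemma fourier_dirderive A f c xi : cdom A f -> (forall j, cdom A (mulx j f)) ->
  cdiff (fourier c f) xi /\
  forall j, dirderive (delta_mx 0 j) (fourier c f) xi =
    fourier c (fun x => (0 +i* c) * mulx j f x) xi.
Proof.
move=> Df Dx; have A0 := cdom_ge0 Df.
pose F (xi : 'rV[R]_n) (t : n.-tuple (measurableTypeR R)) :=
  f (tuple_row t) * expi (c * dotp (tuple_row t) xi).
have dF z t v : cdiff (F ^~ t) z /\
    dirderive v (F ^~ t) z = f (tuple_row t) *
      ((0 +i* (c * dotp (tuple_row t) v)) * expi (c * dotp (tuple_row t) z)).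
  have [d1 d2] := dirderive_wave c (tuple_row t) z v.
  by split; [apply: cdiffM => //; exact: cdiff_cst|rewrite dirderiveZ// d2].
have nDF j z t : normc (dirderive (delta_mx 0 j) (F ^~ t) z) <=
    (1 + `|c|) * (2 * A) * wt (tuple_row t).
  rewrite (dF z t _).2 dotp_delta !ComplexField.Normc.normcM normc_expi mulr1.
  have -> : normc (0 +i* (c * tuple_row t 0 j)) = `|c| * `|tuple_row t 0 j|.
    by rewrite /= expr0n add0r sqrtr_sqr normrM.
  rewrite mulrCA -[normc _ * _]mulrC -normcZr -mulrA.
  rewrite (@le_trans _ _ (`|c| * (2 * A * wt (tuple_row t))))//.
    by rewrite ler_wpM2l//; exact: (cdom_normc (tuple_row t) (Dx j)).
  by rewrite ler_wpM2r ?lerDr// mulr_ge0 ?wt_ge0// mulr_ge0.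
have nF z t : normc (F z t) <= (1 + `|c|) * (2 * A) * wt (tuple_row t).
  rewrite ComplexField.Normc.normcM normc_expi mulr1 (le_trans (cdom_normc (tuple_row t) Df))//.
  by rewrite -[leRHS]mulrA ler_peMl ?lerDl// mulr_ge0 ?wt_ge0// mulr_ge0.
have cD j t : ccontinuous (dirderive (delta_mx 0 j) (F ^~ t)).
  rewrite (_ : dirderive _ _ = (fun xi => (f (tuple_row t) *
      (0 +i* (c * dotp (tuple_row t) (delta_mx 0 j)))) * expi (c * dotp (tuple_row t) xi))).
    apply: ccontinuousM; first by split; exact: cst_continuous.
    apply: ccontinuous_expi; apply: continuous_funM; first exact: cst_continuous.
    exact: continuous_dotp.
  by apply/funext => z; rewrite (dF z t _).2 mulrA.
have G0 (t : n.-tuple (measurableTypeR R)) : 0 <= (1 + `|c|) * (2 * A) * wt (tuple_row t).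
  by rewrite mulr_ge0 ?wt_ge0// !mulr_ge0// addr_ge0.
have iG : (lebesgue_tuple R n).-integrable setT
    (EFin \o (fun t => (1 + `|c|) * (2 * A) * wt (tuple_row t))).
  by apply: integrable_realZ => //; exact: integrable_wt.
have bc (v : 'rV[R]_n) : v = \sum_j coord_lin j v *: delta_mx 0 j.
  by rewrite {1}(row_sum_delta v).
have [] := @differentiable_integral_param R _ _ _ (lebesgue_tuple R n) setT measurableT
  n (fun j => delta_mx 0 j) coord_lin bc row_coord_le (fun xi t => cRe (F xi t))
  _ xi 1 ltr01 _ _ iG G0 _ _ _.
- by move=> z _; have [/dominated_integrable] := cdom_wave c z Df.
- by move=> z t _ _; have [[]] := dF z t 0.
- by move=> z t _ _; rewrite (le_trans (Re_le_normc _))// nF.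
- by move=> j z t _ _; apply: le_trans (nDF j z t); exact: (Re_le_normc (dirderive _ _ _)).
- by move=> j t _; exact: (cD j t).1.
move=> dr Dr.
have [] := @differentiable_integral_param R _ _ _ (lebesgue_tuple R n) setT measurableT
  n (fun j => delta_mx 0 j) coord_lin bc row_coord_le (fun xi t => cIm (F xi t))
  _ xi 1 ltr01 _ _ iG G0 _ _ _.
- by move=> z _; have [_ /dominated_integrable] := cdom_wave c z Df.
- by move=> z t _ _; have [[]] := dF z t 0.
- by move=> z t _ _; rewrite (le_trans (Im_le_normc _))// nF.
- by move=> j z t _ _; apply: le_trans (nDF j z t); exact: (Im_le_normc (dirderive _ _ _)).
- by move=> j t _; exact: (cD j t).2.
move=> di Di; split; first by split.
move=> j.
have E t : dirderive (delta_mx 0 j) (F ^~ t) xi =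
    ((0 +i* c) * mulx j f (tuple_row t)) * expi (c * dotp (tuple_row t) xi).
  rewrite (dF xi t _).2 dotp_delta /mulx mulrA; congr (_ * _).
  rewrite mulrC mulrA; congr (_ * _).
  by apply: complex_eq; rewrite ?Re_mulc ?Im_mulc /=; ring.
apply: complex_eq.
  have [_ h] := Dr (delta_mx 0 j); rewrite [LHS]h.
  by apply: eq_Rintegral => t _; rewrite -E.
have [_ h] := Di (delta_mx 0 j); rewrite [LHS]h.
by apply: eq_Rintegral => t _; rewrite -E.
Qed.

Lemma fourier_partial A f c xi j : cdom A f -> cdom A (dirderive (delta_mx 0 j) f) ->
  (forall x, cdiff f x) ->
  fourier c (dirderive (delta_mx 0 j) f) xi = - (0 +i* (c * xi 0 j)) * fourier c f xi.
Proof.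
move=> Df Ddf df.
pose w (x : 'rV[R]_n) := expi (c * dotp x xi).
have wE : w = (fun x => expi (c * dotp xi x)) by apply/funext => x; rewrite /w dotpC.
have dw x : cdiff w x /\ dirderive (delta_mx 0 j) w x = (0 +i* (c * xi 0 j)) * w x.
  by rewrite wE; have := dirderive_wave c xi x (delta_mx 0 j); rewrite dotp_delta.
pose B := (2 * A) + (normc (0 +i* (c * xi 0 j))) * (2 * (2 * A)).
have Dw := cdom_wave c xi Df; have Ddw := cdom_wave c xi Ddf.
have A0 := cdom_ge0 Df.
have D3 : cdom (normc (0 +i* (c * xi 0 j)) * (2 * (2 * A)))
    (fun x => (0 +i* (c * xi 0 j)) * (f x * w x)).
  apply: cdom_intro.
    apply: ccontinuousM; last exact: cdom_continuous Dw.
    by split; exact: cst_continuous.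
  move=> x; rewrite ComplexField.Normc.normcM -!mulrA ler_wpM2l ?normc_ge0//.
  by have := cdom_normc x Dw; rewrite -!mulrA.
have EE x : dirderive (delta_mx 0 j) (fun x => f x * w x) x =
    dirderive (delta_mx 0 j) f x * w x + (0 +i* (c * xi 0 j)) * (f x * w x).
  by rewrite (dirderiveM _ (df x) (dw x).1) (dw x).2; congr (_ + _); rewrite mulrCA.
have B1 : 2 * A <= B by rewrite lerDl !mulr_ge0// normc_ge0.
have DB : cdom B (dirderive (delta_mx 0 j) (fun x => f x * w x)).
  rewrite (_ : dirderive _ _ = (fun x => dirderive (delta_mx 0 j) f x * w x +
     (0 +i* (c * xi 0 j)) * (f x * w x))); last by apply/funext.
  have [[c1 b1] [c2 b2]] := Ddw; have [[c3 b3] [c4 b4]] := D3.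
  have cR : cRe \o (fun x => dirderive (delta_mx 0 j) f x * w x +
     (0 +i* (c * xi 0 j)) * (f x * w x)) =
     (fun x => cRe (dirderive (delta_mx 0 j) f x * w x) + cRe ((0 +i* (c * xi 0 j)) * (f x * w x))).
    by apply/funext => x; rewrite /comp Re_addc.
  have cI : cIm \o (fun x => dirderive (delta_mx 0 j) f x * w x +
     (0 +i* (c * xi 0 j)) * (f x * w x)) =
     (fun x => cIm (dirderive (delta_mx 0 j) f x * w x) + cIm ((0 +i* (c * xi 0 j)) * (f x * w x))).
    by apply/funext => x; rewrite /comp Im_addc.
  split; rewrite ?cR ?cI; split.
  - exact: continuous_funD.
  - by move=> x; rewrite (le_trans (ler_normD _ _))// mulrDl lerD//; [exact: b1|exact: b3].
  - exact: continuous_funD.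
  - by move=> x; rewrite (le_trans (ler_normD _ _))// mulrDl lerD//; [exact: b2|exact: b4].
have dfw x : cdiff (fun x => f x * w x) x by apply: cdiffM; [exact: df|exact: (dw x).1].
have I0 : integral_Rn (dirderive (delta_mx 0 j) (fun x => f x * w x)) = 0.
  apply: complex_eq.
    apply: (@integral_row_partial0 R n j B (cRe \o (fun x => f x * w x))
      (cRe \o dirderive (delta_mx 0 j) (fun x => f x * w x))).
    - exact: dominated_le B1 Dw.1.
    - exact: DB.1.
    - by move=> x; apply: derivableP; apply: diff_derivable; exact: (dfw x).1.
  apply: (@integral_row_partial0 R n j B (cIm \o (fun x => f x * w x))
      (cIm \o dirderive (delta_mx 0 j) (fun x => f x * w x))).
  - exact: dominated_le B1 Dw.2.
  - exact: DB.2.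
  - by move=> x; apply: derivableP; apply: diff_derivable; exact: (dfw x).2.
move: I0; rewrite (_ : dirderive _ _ = (fun x => dirderive (delta_mx 0 j) f x * w x +
     (0 +i* (c * xi 0 j)) * (f x * w x))); last by apply/funext.
rewrite (integral_RnD Ddw D3) (integral_RnZ _ Dw) => /eqP.
by rewrite addr_eq0 -mulNr => /eqP.
Qed.

End fourier.

(** * Schwartz space *)

Section bounded_operators.
Context {R : realType}.

(** [List.In] because the indices form a bare type; they contain functions and differential
    operators. *)
Definition weights_le (I E P : Type) (w : I -> E -> P -> R) (J : seq I) (f : E) (B : R) :=
  forall i, List.In i J -> forall x, w i f x <= B.

(* Continuity for families of seminorms, with the weights estimated pointwise
   instead of the suprema that define the seminorms. *)
Definition bounded_op (I1 E1 P1 I2 E2 P2 : Type) (S : E1 -> Prop)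
    (w1 : I1 -> E1 -> P1 -> R) (w2 : I2 -> E2 -> P2 -> R) (T : E1 -> E2) : Prop :=
  forall i, exists (J : seq I1) (C : R), 0 <= C /\ forall f B, S f -> 0 <= B ->
    weights_le w1 J f B -> forall y, w2 i (T f) y <= C * B.

Lemma weights_le_cat (I E P : Type) (w : I -> E -> P -> R) J1 J2 f B :
  weights_le w (J1 ++ J2) f B -> weights_le w J1 f B /\ weights_le w J2 f B.
Proof. by move=> H; split => i Ji; apply: H; apply: List.in_or_app; [left|right]. Qed.

Section ops.
Context {I1 E1 P1 I2 E2 P2 : Type} {S : E1 -> Prop}.
Variables (w1 : I1 -> E1 -> P1 -> R) (w2 : I2 -> E2 -> P2 -> R).

Lemma bounded_op_seq (T : E1 -> E2) : bounded_op S w1 w2 T ->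
  forall L : seq I2, exists (J : seq I1) (C : R), 0 <= C /\ forall f B, S f -> 0 <= B ->
    weights_le w1 J f B -> weights_le w2 L (T f) (C * B).
Proof.
move=> bT; elim => [|i L [J [C [C0 H]]]]; first by exists [::], 0; split => // f B _ _ _ i [].
have [J1 [C1 [C10 H1]]] := bT i.
exists (J1 ++ J), (C1 + C); split; first exact: addr_ge0.
move=> f B Sf B0 fB k + x; have [b1 b2] := weights_le_cat fB => -[<-|Lk].
  by rewrite (le_trans (H1 f B Sf B0 b1 x))// ler_wpM2r// lerDl.
by rewrite (le_trans (H f B Sf B0 b2 k Lk x))// ler_wpM2r// lerDr.
Qed.

Lemma weights_le_exists (f : E1) : (forall i, exists B, forall x, w1 i f x <= B) ->
  forall J, exists2 B, 0 <= B & weights_le w1 J f B.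
Proof.
move=> H; elim => [|i J [B B0 HB]]; first by exists 0.
have [B1 HB1] := H i; exists (`|B1| + B); first exact: addr_ge0.
move=> k [<-|Jk] x; first by rewrite (le_trans (HB1 x))// (le_trans (ler_norm _))// lerDl.
by rewrite (le_trans (HB k Jk x))// lerDr.
Qed.

Lemma bounded_op_bounds (T : E1 -> E2) : bounded_op S w1 w2 T -> forall f, S f ->
  (forall i, exists B, forall x, w1 i f x <= B) ->
  forall i, exists B, forall x, w2 i (T f) x <= B.
Proof.
move=> bT f Sf bf i; have [J [C [C0 H]]] := bT i.
have [B B0 HB] := weights_le_exists bf J.
by exists (C * B) => x; exact: H.
Qed.

Lemma bounded_op_comp (I3 E3 P3 : Type) (w3 : I3 -> E3 -> P3 -> R) (S2 : E2 -> Prop)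
    (T : E1 -> E2) (U : E2 -> E3) :
  (forall f, S f -> S2 (T f)) -> bounded_op S w1 w2 T -> bounded_op S2 w2 w3 U ->
  bounded_op S w1 w3 (U \o T).
Proof.
move=> ST bT bU i; have [J [C [C0 H]]] := bU i.
have [J' [C' [C'0 H']]] := bounded_op_seq bT J.
exists J', (C * C'); split; first exact: mulr_ge0.
move=> f B Sf B0 fB y; rewrite -mulrA; apply: H.
- exact: ST.
- exact: mulr_ge0.
- exact: H'.
Qed.

Lemma bounded_op_add (T U V : E1 -> E2) : bounded_op S w1 w2 T -> bounded_op S w1 w2 U ->
  (forall i f y, S f -> w2 i (V f) y <= w2 i (T f) y + w2 i (U f) y) ->
  bounded_op S w1 w2 V.
Proof.
move=> bT bU VTU i; have [J [C [C0 H]]] := bT i; have [J' [C' [C'0 H']]] := bU i.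
exists (J ++ J'), (C + C'); split; first exact: addr_ge0.
move=> f B Sf B0 fB y; have [b1 b2] := weights_le_cat fB.
by rewrite (le_trans (VTU _ _ _ Sf))// mulrDl lerD//; [exact: H|exact: H'].
Qed.

End ops.
End bounded_operators.

Section schwartz_operators.
Context {R : realType} {n : nat}.
Local Notation E := ('rV[R]_n -> R[i]).
Implicit Types (f g : E) (x : 'rV[R]_n) (s : seq 'I_n).
Local Notation sw := (@schwartz_weight R n).

(** The continuous operators of the Schwartz space, closed under sums, multiples and composition.
    Polynomial differential operators thus inherit their estimates from the generators [mulx j] and
    the partial derivatives. *)
Definition sop (T : E -> E) : Prop :=
  (forall f, is_schwartz f -> is_schwartz (T f)) /\ bounded_op (@is_schwartz R n) sw sw T.

Lemma schwartz_bounds f : is_schwartz f -> forall i, exists B, forall x, sw i f x <= B.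
Proof. by move=> [_ b] i; have [B HB] := b i; exists B => x; apply: HB; exists x. Qed.

Lemma sop_intro (T : E -> E) :
  (forall f, is_schwartz f -> smooth_on setT (T f)) ->
  bounded_op (@is_schwartz R n) sw sw T -> sop T.
Proof.
move=> smT bT; split => // f Sf; split; first exact: smT.
move=> i; have [B HB] := bounded_op_bounds bT Sf (schwartz_bounds Sf) i.
by exists B => _ [x _ <-].
Qed.

Lemma sop_comp T U : sop T -> sop U -> sop (U \o T).
Proof.
move=> [ST bT] [SU bU]; split; first by move=> f /ST/SU.
exact: bounded_op_comp bT bU.
Qed.

Lemma partial_rcons s j f : partial (rcons s j) f = partial s (dirderive (delta_mx 0 j) f).
Proof. by rewrite /partial map_rcons /iter_dirderive foldr_rcons. Qed.

Lemma schwartz_smooth f : is_schwartz f -> smooth_on setT f. Proof. by case. Qed.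

Lemma smooth_partial s f : smooth_on setT f -> smooth_on setT (partial s f).
Proof. exact: smooth_on_iter. Qed.

Lemma partialD s f g : smooth_on setT f -> smooth_on setT g ->
  partial s (fun x => f x + g x) = fun x => partial s f x + partial s g x.
Proof.
move=> sf sg; elim: s => [//|j s IH]; apply/funext => x.
rewrite /partial /= -!/(partial _ _) IH dirderiveD//;
  exact: smooth_on_cdiff (smooth_partial s _) I.
Qed.

Lemma partialZ s k f : smooth_on setT f ->
  partial s (fun x => k * f x) = fun x => k * partial s f x.
Proof.
move=> sf; elim: s => [//|j s IH]; apply/funext => x.
rewrite /partial /= -!/(partial _ _) IH dirderiveZ//.
exact: smooth_on_cdiff (smooth_partial s _) I.
Qed.

Lemma sop_id : sop id.
Proof.
split=> // i; exists [:: i], 1; split => // f B _ _ H y.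
by rewrite mul1r; apply: H; left.
Qed.

Lemma sop_partial j : sop (dirderive (delta_mx 0 j)).
Proof.
apply: sop_intro; first by move=> f [sf _]; exact: smooth_on_dirderive.
move=> [a s]; exists [:: (a, rcons s j)], 1; split => // f B _ _ H y.
have := H (a, rcons s j) (or_introl erefl) y.
by rewrite /schwartz_weight /= partial_rcons mul1r.
Qed.

Lemma sopZ k T : sop T -> sop (fun f x => k * T f x).
Proof.
move=> [ST bT]; apply: sop_intro.
  move=> f /ST[sf _]; apply: smooth_onM => //; [exact: openT|exact: smooth_on_cst].
move=> i; have [J [C [C0 H]]] := bT i.
exists J, (normc k * C); split; first by rewrite mulr_ge0// normc_ge0.
move=> f B Sf B0 fB y; rewrite -mulrA.
have <- : normc k * sw i (T f) y = sw i (fun x => k * T f x) y.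
  rewrite /schwartz_weight partialZ; last exact: (ST f Sf).1.
  by rewrite -ComplexField.Normc.normcM mulrCA.
by rewrite ler_wpM2l ?normc_ge0//; exact: H.
Qed.

Lemma sopD T U : sop T -> sop U -> sop (fun f x => T f x + U f x).
Proof.
move=> [ST bT] [SU bU]; apply: sop_intro.
  by move=> f Sf; apply: smooth_onD; [exact: openT|exact: (ST f Sf).1|exact: (SU f Sf).1].
apply: (bounded_op_add bT bU) => i f y Sf.
rewrite /schwartz_weight partialD; [|exact: (ST f Sf).1|exact: (SU f Sf).1].
by rewrite mulrDr le_normcD.
Qed.

(** The commutator of [partial s] with multiplication by [x_j]: one term for each occurrence of [j]
    in [s], with that occurrence deleted. *)
Fixpoint comm_terms (j : 'I_n) s : seq (seq 'I_n) :=
  if s is i :: s' then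
    (if i == j then [:: s'] else [::]) ++ [seq i :: t | t <- comm_terms j s']
  else [::].

Lemma smooth_coord j : smooth_on setT (fun x : 'rV[R]_n => (x 0 j)%:C).
Proof.
apply: smooth_on_real => k; apply: (@Ck_linear _ _ _ _ (coord_lin j)).
exact: coord_continuous.
Qed.

Lemma dirderive_coord j (v x : 'rV[R]_n) :
  dirderive v (fun x : 'rV[R]_n => (x 0 j)%:C) x = (v 0 j)%:C.
Proof.
rewrite /dirderive /comp /= derive_cst; congr (_ +i* _).
have dc := @differentiable_coord R 1 n x 0 j.
rewrite deriveE//.
by have -> := @diff_lin _ _ _ (coord_lin j) x (@coord_continuous _ _ _ 0 j).
Qed.

Lemma smooth_mulx j f : smooth_on setT f -> smooth_on setT (mulx j f).
Proof. by move=> sf; apply: smooth_onM => //; [exact: openT|exact: smooth_coord]. Qed.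

Lemma partial_mulx s j f : smooth_on setT f -> forall x,
  partial s (mulx j f) x =
    (x 0 j)%:C * partial s f x + \sum_(t <- comm_terms j s) partial t f x.
Proof.
move=> sf; elim: s => [|i s IH] x; first by rewrite big_nil addr0.
have cf t y : cdiff (partial t f) y by exact: smooth_on_cdiff (smooth_partial t sf) I.
have cc y : cdiff (fun x : 'rV[R]_n => (x 0 j)%:C) y.
  exact: smooth_on_cdiff (smooth_coord j) I.
rewrite /partial [LHS]/= -/(partial s (mulx j f)).
have -> : partial s (mulx j f) = (fun x => (x 0 j)%:C * partial s f x +
   \sum_(t <- comm_terms j s) partial t f x) by apply/funext.
have [d1 d2] := @dirderive_sum _ _ _ (comm_terms j s) (fun t => partial t f) x
   (delta_mx 0 i) (fun t => cf t x).
rewrite dirderiveD//; last by apply: cdiffM.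
rewrite dirderiveM// dirderive_coord d2 big_cat big_map/= addrA; congr (_ + _).
rewrite addrC; congr (_ + _); rewrite mxE eqxx/= eq_sym.
by case: eqP => _; rewrite ?big_seq1 ?mul1r// big_nil mul0r.
Qed.

Lemma sop_mulx j : sop (mulx j).
Proof.
apply: sop_intro; first by move=> f [sf _]; exact: smooth_mulx.
move=> [a s].
pose a' k := if k == j then (a k).+1 else a k.
exists ((a', s) :: [seq (a, t) | t <- comm_terms j s]), (1 + (size (comm_terms j s))%:R).
split; first by rewrite addr_ge0.
move=> f B [sf _] B0 H y; rewrite /schwartz_weight /= partial_mulx// mulrDr.
rewrite (le_trans (le_normcD _ _))// mulrDl mul1r lerD//.
  have := H (a', s) (or_introl erefl) y; rewrite /schwartz_weight /= mulrA -rmorphM/=.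
  congr (normc (_%:C * _) <= _); rewrite (bigD1 j)//= [in RHS](bigD1 j)//= /a' eqxx.
  rewrite exprSr mulrAC; congr (_ * _ * _); apply: eq_bigr => k kj.
  by rewrite (negbTE kj).
rewrite mulr_sumr (le_trans (normc_sum _ _))//.
have : forall t, List.In t (comm_terms j s) -> sw (a, t) f y <= B.
  move=> t ts; apply: H; right; exact: (List.in_map (fun t => (a, t))).
rewrite /schwartz_weight /=; elim: (comm_terms j s) => [|t L IH] HL.
  by rewrite big_nil mul0r.
rewrite big_cons /= -natr1 mulrDl mul1r addrC lerD//.
  by apply: IH => u uL; apply: HL; right.
by apply: HL; left.
Qed.

Definition index0 : schwartz_index := (fun=> 0%N, [::] : seq 'I_n).

Lemma schwartz_weight0 f x : sw index0 f x = normc (f x).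
Proof. by rewrite /schwartz_weight /= big1 ?mul1r. Qed.

Lemma sop_oneDsqr j : sop (fun f x => f x + mulx j (mulx j f) x).
Proof. by apply: sopD; [exact: sop_id|apply: sop_comp; exact: sop_mulx]. Qed.

Lemma sop_wtV s : exists2 Q, sop Q &
  forall f x, Q f x = (\prod_(j <- s) (1 + x 0 j ^+ 2))%:C * f x.
Proof.
elim: s => [|j s [Q sQ QE]].
  by exists id; [exact: sop_id|move=> f x; rewrite big_nil mul1r].
exists (fun f => (fun x => Q f x + mulx j (mulx j (Q f)) x)).
  exact: (sop_comp sQ (sop_oneDsqr j)).
move=> f x; rewrite big_cons /mulx QE rmorphM/= -mulrA rmorphD/= rmorph1 mulrDl mul1r.
by rewrite rmorphXn/= expr2 !mulrA.
Qed.

Lemma schwartz_continuous f : is_schwartz f -> ccontinuous f.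
Proof.
move=> [sf _]; split=> x; apply: differentiable_continuous.
  by have [] := smooth_on_cdiff sf (I : setT x).
by have [] := smooth_on_cdiff sf (I : setT x).
Qed.

(** [1 / wt] is a polynomial, so multiplication by it is a continuous operator; its estimate for the
    weight [index0] says that [|f|] is at most [C * B * wt]. *)
Lemma schwartz_cdom_uniform : exists (J : seq schwartz_index) (C : R), 0 <= C /\
  forall f B, is_schwartz f -> 0 <= B -> weights_le sw J f B -> cdom (C * B) f.
Proof.
have [Q [SQ bQ] QE] := sop_wtV (index_enum 'I_n).
have [J [C [C0 H]]] := bQ index0.
exists J, C; split => // f B Sf B0 fB; apply: cdom_intro; first exact: schwartz_continuous.
move=> x; have := H f B Sf B0 fB x; rewrite schwartz_weight0 QE normcZr.
have -> : \prod_(j <- index_enum 'I_n) (1 + x 0 j ^+ 2) = (wt x)^-1.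
  by rewrite /wt -prodfV; apply: eq_bigr => j _; rewrite /wt1 invrK.
by rewrite ger0_norm ?invr_ge0 ?wt_ge0// mulrC ler_pdivrMr// wt_gt0.
Qed.

Lemma schwartz_cdom f : is_schwartz f -> exists A, cdom A f.
Proof.
move=> Sf; have [J [C [C0 H]]] := schwartz_cdom_uniform.
have [B B0 HB] := weights_le_exists (schwartz_bounds Sf) J.
by exists (C * B); exact: H.
Qed.

Lemma cdom_le A B f : A <= B -> cdom A f -> cdom B f.
Proof. by move=> AB [h1 h2]; split; [exact: dominated_le h1|exact: dominated_le h2]. Qed.

Lemma schwartz_cdom_mulx f : is_schwartz f ->
  exists A, cdom A f /\ forall j, cdom A (mulx j f).
Proof.
move=> Sf; have [A0 h0] := schwartz_cdom Sf.
have /choice[A hA] j : exists A, cdom A (mulx j f).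
  by apply: schwartz_cdom; exact: (sop_mulx j).1.
exists (A0 + \sum_j A j); split.
  by apply: cdom_le h0; rewrite lerDl sumr_ge0// => j _; exact: cdom_ge0 (hA j).
move=> j; apply: cdom_le (hA j); rewrite (bigD1 j)//= addrCA lerDl addr_ge0 ?(cdom_ge0 h0)//.
by rewrite sumr_ge0// => i _; exact: cdom_ge0 (hA i).
Qed.

Lemma schwartz_cdom_partial f j : is_schwartz f ->
  exists A, cdom A f /\ cdom A (dirderive (delta_mx 0 j) f).
Proof.
move=> Sf; have [A hA] := schwartz_cdom Sf.
have [B hB] := schwartz_cdom ((sop_partial j).1 f Sf).
exists (A + B); split; first by apply: cdom_le hA; rewrite lerDl (cdom_ge0 hB).
by apply: cdom_le hB; rewrite lerDr (cdom_ge0 hA).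
Qed.

Lemma sop_iter_mulx c (s : seq 'I_n) : exists2 Q, sop Q &
  forall f, is_schwartz f -> partial s (fourier c f) = fourier c (Q f).
Proof.
elim: s => [|j s [Q sQ QE]]; first by exists id => //; exact: sop_id.
exists ((fun f x => (0 +i* c) * mulx j f x) \o Q).
  by apply: sop_comp => //; exact: sopZ (sop_mulx j).
move=> f Sf; rewrite /partial /= -/(partial s _) QE//.
apply/funext => x; have [A [h1 h2]] := schwartz_cdom_mulx (sQ.1 f Sf).
by have [_ ->] := fourier_dirderive c x h1 h2.
Qed.

Lemma fourier_smooth c f : is_schwartz f -> smooth_on setT (fourier c f).
Proof.
move=> Sf; apply/smooth_onP.
suff H k : forall f, is_schwartz f -> Ck k setT (cRe \o fourier c f) /\
    Ck k setT (cIm \o fourier c f) by split => k; have [] := H k f Sf.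
elim: k => [|k IH] {}f {}Sf; have [A [h1 h2]] := schwartz_cdom_mulx Sf.
  by do 2 split => //; move=> x _; have [[]] := fourier_dirderive c x h1 h2.
have dv v x : dirderive v (fourier c f) x =
    \sum_j (v 0 j)%:C * fourier c (fun y => (0 +i* c) * mulx j f y) x.
  have [d1 d2] := fourier_dirderive c x h1 h2.
  rewrite {1}(row_sum_delta v) dirderive_lin//.
  by apply: eq_bigr => j _; rewrite d2.
have Sj j : is_schwartz (fun y => (0 +i* c) * mulx j f y).
  exact: (sopZ (0 +i* c) (sop_mulx j)).1.
split; (split; first by move=> x _; have [[]] := fourier_dirderive c x h1 h2) => v.
  apply: (@Ck_eq _ _ _ _ (fun x => \sum_j v 0 j *
    (cRe \o fourier c (fun y => (0 +i* c) * mulx j f y)) x)).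
  - exact: openT.
  - move=> x _; rewrite -[RHS]/(cRe (dirderive v (fourier c f) x)) dv Re_sum.
    by apply: eq_bigr => j _; rewrite Re_mulc /= mul0r subr0.
  - apply: Ck_sum => [|j]; first exact: openT.
    by apply: CkZ; [exact: openT|exact: (IH _ (Sj j)).1].
apply: (@Ck_eq _ _ _ _ (fun x => \sum_j v 0 j *
    (cIm \o fourier c (fun y => (0 +i* c) * mulx j f y)) x)).
- exact: openT.
- move=> x _; rewrite -[RHS]/(cIm (dirderive v (fourier c f) x)) dv Im_sum.
  by apply: eq_bigr => j _; rewrite Im_mulc /= mul0r addr0.
- apply: Ck_sum => [|j]; first exact: openT.
  by apply: CkZ; [exact: openT|exact: (IH _ (Sj j)).2].
Qed.

Lemma fourier_mulx (c : R) f j x : c != 0 -> is_schwartz f ->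
  (x 0 j)%:C * fourier c f x =
  fourier c (fun y => (0 +i* c^-1) * dirderive (delta_mx 0 j) f y) x.
Proof.
move=> c0 Sf; have [A [h1 h2]] := schwartz_cdom_partial j Sf.
have df y : cdiff f y by exact: smooth_on_cdiff (schwartz_smooth Sf) I.
rewrite (fourierZ _ _ _ h2) (fourier_partial c x h1 h2 df).
rewrite mulrA; congr (_ * _); apply: complex_eq; rewrite ?Re_mulc ?Im_mulc /=.
  by field.
by field.
Qed.

Lemma sop_iter_partial (c : R) (a : 'I_n -> nat) s : c != 0 -> exists2 Q, sop Q &
  forall f, is_schwartz f -> forall x,
  (\prod_(j <- s) x 0 j ^+ a j)%:C * fourier c f x = fourier c (Q f) x.
Proof.
move=> c0; elim: s => [|j s [Q sQ QE]].
  by exists id; [exact: sop_id|move=> f _ x; rewrite big_nil mul1r].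
have [P sP PE] : exists2 P, sop P & forall f, is_schwartz f -> forall x,
    (x 0 j ^+ a j)%:C * fourier c f x = fourier c (P f) x.
  elim: (a j) => [|k [P sP PE]].
    by exists id; [exact: sop_id|move=> f _ x; rewrite mul1r].
  exists ((fun f y => (0 +i* c^-1) * dirderive (delta_mx 0 j) f y) \o P).
    by apply: sop_comp => //; exact: sopZ (sop_partial j).
  move=> f Sf x; rewrite exprS rmorphM/= -mulrA PE// fourier_mulx//.
  exact: sP.1.
exists (P \o Q); first exact: sop_comp.
move=> f Sf x; rewrite big_cons rmorphM/= -mulrA QE// PE//.
exact: sQ.1.
Qed.

(** A monomial times a derivative of the transform is the transform of [P (Q f)] for operators [P]
    and [Q] of the class [sop], and a transform is bounded by the domination constant of its
    argument. *)
Lemma sop_fourier (c : R) : c != 0 -> sop (fourier c).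
Proof.
move=> c0; apply: sop_intro; first exact: fourier_smooth.
move=> [a s].
have [Q sQ QE] := sop_iter_mulx c s.
have [P sP PE] := sop_iter_partial a (index_enum 'I_n) c0.
have [SPQ bPQ] := sop_comp sQ sP.
have [J [C [C0 H]]] := schwartz_cdom_uniform.
have [J' [C' [C'0 H']]] := bounded_op_seq bPQ J.
have K0 : 0 <= integral_row (@wt R n).
  by apply: Rintegral_ge0 => t _; exact: wt_ge0.
exists J', (4 * (C * C') * integral_row (@wt R n)); split.
  by rewrite !mulr_ge0.
move=> f B Sf B0 fB y; rewrite /schwartz_weight /= QE// PE; last exact: sQ.1.
have CB0 : 0 <= C' * B by exact: mulr_ge0.
have := fourier_le c y (H _ _ (SPQ f Sf) CB0 (H' f B Sf B0 fB)).
move=> /le_trans; apply; rewrite le_eqVlt; apply/orP; left; apply/eqP.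
by ring.
Qed.

End schwartz_operators.

(** * Fourier inversion *)

Section one_dimensional_inversion.
Context {R : realType}.
Local Notation leb := (@lebesgue_measure R).

(** From the square of [1 + e t / 2 <= exp (e t / 2)]: the constant [4 / e^2] turns [(e t / 2)^2]
    into [t^2]. *)
Lemma expRN_le_wt1 (e t : R) : 0 < e -> 0 <= t ->
  expR (- (e * t)) <= (1 + 4 / e ^+ 2) * wt1 t.
Proof.
move=> e0 t0; have et0 : 0 <= e * t by rewrite mulr_ge0// ltW.
have h1 : 1 + e * t / 2 <= expR (e * t / 2) by exact: expR_ge1Dx.
have h2 : (1 + e * t / 2) ^+ 2 <= expR (e * t).
  rewrite [X in expR X](_ : _ = e * t / 2 + e * t / 2); last by field.
  rewrite expRD -expr2 lerXn2r// ?nnegrE ?expR_ge0//.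
  by rewrite addr_ge0// divr_ge0.
have w0 : 0 < 1 + t ^+ 2 by rewrite ltr_pwDl// sqr_ge0.
rewrite expRN /wt1 ler_pdivlMr// mulrC ler_pdivrMr ?expR_gt0//.
have c0 : 0 <= 1 + 4 / e ^+ 2 by rewrite addr_ge0// divr_ge0// sqr_ge0.
apply: le_trans (ler_wpM2l c0 h2).
rewrite -subr_ge0 (_ : _ - _ = e * t + e ^+ 2 * t ^+ 2 / 4 + 4 / e ^+ 2 + 4 * t / e); last first.
  by field; rewrite gt_eqF.
by rewrite !addr_ge0// ?divr_ge0 ?mulr_ge0 ?sqr_ge0// ltW.
Qed.

Definition damp (e t : R) : R := expR (- (e * `|t|)).

Lemma damp_le e t : 0 < e -> damp e t <= (1 + 4 / e ^+ 2) * wt1 t.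
Proof.
move=> e0; have := expRN_le_wt1 e0 (normr_ge0 t).
by rewrite /wt1 real_normK ?num_real.
Qed.

Lemma damp_ge0 e t : 0 <= damp e t. Proof. exact: expR_ge0. Qed.

Lemma damp_le1 e t : 0 <= e -> damp e t <= 1.
Proof. by move=> e0; rewrite /damp -expR0 ler_expR oppr_le0 mulr_ge0. Qed.

Lemma continuous_damp e : continuous (damp e).
Proof.
have c1 : continuous (fun t : R => - (e * `|t|)).
  rewrite (_ : (fun t : R => _) = (fun t : R => (- e) * `|t|)); last first.
    by apply/funext => t; rewrite mulNr.
  by apply: continuous_funM; [exact: cst_continuous|exact: norm_continuous].
by move=> t; apply: (continuous_comp (c1 t)); exact: continuous_expR.
Qed.

Lemma cvgy_wt1 (A : R) (h : R -> R) : (forall x, 0 <= x -> `|h x| <= A * wt1 x) ->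
  h x @[x --> +oo%R] --> (0 : R).
Proof.
move=> hA; apply/cvgrPdist_le => e e0.
have A0 : 0 <= A.
  by have := le_trans (normr_ge0 _) (hA 0 (lexx 0)); rewrite pmulr_lge0// wt1_gt0.
near=> x.
have x1 : 1 <= x by near: x; apply: nbhs_pinfty_ge; rewrite num_real.
have xA : A / e <= x by near: x; apply: nbhs_pinfty_ge; rewrite num_real.
have x0 : 0 <= x by exact: le_trans x1.
rewrite sub0r normrN (le_trans (hA x x0))//.
rewrite /wt1 ler_pdivrMr ?ltr_pwDl ?sqr_ge0//.
move: xA; rewrite ler_pdivrMr// mulrC => xA; rewrite (le_trans xA)// ler_wpM2l ?(ltW e0)//.
by rewrite expr2 -[leLHS]add0r lerD// ler_peMl.
Unshelve. all: by end_near. Qed.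

(** Combinations of the damped cosine and sine are stable under derivation, so a primitive of either
    is found by solving a linear system for [a] and [b]. *)
Lemma is_derive_damped (e y a b x : R) :
  is_derive x 1 (fun t => expR (- (e * t)) * (a * cos (y * t) + b * sin (y * t)))
    (expR (- (e * x)) * ((b * y - e * a) * cos (y * x) - (a * y + e * b) * sin (y * x))).
Proof.
have dl (k : R) : is_derive x 1 (fun t => k * t) k.
  by have := @is_deriveZ R R^o R^o id k x 1 1 (is_derive_id x 1); rewrite -[_ *: 1]/(_ * 1) mulr1.
have dE : is_derive x 1 (fun t => expR (- (e * t))) (expR (- (e * x)) * - e).
  exact: (@is_derive1_comp R expR (fun t => - (e * t))).
have dC : is_derive x 1 (fun t => cos (y * t)) (- sin (y * x) * y).
  exact: (@is_derive1_comp R cos (fun t => y * t)).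
have dS : is_derive x 1 (fun t => sin (y * t)) (cos (y * x) * y).
  exact: (@is_derive1_comp R sin (fun t => y * t)).
have dCS := is_deriveD (is_deriveZ a dC) (is_deriveZ b dS).
have H := is_deriveM dE dCS.
rewrite (_ : expR _ * _ = expR (- (e * x)) *: (a *: (- sin (y * x) * y) + b *: (cos (y * x) * y)) +
  (a * cos (y * x) + b * sin (y * x)) *: (expR (- (e * x)) * - e)); first exact: H.
by rewrite -![_ *: _]/(_ * _); ring.
Qed.

Lemma poisson_kernel (e y : R) : 0 < e ->
  \int[leb]_t (damp e t * cos (y * t)) = 2 * e / (e ^+ 2 + y ^+ 2) /\
  \int[leb]_t (damp e t * sin (y * t)) = 0.
Proof.
move=> e0; set A := 1 + 4 / e ^+ 2.
have A0 : 0 <= A by rewrite addr_ge0// divr_ge0// sqr_ge0.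
have D0 : e ^+ 2 + y ^+ 2 != 0 by rewrite gt_eqF// ltr_pwDl// ?exprn_gt0// sqr_ge0.
have clin : continuous (fun t : R => y * t).
  by apply: continuous_funM; [exact: cst_continuous|move=> t; exact: cvg_id].
have dom (h : R -> R) : continuous h -> (forall t, `|h t| <= 1) ->
    dominated1 A (fun t => damp e t * h t).
  move=> ch h1; split; first by apply: continuous_funM => //; exact: continuous_damp.
  move=> t; rewrite normrM (ger0_norm (damp_ge0 e t)).
  by rewrite (le_trans (ler_piMr (damp_ge0 _ _) (h1 t)))// damp_le.
have ccos : continuous (fun t : R => cos (y * t)).
  by move=> t; apply: (continuous_comp (clin t)); exact: continuous_cos.
have csin : continuous (fun t : R => sin (y * t)).
  by move=> t; apply: (continuous_comp (clin t)); exact: continuous_sin.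
have cos1 t : `|cos (y * t)| <= 1 by rewrite ler_norml cos_geN1 cos_le1.
have sin1 t : `|sin (y * t)| <= 1 by rewrite ler_norml sin_geN1 sin_le1.
pose G a b (t : R) := expR (- (e * t)) * (a * cos (y * t) + b * sin (y * t)).
have G0 a b : G a b 0 = a.
  by rewrite /G !mulr0 oppr0 expR0 cos0 sin0 mulr0 addr0 mulr1 mul1r.
have cG a b : {for 0, continuous (G a b)}.
  apply: differentiable_continuous; apply/derivable1_diffP.
  by have [] := is_derive_damped e y a b 0.
have Goo a b : G a b x @[x --> +oo%R] --> (0 : R).
  apply: (@cvgy_wt1 (A * (`|a| + `|b|))) => x x0.
  rewrite /G normrM ger0_norm ?expR_ge0// mulrAC.
  apply: ler_pM; rewrite ?expR_ge0//; first exact: expRN_le_wt1.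
  rewrite (le_trans (ler_normD _ _))// !normrM.
  by apply: lerD; rewrite ler_piMr.
have dG a b (x : R) : 0 < x -> is_derive x 1 (G a b)
    (damp e x * ((b * y - e * a) * cos (y * x) - (a * y + e * b) * sin (y * x))).
  move=> x0; have := is_derive_damped e y a b x.
  by rewrite /damp gtr0_norm.
split.
  (* The coefficients solve [b y - e a = 1] and [a y + e b = 0]. The integrand is even, so the same
     primitive serves both half-lines. *)
  transitivity (- G (- e / (e ^+ 2 + y ^+ 2)) (y / (e ^+ 2 + y ^+ 2)) 0 -
     G (- e / (e ^+ 2 + y ^+ 2)) (y / (e ^+ 2 + y ^+ 2)) 0); last by rewrite G0; field.
  apply: (@integral_line R A _ (G (- e / (e ^+ 2 + y ^+ 2)) (y / (e ^+ 2 + y ^+ 2)))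
     (G (- e / (e ^+ 2 + y ^+ 2)) (y / (e ^+ 2 + y ^+ 2))) (dom _ ccos cos1)) => //.
  - move=> x x0; apply: is_derive_eq (dG _ _ _ x0) _; congr (_ * _).
    by field.
  - move=> x x0; apply: is_derive_eq (dG _ _ _ x0) _; rewrite /damp normrN mulrN cosN; congr (_ * _).
    by field.
(* Now [b y - e a = 0] and [a y + e b = -1]. The integrand is odd: the reflected half-line takes the
   opposite coefficients, and the two contributions cancel. *)
transitivity (- G (- y / (e ^+ 2 + y ^+ 2)) (- e / (e ^+ 2 + y ^+ 2)) 0 -
     G (y / (e ^+ 2 + y ^+ 2)) (e / (e ^+ 2 + y ^+ 2)) 0); last by rewrite !G0; field.
apply: (@integral_line R A _ (G (- y / (e ^+ 2 + y ^+ 2)) (- e / (e ^+ 2 + y ^+ 2)))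
     (G (y / (e ^+ 2 + y ^+ 2)) (e / (e ^+ 2 + y ^+ 2))) (dom _ csin sin1)) => //.
- move=> x x0; apply: is_derive_eq (dG _ _ _ x0) _; congr (_ * _).
  by field.
- move=> x x0; apply: is_derive_eq (dG _ _ _ x0) _; rewrite /damp normrN mulrN sinN; congr (_ * _).
  by field.
Qed.

(** An instance of Peetre's inequality. Cleared of denominators, the difference of the two sides is
    a sum of nonnegative terms. *)
Lemma wt1_shift_le (x y : R) : wt1 (y - x) <= 2 * (1 + x ^+ 2) * wt1 y.
Proof.
have h (t : R) : 0 < 1 + t ^+ 2 by rewrite ltr_pwDl// sqr_ge0.
rewrite /wt1 ler_pdivlMr// mulrC ler_pdivrMr//.
rewrite -subr_ge0 (_ : _ - _ = (y - 2 * x) ^+ 2 + 1 + 2 * x ^+ 2 * (y - x) ^+ 2); last by ring.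
by rewrite !addr_ge0// ?sqr_ge0// mulr_ge0 ?sqr_ge0// mulr_ge0// sqr_ge0.
Qed.

Definition poisson (e u : R) : R := e / (pi * (e ^+ 2 + u ^+ 2)).

Lemma poisson_ge0 e u : 0 < e -> 0 <= poisson e u.
Proof.
by move=> e0; rewrite divr_ge0 ?(ltW e0)// mulr_ge0 ?pi_ge0// addr_ge0 ?sqr_ge0.
Qed.

Lemma dominated1_poisson e x : 0 < e ->
  exists A, dominated1 A (fun y => poisson e (y - x)).
Proof.
(* [C] comes from [e^2 (1 + u^2) <= (1 + e^2) (e^2 + u^2)]. *)
move=> e0; pose C := (1 + e ^+ 2) / (pi * e).
have p0 := pi_gt0 R.
have C0 : 0 <= C by rewrite divr_ge0 ?mulr_ge0 ?pi_ge0 ?(ltW e0)// addr_ge0// sqr_ge0.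
exists (C * (2 * (1 + x ^+ 2))); split.
  have cV (u : R) : {for u, continuous (fun y : R => (pi * (e ^+ 2 + (y - x) ^+ 2))^-1)}.
    apply: cvgV; first by rewrite mulf_neq0 ?gt_eqF// ltr_pwDl ?exprn_gt0 ?sqr_ge0.
    apply: cvgMr; apply: cvgD; first exact: cvg_cst.
    rewrite expr2; under eq_fun do rewrite expr2.
    by apply: cvgM; apply: cvgB; [exact: cvg_id|exact: cvg_cst|exact: cvg_id|exact: cvg_cst].
  by move=> u; apply: cvgMr; exact: cV.
move=> y; rewrite ger0_norm ?poisson_ge0// -mulrA.
apply: le_trans (ler_wpM2l C0 (wt1_shift_le x y)).
have h (t : R) : 0 < 1 + t ^+ 2 by rewrite ltr_pwDl// sqr_ge0.
rewrite /poisson /C /wt1; move: (y - x) => u.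
have d0 : 0 < e ^+ 2 + u ^+ 2 by rewrite ltr_pwDl ?exprn_gt0 ?sqr_ge0.
rewrite -mulrA -invfM ler_pdivrMr ?mulr_gt0// mulrAC ler_pdivlMr ?mulr_gt0//.
rewrite -subr_ge0 (_ : _ - _ = pi * ((e ^+ 2) ^+ 2 + u ^+ 2)); last by ring.
by rewrite mulr_ge0 ?pi_ge0// addr_ge0 ?sqr_ge0.
Qed.

Lemma integral_poisson e x : 0 < e -> \int[leb]_y poisson e (y - x) = 1.
Proof.
move=> e0; have [A DA] := dominated1_poisson x e0.
have p0 := pi_gt0 R.
(* The sign [s] is [1] on the right half-line and [-1] on the reflected left one; the shift by
   [2^-1] makes the primitive vanish at [+oo] for [s = 1]. *)
have at_der (s u : R) : is_derive u 1 (fun y : R => atan ((s * y - x) / e) / pi - 2^-1)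
    (s * poisson e (s * u - x)).
  have dl : is_derive u 1 (fun y : R => (s * y - x) / e) (s / e).
    have h2 := is_deriveB (@is_deriveZ R R^o R^o id s u 1 1 (is_derive_id u 1))
      (is_derive_cst (x : R^o) u (1 : R^o)).
    have := is_deriveZ (e^-1) h2; rewrite -[s *: 1]/(s * 1) mulr1 subr0.
    rewrite -[_ *: s]/(_ * _) mulrC; congr (is_derive _ _ _ _).
    by apply/funext => y; rewrite [RHS]mulrC.
  have h := @is_derive1_comp R (@atan R) (fun y => (s * y - x) / e) u _ _ (is_derive1_atan _) dl.
  have h3 := is_deriveB (@is_deriveZ R R^o R^o _ (pi^-1) u 1 _ h)
      (is_derive_cst (2^-1 : R^o) u (1 : R^o)).
  move: h3; rewrite subr0 -[_ *: _]/(_ * _); congr (is_derive _ _ _ _).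
    by apply/funext => y; rewrite !fctE; congr (_ - _); rewrite [RHS]mulrC.
  rewrite /poisson; move: (s * u - x) => v.
  have d0 : e ^+ 2 + v ^+ 2 != 0 by rewrite gt_eqF// ltr_pwDl ?exprn_gt0 ?sqr_ge0.
  have d1 : 1 + (v / e) ^+ 2 != 0 by rewrite gt_eqF// ltr_pwDl ?sqr_ge0.
  have en0 : e != 0 by rewrite gt_eqF.
  have pn0 : pi != 0 :> R by rewrite gt_eqF.
  rewrite (_ : 1 + (v / e) ^+ 2 = (e ^+ 2 + v ^+ 2) / e ^+ 2); last by field.
  rewrite invf_div; move: (pi : R) pn0 => q qn0; field.
  by rewrite en0 qn0 d0.
have aty (a : R) : atan ((1 * y - a) / e) / pi - 2^-1 @[y --> +oo%R] --> (0 : R).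
  rewrite [X in _ --> X](_ : 0 = (pi / 2) / pi - 2^-1 :> R); last first.
    by rewrite mulrAC divff ?gt_eqF// mul1r subrr.
  apply: cvgB; last exact: cvg_cst.
  apply: cvgMl; apply: (@cvg_comp _ _ _ (fun y : R => (1 * y - a) / e) atan _ (pinfty_nbhs R)); last exact: cvgy_atan.
  apply/cvgryPge => M; near=> y; rewrite ler_pdivlMr// mul1r lerBrDr.
  by near: y; apply: nbhs_pinfty_ge; rewrite num_real.
pose G1 (y : R) := atan ((1 * y - x) / e) / pi - 2^-1.
(* After reflection the arctangent tends to [- pi / 2]; the final [- 1] makes [G2] vanish at
   [+oo]. *)
pose G2 (y : R) := - (atan ((-1 * y - x) / e) / pi - 2^-1) - 1.
transitivity (- G1 0 - G2 0); last by rewrite /G1 /G2 !mulr0; ring.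
have c0 s : {for 0, continuous (fun y : R => atan ((s * y - x) / e) / pi - 2^-1)}.
  by apply: differentiable_continuous; apply/derivable1_diffP; have [] := at_der s 0.
apply: (@integral_line R A _ G1 G2 DA).
- by move=> y _; have := at_der 1 y; rewrite !mul1r.
- exact: c0.
- exact: aty.
- move=> y _; have := is_deriveB (is_deriveN (at_der (-1) y)) (is_derive_cst (1 : R^o) y (1 : R^o)).
  by rewrite subr0 !mulN1r opprK.
- by apply: continuousB; [apply: continuousN; exact: c0|exact: cst_continuous].
- rewrite (_ : G2 = (fun y => atan ((1 * y - - x) / e) / pi - 2^-1)); first exact: aty.
  apply/funext => y; rewrite /G2 (_ : (-1 * y - x) / e = - ((1 * y - - x) / e)); last by ring.
  by rewrite atanN mulNr; move: (_ / pi) => b; lra.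
Unshelve. all: by end_near. Qed.

(* Away from [x] the Poisson kernel is [O(e)] times an integrable function, so
   the approximation of the identity needs no change of variables. *)
Lemma poisson_split (e d u : R) : 0 < e -> 0 < d -> d <= `|u| ->
  poisson e u <= e * (1 + d ^- 2) / pi * wt1 u.
Proof.
move=> e0 d0 du; have p0 := pi_gt0 R.
have u0 : 0 < u ^+ 2 by rewrite -(real_normK (num_real u)) exprn_gt0// (lt_le_trans d0).
have d2 : d ^+ 2 <= u ^+ 2 by rewrite -[leRHS](real_normK (num_real u)) lerXn2r// ?nnegrE// ltW.
have h (t : R) : 0 < 1 + t ^+ 2 by rewrite ltr_pwDl// sqr_ge0.
have D0 : 0 < e ^+ 2 + u ^+ 2 by rewrite ltr_pwDl ?exprn_gt0 ?sqr_ge0.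
rewrite (_ : poisson e u = e / pi * (e ^+ 2 + u ^+ 2)^-1); last by rewrite /poisson invfM mulrA.
rewrite (_ : e * _ / pi * wt1 u = e / pi * ((1 + d ^- 2) * wt1 u)); last by ring.
rewrite ler_pM2l ?divr_gt0// /wt1 ler_pdivlMr// mulrC ler_pdivrMr//.
have : 1 + u ^+ 2 <= (1 + d ^- 2) * u ^+ 2.
  rewrite mulrDl mul1r addrC lerD2l mulrC ler_pdivlMr ?exprn_gt0// mul1r.
  exact: d2.
move=> /le_trans; apply; rewrite ler_wpM2l//.
  by rewrite addr_ge0// invr_ge0 sqr_ge0.
by rewrite lerDr sqr_ge0.
Qed.

Lemma approximate_identity A (psi : R -> R) x eta : dominated1 A psi -> 0 < eta ->
  exists2 e0, 0 < e0 & forall e, 0 < e -> e < e0 ->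
    `|\int[leb]_y (psi y * poisson e (y - x)) - psi x| <= eta.
Proof.
move=> Dpsi eta0; have A0 := dominated1_ge0 Dpsi.
have p0 := pi_gt0 R.
have psiA y : `|psi y| <= A by rewrite (le_trans (Dpsi.2 y))// ler_piMr// wt1_le1.
have eta20 : 0 < eta / 2 by rewrite divr_gt0.
have /cvgrPdist_le/(_ _ eta20)/nbhs_ballP[d /= d0 Hd] := Dpsi.1 x.
(* [2 * A] bounds [|psi y - psi x|] and [1 + d ^- 2] is the factor in [poisson_split]. The threshold
   chosen next for [e] keeps [K * e] below [eta / 2]. *)
pose K := 2 * A * (1 + d ^- 2).
have K0 : 0 <= K by rewrite !mulr_ge0// addr_ge0// invr_ge0 sqr_ge0.
exists (eta / 2 / (K + 1)); first by rewrite !divr_gt0// ltr_wpDl.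
move=> e e0 ee.
have [B DB] := dominated1_poisson x e0.
have D1 := dominated1_poisson x ltr01.
have [B1 DB1] := D1.
have ipo : leb.-integrable setT (EFin \o (fun y => poisson e (y - x))) := dominated1_integrable DB.
have ipo1 : leb.-integrable setT (EFin \o (fun y => poisson 1 (y - x))) := dominated1_integrable DB1.
have Dpp : dominated1 (A * B) (fun y => psi y * poisson e (y - x)).
  split; first by apply: continuous_funM; [exact: Dpsi.1|exact: DB.1].
  move=> y; rewrite normrM -mulrA; apply: ler_pM => //; exact: DB.2.
have ipp := dominated1_integrable Dpp.
have ipx : leb.-integrable setT (EFin \o (fun y => psi x * poisson e (y - x))) by exact: integrable_realZ.
have -> : \int[leb]_y (psi y * poisson e (y - x)) - psi x =
    \int[leb]_y (psi y * poisson e (y - x) - psi x * poisson e (y - x)).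
  by rewrite RintegralB// RintegralZl// integral_poisson// mulr1.
have idif : leb.-integrable setT (EFin \o (fun y => psi y * poisson e (y - x) - psi x * poisson e (y - x))).
  have := integrableB measurableT ipp ipx.
  by congr (_.-integrable _ _); apply/funext => y; rewrite /= EFinB.
rewrite (le_trans (le_normr_Rintegral measurableT idif))//.
(* Near [x] the first term dominates, by continuity of [psi]; at distance at least [d] the second
   does, since [wt1 / pi] is [poisson 1]. Both kernels have mass one. *)
have ibd : leb.-integrable setT (EFin \o (fun y => eta / 2 * poisson e (y - x) + K * e * poisson 1 (y - x))).
  by apply: integrable_realD => //; apply: integrable_realZ.
rewrite (@le_trans _ _ (\int[leb]_y (eta / 2 * poisson e (y - x) + K * e * poisson 1 (y - x))))//.
  apply: le_Rintegral => //; first exact: integrable_norm.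
  move=> y _; rewrite /= -mulrBl normrM (ger0_norm (poisson_ge0 _ e0)).
  have pe := poisson_ge0 (y - x) e0; have p1 := poisson_ge0 (y - x) ltr01.
  have [yd|yd] := ltP `|y - x| d.
    apply: le_trans (_ : eta / 2 * poisson e (y - x) <= _).
      rewrite ler_wpM2r// distrC; apply: Hd; rewrite -ball_normE /ball_ /=.
      by rewrite distrC.
    by rewrite lerDl mulr_ge0// mulr_ge0// ltW.
  apply: le_trans (_ : K * e * poisson 1 (y - x) <= _); last first.
    by rewrite lerDr mulr_ge0// ltW.
  apply: le_trans (ler_pM _ pe (_ : _ <= 2 * A) (poisson_split e0 d0 yd)) _ => //.
    by rewrite (le_trans (ler_normB _ _))// mulr2n mulrDl mul1r lerD.
  rewrite le_eqVlt; apply/orP; left; apply/eqP.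
  rewrite /K /poisson /wt1 expr1n; move: (y - x) => u.
  have u0 : 1 + u ^+ 2 != 0 by rewrite gt_eqF// ltr_pwDl ?sqr_ge0.
  by rewrite (invfM pi); ring.
rewrite RintegralD//; [|exact: integrable_realZ|exact: integrable_realZ].
have ip k a : 0 < a -> \int[leb]_y (k * poisson a (y - x)) = k.
  move=> a0; have [Ba DBa] := dominated1_poisson x a0.
  by rewrite RintegralZl// ?integral_poisson ?mulr1//; exact: dominated1_integrable DBa.
rewrite !ip// [leRHS]splitr lerD2l.
rewrite (le_trans (ler_wpM2l K0 (ltW ee)))// mulrCA ler_piMr// ?(ltW eta20)//.
by rewrite ler_pdivrMr ?ltr_wpDl// mul1r lerDl.
Qed.

Lemma ccontinuous_integral1 (V : normedModType R) (A : R) (F : V -> R -> R[i]) :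
  (forall z : V, cdom1 A (F z)) -> (forall s, ccontinuous (F ^~ s)) ->
  ccontinuous (fun z : V => integral1 (F z)).
Proof.
move=> DF cF; split.
  exact: (@continuous_integral1 R V A (fun y => cRe \o F y)
    (fun y => (DF y).1) (fun x => (cF x).1)).
exact: (@continuous_integral1 R V A (fun y => cIm \o F y)
    (fun y => (DF y).2) (fun x => (cF x).2)).
Qed.

Lemma ccontinuous_comp (U V : topologicalType) (h : U -> V) (f : V -> R[i]) :
  continuous h -> ccontinuous f -> ccontinuous (f \o h).
Proof.
move=> ch [fr fi]; split => x.
  exact: (continuous_comp (ch x) (fr (h x))).
exact: (continuous_comp (ch x) (fi (h x))).
Qed.

Lemma ccontinuous_real (V : topologicalType) (t : V -> R) :
  continuous t -> ccontinuous (fun x => (t x)%:C).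
Proof. by move=> ct; split => x; [exact: ct|exact: cst_continuous]. Qed.

Lemma integral_Rn0 (h : 'rV[R]_0 -> R[i]) : integral_Rn h = h 0.
Proof.
have H (g : 'rV[R]_0 -> R) : \int[lebesgue_tuple R 0]_t g (tuple_row t) = g 0.
  rewrite (_ : (fun t => _) = cst (g 0)); last first.
    by apply/funext => t /=; congr g; apply/rowP => -[].
  rewrite Rintegral_cst//= -[RHS]mulr1; congr (_ * _).
  by rewrite indicE in_setT.
by apply: complex_eq; rewrite /= (H (fun x => _ (h x))).
Qed.

Lemma integral_Rn1 A (g : 'rV[R]_1 -> R[i]) : cdom A g ->
  integral_Rn g = integral1 (fun s => g (row_cons s 0)).
Proof.
move=> /integral_Rn_cons[-> _]; congr integral1; apply/funext => s.
by rewrite integral_Rn0.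
Qed.

(** [F] is read as a dominated function on [R^2], and its first coordinate is split off in either
    order. *)
Lemma integral1_swap A (F : R -> R -> R[i]) :
  ccontinuous (fun x : 'rV[R]_2 => F (x 0 ord0) (x 0 (lift ord0 ord0))) ->
  (forall s t, normc (F s t) <= A * (wt1 s * wt1 t)) ->
  integral1 (fun s => integral1 (F s)) = integral1 (fun t => integral1 (F ^~ t)).
Proof.
move=> cF FA; pose f (x : 'rV[R]_2) := F (x 0 ord0) (x 0 (lift ord0 ord0)).
have fE s t : f (row_cons s (row_cons t 0)) = F s t.
  by rewrite /f row_cons0 row_consS row_cons0.
have Df : cdom A f.
  apply: cdom_intro => // x.
  by rewrite /wt 2!big_ord_recl big_ord0 mulr1; exact: FA.
have [e1 e2] := integral_Rn_cons Df.
transitivity (integral_Rn f).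
  rewrite e1; congr integral1; apply/funext => s.
  rewrite (integral_Rn1 (cdom_consr s Df)); congr integral1; apply/funext => t.
  by rewrite /= fE.
rewrite e2 (integral_Rn1 (cdom_integral_consl Df)); congr integral1; apply/funext => t.
by congr integral1; apply/funext => s; rewrite fE.
Qed.

Lemma cvg_at_right_eq (g : R -> R) a : {for 0, continuous g} ->
  (forall eta, 0 < eta -> exists2 e0, 0 < e0 & forall e, 0 < e -> e < e0 -> `|g e - a| <= eta) ->
  g 0 = a.
Proof.
move=> cg ga; apply/eqP; rewrite -subr_eq0 -normr_le0.
apply/ler_addgt0Pl => eta eta0; rewrite addr0; have eta2 : 0 < eta / 2 by rewrite divr_gt0.
have [e0 e0_gt0 He0] := ga _ eta2.
have /cvgrPdist_le/(_ _ eta2)/nbhs_ballP[d /= d0 Hd] := cg.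
pose e := Num.min e0 d / 2.
have m0 : 0 < Num.min e0 d by rewrite lt_min e0_gt0.
have em : e < Num.min e0 d by rewrite ltr_pdivrMr// ltr_pMr// ltr1n.
move: em; rewrite lt_min => /andP[ee0 ed].
have eg0 : 0 < e by rewrite divr_gt0.
rewrite (_ : g 0 - a = (g 0 - g e) + (g e - a)); last by ring.
rewrite (le_trans (ler_normD _ _))// [leRHS]splitr lerD//; last exact: He0.
by apply: Hd; rewrite -ball_normE /ball_ /= sub0r normrN gtr0_norm.
Qed.

Definition fourier1 (c : R) (phi : R -> R[i]) (t : R) : R[i] :=
  integral1 (fun s => phi s * expi (c * (s * t))).

(** After Fubini the inner integral is [poisson_kernel] at [c * (s - x)]. It depends on [c] only
    through [c ^+ 2], so both signs are covered, and dividing by [(2 * pi) ^+ 2] rescales the width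
    to [e / (2 * pi)]. *)
Lemma fourier1_damped c A (phi : R -> R[i]) e x : c ^+ 2 = (2 * pi) ^+ 2 ->
  cdom1 A phi -> 0 < e ->
  integral1 (fun t => fourier1 c phi t * ((damp e t)%:C * expi (- c * (t * x)))) =
  integral1 (fun s => phi s * (poisson (e / (2 * pi)) (s - x))%:C).
Proof.
move=> c2 Dphi e0; have A0 := cdom1_ge0 Dphi; have p0 := pi_gt0 R.
have [cr ci] := cdom1_continuous Dphi.
pose F t s := phi s * (expi (c * (s * t)) * ((damp e t)%:C * expi (- c * (t * x)))).
have ccoord (k : 'I_2) : continuous (fun z : 'rV[R]_2 => z 0 k).
  by move=> z; exact: coord_continuous.
have clin a (k : 'I_2) : continuous (fun z : 'rV[R]_2 => a * z 0 k).
  by apply: continuous_funM => //; exact: cst_continuous.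
transitivity (integral1 (fun t => integral1 (F t))).
  congr integral1; apply/funext => t.
  have D := @cdom1M R A phi (fun s => expi (c * (s * t))) Dphi.
  rewrite mulrC /fourier1 -(integral1Z _ (D _ _)).
  - by congr integral1; apply/funext => s; rewrite /F mulrC -mulrA.
  - apply: ccontinuous_expi; apply: continuous_funM; first exact: cst_continuous.
    by apply: continuous_funM; [move=> s; exact: cvg_id|exact: cst_continuous].
  - by move=> s; rewrite normc_expi.
rewrite (@integral1_swap (2 * A * (1 + 4 / e ^+ 2))).
- congr integral1; apply/funext => s; rewrite /F.
  pose g t := (damp e t)%:C * expi (c * (s - x) * t).
  transitivity (integral1 (fun t => phi s * g t)).
    congr integral1; apply/funext => t; congr (_ * _); rewrite mulrCA /g; congr (_ * _).
    by rewrite -expiD; congr expi; ring.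
  have Dg : exists B, cdom1 B g.
    exists (1 + 4 / e ^+ 2); apply: cdom1_intro => [|t].
      apply: ccontinuousM; first by apply: ccontinuous_real; exact: continuous_damp.
      apply: ccontinuous_expi; apply: continuous_funM; first exact: cst_continuous.
      by move=> t; exact: cvg_id.
    by rewrite normcZr normc_expi mulr1 ger0_norm ?damp_ge0// damp_le.
  have [B DB] := Dg; rewrite (integral1Z _ DB); congr (_ * _).
  have [k1 k2] := poisson_kernel (c * (s - x)) e0.
  have -> : integral1 g = (2 * e / (e ^+ 2 + (c * (s - x)) ^+ 2))%:C.
    apply: complex_eq; rewrite /integral1 /=.
      by rewrite -k1; apply: eq_Rintegral => t _; rewrite /= mul0r subr0.
    rewrite -[RHS]k2; apply: eq_Rintegral => t _; rewrite [LHS]/=.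
    by rewrite mul0r addr0.
  congr (_%:C); rewrite exprMn c2 /poisson; move: (s - x) (pi : R) p0 => u q q0.
  have h : 0 < e ^+ 2 + (2 * q) ^+ 2 * u ^+ 2.
    by rewrite ltr_pwDl ?exprn_gt0// mulr_ge0 ?sqr_ge0.
  rewrite (_ : (e / (2 * q)) ^+ 2 + u ^+ 2 = (e ^+ 2 + (2 * q) ^+ 2 * u ^+ 2) / (2 * q) ^+ 2); last first.
    by field; rewrite gt_eqF.
  move: (_ + _) h => D D0; field.
  by rewrite !gt_eqF.
- apply: ccontinuousM; first exact: (@ccontinuous_comp _ _ (fun z : 'rV[R]_2 => z 0 (lift ord0 ord0))).
  apply: ccontinuousM.
    apply: ccontinuous_expi; apply: continuous_funM; first exact: cst_continuous.
    exact: continuous_funM.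
  apply: ccontinuousM.
    apply: ccontinuous_real => z.
    by apply: (continuous_comp (ccoord ord0 z)); exact: continuous_damp.
  apply: ccontinuous_expi; apply: continuous_funM; first exact: cst_continuous.
  by apply: continuous_funM => //; exact: cst_continuous.
- move=> t s; rewrite /F ComplexField.Normc.normcM [normc (expi _ * _)]ComplexField.Normc.normcM.
  rewrite normcZr !normc_expi mul1r mulr1 ger0_norm ?damp_ge0//.
  rewrite (_ : _ * (wt1 t * _) = (2 * A * wt1 s) * ((1 + 4 / e ^+ 2) * wt1 t)); last by ring.
  by apply: ler_pM; rewrite ?normc_ge0 ?damp_ge0 ?damp_le//; exact: cdom1_normc.
Qed.

Lemma fourier1_inversion c A A' (phi : R -> R[i]) x : c ^+ 2 = (2 * pi) ^+ 2 ->
  cdom1 A phi -> cdom1 A' (fourier1 c phi) ->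
  fourier1 (- c) (fourier1 c phi) x = phi x.
Proof.
move=> c2 Dphi DF; have p0 := pi_gt0 R.
(* With [|e|] the damped integral is defined on the whole line and continuous, by dominated
   convergence. [L 0] is the undamped integral, and for small [e > 0] the Poisson kernel brings
   [L e] close to [phi x]. *)
pose L (e : R) := integral1 (fun t => fourier1 c phi t * ((damp `|e| t)%:C * expi (- c * (t * x)))).
have L0 : L 0 = fourier1 (- c) (fourier1 c phi) x.
  congr integral1; apply/funext => t.
  by rewrite /damp normr0 mul0r oppr0 expR0 mul1r.
rewrite -L0.
have clin : continuous (fun t : R => - c * (t * x)).
  apply: continuous_funM; first exact: cst_continuous.
  by apply: continuous_funM; [move=> t; exact: cvg_id|exact: cst_continuous].
have [Lr Li] : ccontinuous (L : R^o -> R[i]).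
  apply: (@ccontinuous_integral1 R^o (2 * A')).
    move=> e; apply: cdom1M => //.
      apply: ccontinuousM; last exact: ccontinuous_expi.
      by apply: ccontinuous_real; exact: continuous_damp.
    move=> t; rewrite normcZr normc_expi mulr1 ger0_norm ?damp_ge0//.
    exact: damp_le1.
  move=> t; apply: ccontinuousM; first by split; exact: cst_continuous.
  apply: ccontinuousM; last by split; exact: cst_continuous.
  apply: ccontinuous_real => e.
  apply: (@continuous_comp _ _ _ (fun e : R => - (`|e| * `|t|)) (@expR R)); last exact: continuous_expR.
  by apply: cvgN; apply: cvgMl; exact: norm_continuous.
have LE e : 0 < e -> L e = integral1 (fun s => phi s * (poisson (e / (2 * pi)) (s - x))%:C).
  by move=> e0; rewrite /L gtr0_norm//; exact: (fourier1_damped x c2 Dphi e0).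
have [Dr Di] := Dphi.
have pp : 0 < 2 * pi :> R by rewrite mulr_gt0.
have step (psi g : R -> R) : dominated1 A psi -> 
    (forall e, 0 < e -> g e = \int[leb]_s (psi s * poisson (e / (2 * pi)) (s - x))) ->
    forall eta, 0 < eta -> exists2 e0, 0 < e0 & forall e, 0 < e -> e < e0 -> `|g e - psi x| <= eta.
  move=> Dpsi gE eta eta0; have [e0 e00 He] := approximate_identity x Dpsi eta0.
  exists (e0 * (2 * pi)); first by rewrite mulr_gt0.
  by move=> e eg ee; rewrite gE//; apply: He; [rewrite divr_gt0|rewrite ltr_pdivrMr].
apply: complex_eq.
  apply: (@cvg_at_right_eq (cRe \o L)); first exact: Lr.
  apply: (step _ (cRe \o L) Dr) => e eg; rewrite -[LHS]/(cRe (L e)) LE//=; apply: eq_Rintegral => s _.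
  by rewrite Re_mulc /= mulr0 subr0.
apply: (@cvg_at_right_eq (cIm \o L)); first exact: Li.
apply: (step _ (cIm \o L) Di) => e eg; rewrite -[LHS]/(cIm (L e)) LE//=; apply: eq_Rintegral => s _.
by rewrite Im_mulc /= mulr0 add0r.
Qed.

End one_dimensional_inversion.

Section inversion.
Context {R : realType}.

(** For fixed remaining frequencies [xi], inversion in the first variable recovers the transform
    [h x1 xi] of the slice of [f] at [x1]; the induction hypothesis then inverts that transform. *)
Lemma fourier_inversion c n A A' (f : 'rV[R]_n -> R[i]) x : c ^+ 2 = (2 * pi) ^+ 2 ->
  cdom A f -> cdom A' (fourier c f) -> fourier (- c) (fourier c f) x = f x.
Proof.
move=> c2; elim: n A A' f x => [|n IH] A A' f x Df DF.
  rewrite /fourier !integral_Rn0 /dotp !big_ord0 !mulr0 expi0 !mulr1.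
  by congr f; apply/rowP => -[].
have wave m (k : R) (z : 'rV[R]_m) : ccontinuous (fun y => expi (k * dotp y z)).
  apply: ccontinuous_expi; apply: continuous_funM; first exact: cst_continuous.
  rewrite (_ : (@dotp R m)^~ z = dotp z); first exact: continuous_dotp.
  by apply/funext => w; exact: dotpC.
have waveM m (k : R) (z : 'rV[R]_m) B g : cdom B g -> cdom (2 * B) (fun y => g y * expi (k * dotp y z)).
  by move=> Dg; apply: cdomM => // y; rewrite normc_expi.
rewrite [in RHS](row_cons_eta x); set x1 := x 0 ord0; set x' := row_tail x.
pose h s := fourier c (f \o row_cons s).
have hE s : h s = fun xi => integral_Rn (fun y => f (row_cons s y) * expi (c * dotp y xi)) by [].
have Fcons t xi : fourier c f (row_cons t xi) = fourier1 c (h^~ xi) t.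
  rewrite /fourier (integral_Rn_cons (waveM _ c (row_cons t xi) _ _ Df)).1.
  congr integral1; apply/funext => s.
  rewrite mulrC hE -(integral_RnZ _ (waveM _ c xi _ _ (cdom_consr s Df))).
  congr integral_Rn; apply/funext => y /=; rewrite mulrCA -expiD; congr (_ * expi _).
  by rewrite dotp_cons mulrDr.
have inv1 xi : fourier1 (- c) (fun t => fourier c f (row_cons t xi)) x1 = h x1 xi.
  under [fun t => _]eq_fun do rewrite Fcons.
  have Dh : cdom1 (2 * A * integral_row (@wt R n)) (h^~ xi).
    have D0 : cdom (2 * A) (fun y : 'rV[R]_n.+1 => f y * expi (c * dotp y (row_cons 0 xi))) := waveM _ c _ _ _ Df.
    have := cdom_integral_consr D0; congr cdom1; apply/funext => s.
    congr integral_Rn; apply/funext => y /=; congr (_ * expi _).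
    by rewrite dotp_cons mulr0 add0r.
  apply: (fourier1_inversion _ c2 Dh (_ : cdom1 (A' * wt xi) _)).
  rewrite (_ : fourier1 c _ = fun t => fourier c f (row_cons t xi)); last by apply/funext => t; rewrite Fcons.
  exact: cdom_consl.
have DG := waveM _ (- c) x _ _ DF.
(* The domination of the transform of a slice is not among the hypotheses. By [inv1] that transform
   is a partial integral of [fourier c f] times a wave in the first variable, and so it is
   dominated; here [pi] is the integral of [wt1]. *)
have Dx1 : cdom (A' * 2 * pi) (fourier c (f \o row_cons x1)).
  have D0 := waveM _ (- c) (row_cons x1 0) _ _ DF.
  have := cdom_integral_consl D0; rewrite [2 * A']mulrC; congr cdom; apply/funext => xi.
  rewrite -[RHS]/(h x1 xi) -inv1; congr integral1; apply/funext => s /=; congr (_ * expi _).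
  by rewrite dotp_cons [dotp xi 0](_ : _ = 0) ?addr0// /dotp big1// => j _; rewrite mxE mulr0.
rewrite -[RHS](IH _ _ (f \o row_cons x1) x' (cdom_consr x1 Df) Dx1).
rewrite {1}/fourier (integral_Rn_cons DG).2; congr integral_Rn; apply/funext => xi.
rewrite -[fourier c (f \o _) xi]/(h x1 xi) -inv1 mulrC.
rewrite -(@integral1Z _ (2 * (A' * wt xi))).
  congr integral1; apply/funext => s; rewrite mulrCA -expiD; congr (_ * expi _).
  by rewrite (row_cons_eta x) dotp_cons mulrDr addrC.
apply: cdom1M; first exact: cdom_consl.
  apply: ccontinuous_expi; apply: continuous_funM; first exact: cst_continuous.
  by apply: continuous_funM; [move=> s; exact: cvg_id|exact: cst_continuous].
by move=> s; rewrite normc_expi.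
Qed.

End inversion.

(** * Calculus on the cylinder *)

Section pairs.
Context {R : realType} {n : nat} {W : normedModType R}.
Local Notation V := 'rV[R]_n.
Local Notation C := (R * V)%type.

(** Coordinates on [R * R^n] with a single index, in the form that the chain rule for combinations
    of fixed vectors expects. *)
Definition pair_basis (j : 'I_n.+1) : C :=
  oapp (fun k => (0, delta_mx 0 k)) (1, 0) (unlift ord0 j).

Definition pair_coef (a : R) (x : V) (j : 'I_n.+1) : R :=
  oapp (fun k => x 0 k) a (unlift ord0 j).

Lemma pair_sum a (x : V) : (a, x) = \sum_j pair_coef a x j *: pair_basis j.
Proof.
rewrite big_ord_recl /pair_coef /pair_basis unlift_none /=.
under eq_bigr => j _ do rewrite liftK /=.
rewrite [RHS]surjective_pairing; congr pair.
  rewrite /= raddf_sum /= big1 ?addr0; first by rewrite -[_ *: _]/(a * 1) mulr1.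
  by move=> j _; rewrite -[LHS]/(x 0 j * 0) mulr0.
by rewrite /= raddf_sum /= scaler0 add0r {1}(row_sum_delta x).
Qed.

Lemma Coo_pair_coef (U : set W) (a : W -> R) (x : W -> V) : Coo U a ->
  (forall k, Coo U (fun y => x y 0 k)) -> forall j, Coo U (fun y => pair_coef (a y) (x y) j).
Proof.
by move=> ca cx j; rewrite /pair_coef; case: unliftP => [k _|_] /=; [exact: cx|exact: ca].
Qed.

Lemma smooth_on_pair (U : set W) (U' : set C) (a : W -> R) (x : W -> V) (g : C -> R[i]) :
  open U -> (forall y, U y -> U' (a y, x y)) -> Coo U a ->
  (forall k, Coo U (fun y => x y 0 k)) -> smooth_on U' g ->
  smooth_on U (fun y => g (a y, x y)).
Proof.
move=> oU UU' ca cx sg.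
have -> : (fun y => g (a y, x y)) =
    fun y => g (\sum_j pair_coef (a y) (x y) j *: pair_basis j).
  by apply/funext => y; rewrite -pair_sum.
apply: smooth_on_comp sg => //; last exact: Coo_pair_coef.
by move=> y Uy; rewrite -pair_sum; exact: UU'.
Qed.

Lemma differentiable_pair_coef (a : W -> R) (x : W -> V) y : differentiable a y ->
  (forall k, differentiable (fun y => x y 0 k) y) ->
  forall j, differentiable (fun y => pair_coef (a y) (x y) j) y.
Proof.
by move=> ca cx j; rewrite /pair_coef; case: unliftP => [k _|_] /=; [exact: cx|exact: ca].
Qed.

Lemma continuous_pair (a : W -> R) (x : W -> V) y : differentiable a y ->
  (forall k, differentiable (fun y => x y 0 k) y) ->
  {for y, continuous (fun y => (a y, x y))}.
Proof.
move=> da dx.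
rewrite (_ : (fun y => _) = fun y => \sum_j pair_coef (a y) (x y) j *: pair_basis j).
  apply: differentiable_continuous.
  by have [] := derive_lincomb pair_basis 0 (differentiable_pair_coef da dx).
by apply/funext => z; rewrite -pair_sum.
Qed.

Lemma smooth_on_row (U : set W) (U' : set V) (x : W -> V) (g : V -> R[i]) :
  open U -> (forall y, U y -> U' (x y)) ->
  (forall k, Coo U (fun y => x y 0 k)) -> smooth_on U' g ->
  smooth_on U (fun y => g (x y)).
Proof.
move=> oU UU' cx sg.
have -> : (fun y => g (x y)) = fun y => g (\sum_j x y 0 j *: delta_mx 0 j).
  by apply/funext => y; rewrite -row_sum_delta.
apply: smooth_on_comp sg => //.
by move=> y Uy; rewrite -row_sum_delta; exact: UU'.
Qed.

Lemma dirderive_row (x : W -> V) (g : V -> R[i]) y v :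
  (forall k, differentiable (fun y => x y 0 k) y) -> cdiff g (x y) ->
  cdiff (fun y => g (x y)) y /\
  dirderive v (fun y => g (x y)) y =
  dirderive (\row_k 'D_v (fun y => x y 0 k) y) g (x y).
Proof.
move=> dx dg.
have E : (fun y => g (x y)) = fun y => g (\sum_j x y 0 j *: delta_mx 0 j).
  by apply/funext => z; rewrite -row_sum_delta.
have dg' : cdiff g (\sum_j x y 0 j *: delta_mx 0 j) by rewrite -row_sum_delta.
have [h1 h2] := dirderive_comp v dx dg'.
have key (c : 'I_n -> R) : \sum_j (c j)%:C * dirderive (delta_mx 0 j) g (x y) =
    dirderive (\row_j c j) g (x y).
  rewrite -dirderive_lin//; apply: (f_equal (fun u : V => dirderive u g (x y))).
  by rewrite [RHS]row_sum_delta; apply: eq_bigr => j _; rewrite mxE.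
by rewrite E; split => //; rewrite h2 -row_sum_delta key.
Qed.

Lemma open_preimage_in (T : topologicalType) (U : set W) (U' : set T) (f : W -> T) :
  open U -> open U' -> (forall y, U y -> {for y, continuous f}) ->
  open [set y | U y /\ U' (f y)].
Proof.
move=> oU oU' cf; rewrite openE => y [Uy U'y]; rewrite /interior; apply: filterI.
  exact: open_nbhs_nbhs.
by apply: cf => //; exact: open_nbhs_nbhs.
Qed.

End pairs.

(** A directional derivative sees its function on one line only. Derivatives are thereby transferred
    between [R], [R^n] and [R * R^n] without any differentiability to check. *)
Lemma derive_eq_line (R : realType) (V1 V2 : normedModType R) (f : V1 -> R) (g : V2 -> R)
    (a v : V1) (b u : V2) : (forall h : R, f (h *: v + a) = g (h *: u + b)) ->
  'D_v f a = 'D_u g b.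
Proof.
move=> H; have H0 := H 0; rewrite !scale0r !add0r in H0.
rewrite /derive.
have -> : (fun h : R => h^-1 *: ((f \o shift a) (h *: v) - f a)) =
          (fun h : R => h^-1 *: ((g \o shift b) (h *: u) - g b)) => //.
by apply/funext => h /=; rewrite H H0.
Qed.

Section cylinder_calculus.
Context {R : realType} {n : nat}.
Local Notation V := 'rV[R]_n.
Local Notation S := (sphere R n).
Local Notation C := (R * V)%type.
Implicit Types (x : V) (w : S) (u : S -> R[i]) (F K : R * S -> R[i]) (X : S -> V).

Definition nrm x : R := Num.sqrt (dotp x x).

Lemma dotp_ge0 x : 0 <= dotp x x.
Proof. by apply: sumr_ge0 => j _; rewrite -expr2 sqr_ge0. Qed.

Lemma dotp_gt0 x : x != 0 -> 0 < dotp x x.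
Proof.
move=> x0; rewrite lt_neqAle dotp_ge0 andbT eq_sym.
apply: contra x0 => /eqP/psumr_eq0P H; apply/eqP/rowP => j; rewrite mxE.
by apply/eqP; rewrite -sqrf_eq0 expr2 H// => i _; rewrite -expr2 sqr_ge0.
Qed.

Lemma nrm_ge0 x : 0 <= nrm x. Proof. exact: sqrtr_ge0. Qed.

Lemma nrm_gt0 x : x != 0 -> 0 < nrm x.
Proof. by move=> /dotp_gt0; rewrite sqrtr_gt0. Qed.

Lemma nrm_sqr x : nrm x ^+ 2 = dotp x x.
Proof. by rewrite sqr_sqrtr// dotp_ge0. Qed.

Lemma sphere_dotp w : dotp (val w) (val w) = 1. Proof. exact: eqP (valP w). Qed.

Lemma nrm_sphere w : nrm (val w) = 1.
Proof. by rewrite /nrm sphere_dotp sqrtr1. Qed.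

Lemma sphere_neq0 w : val w != 0.
Proof.
apply/eqP => w0; have := sphere_dotp w; rewrite w0 /dotp big1 => [/eqP|j _].
  by rewrite eq_sym oner_eq0.
by rewrite mxE mul0r.
Qed.

Lemma nrmZ a x : nrm (a *: x) = `|a| * nrm x.
Proof.
by rewrite /nrm dotpZl dotpZr mulrA -expr2 sqrtrM ?sqr_ge0// sqrtr_sqr.
Qed.

Lemma coord_le_nrm x j : `|x 0 j| <= nrm x.
Proof.
rewrite -sqrtr_sqr ler_wsqrtr// /dotp (bigD1 j)//= -expr2 lerDl.
by apply: sumr_ge0 => i _; rewrite -expr2 sqr_ge0.
Qed.

Definition dir x : V := (nrm x)^-1 *: x.

Lemma dirP x : x != 0 -> dotp (dir x) (dir x) == 1.
Proof.
move=> x0; rewrite -nrm_sqr nrmZ ger0_norm ?invr_ge0 ?nrm_ge0//.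
by rewrite mulVf ?expr1n// gt_eqF// nrm_gt0.
Qed.

Definition sph x (x0 : x != 0) : S := exist _ (dir x) (dirP x0).

Lemma radial_extE u x (x0 : x != 0) : radial_extension u x = u (sph x0).
Proof. by rewrite /radial_extension (insubT (fun x : V => dotp x x == 1) (dirP x0)). Qed.

Lemma dir_sphere w : dir (val w) = val w.
Proof. by rewrite /dir nrm_sphere invr1 scale1r. Qed.

Lemma sph_val w : sph (sphere_neq0 w) = w.
Proof. by apply/val_inj; rewrite /= dir_sphere. Qed.

Lemma radial_ext_val u w : radial_extension u (val w) = u w.
Proof. by rewrite (radial_extE u (sphere_neq0 w)) sph_val. Qed.

Lemma radial_extension_dir u x : x != 0 -> radial_extension u (dir x) = radial_extension u x.
Proof. by move=> x0; rewrite (radial_extE u x0) -[RHS]radial_ext_val. Qed.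

Lemma radial_extensionD u v x :
  radial_extension (fun w => u w + v w) x = radial_extension u x + radial_extension v x.
Proof. by rewrite /radial_extension; case: insub => //=; rewrite addr0. Qed.

Lemma radial_extensionM u v x :
  radial_extension (fun w => u w * v w) x = radial_extension u x * radial_extension v x.
Proof. by rewrite /radial_extension; case: insub => //=; rewrite mulr0. Qed.

(** The extension of [F] that is constant along rays in the second variable; it turns calculus on
    the cylinder into directional derivatives in [R * R^n]. *)
Definition cext F (q : C) : R[i] := radial_extension (fun w => F (q.1, w)) q.2.
Definition cpt (q : R * S) : C := (q.1, val q.2).
Definition CV0 : set C := [set q | q.2 != 0].

Lemma cextE F (q : C) (q0 : q.2 != 0) : cext F q = F (q.1, sph q0).
Proof. exact: radial_extE. Qed.

Lemma cext_val F r w : cext F (r, val w) = F (r, w).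
Proof. exact: radial_ext_val. Qed.

Lemma open_neq0 : open [set x : V | x != 0].
Proof.
rewrite (_ : [set x | _] = ~` [set 0]); first exact/closed_openC/accessible_closed_set1/hausdorff_accessible/norm_hausdorff.
by apply/seteqP; split => x /eqP.
Qed.

Lemma openCV0 : open CV0.
Proof.
apply: (@open_comp _ _ (@snd R V) [set x | x != 0]); last exact: open_neq0.
by move=> q _; exact: cvg_snd.
Qed.

Lemma fst_linear : linear (fun q : C => q.1 : R).
Proof. by move=> a u v. Qed.

Definition fst_lin : {linear C -> R} :=
  HB.pack (fun q : C => q.1 : R) (GRing.isLinear.Build _ _ _ _ _ fst_linear).

Lemma snd_linear j : linear (fun q : C => q.2 0 j : R).
Proof. by move=> a u v; rewrite !mxE. Qed.

Definition snd_lin j : {linear C -> R} :=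
  HB.pack (fun q : C => q.2 0 j : R) (GRing.isLinear.Build _ _ _ _ _ (snd_linear j)).

Lemma continuous_fst_lin : continuous fst_lin.
Proof. by move=> q; exact: cvg_fst. Qed.

Lemma continuous_snd_lin j : continuous (snd_lin j).
Proof.
move=> q; apply: (@continuous_comp _ _ _ snd (fun x : V => x 0 j)); first exact: cvg_snd.
exact: coord_continuous.
Qed.

Lemma Coo_fst U : Coo U (fun q : C => q.1).
Proof. by move=> k; apply: (@Ck_linear _ _ _ _ fst_lin); exact: continuous_fst_lin. Qed.

Lemma Coo_snd U j : Coo U (fun q : C => q.2 0 j).
Proof. by move=> k; apply: (@Ck_linear _ _ _ _ (snd_lin j)); exact: continuous_snd_lin. Qed.

Lemma Coo_coord (U : set V) j : Coo U (fun x : V => x 0 j).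
Proof. by move=> k; apply: (@Ck_linear _ _ _ _ (coord_lin j)); exact: coord_continuous. Qed.

Lemma Coo_nrm (W : normedModType R) (U : set W) (x : W -> V) : open U ->
  (forall y, U y -> x y != 0) -> (forall j, Coo U (fun y => x y 0 j)) ->
  Coo U (fun y => nrm (x y)).
Proof.
move=> oU x0 cx k; apply: (@Ck_comp1 _ _ k U [set r | 0 < r] (fun y => dotp (x y) (x y))) => //.
- by move=> y Uy; exact: dotp_gt0 (x0 y Uy).
- by apply: Ck_sum => // j; apply: CkM => //; exact: cx.
- exact: Ck_sqrt.
Qed.

Lemma Coo_dir (W : normedModType R) (U : set W) (x : W -> V) j : open U ->
  (forall y, U y -> x y != 0) -> (forall j, Coo U (fun y => x y 0 j)) ->
  Coo U (fun y => dir (x y) 0 j).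
Proof.
move=> oU x0 cx k.
have -> : (fun y => dir (x y) 0 j) = fun y => (nrm (x y))^-1 * x y 0 j.
  by apply/funext => y; rewrite mxE.
apply: CkM => //; last exact: cx.
apply: CkV => //; first by move=> y Uy; rewrite gt_eqF// nrm_gt0// x0.
exact: Coo_nrm.
Qed.

Lemma Coo_differentiable (W : normedModType R) (U : set W) (x : W -> R) y : U y -> Coo U x -> differentiable x y.
Proof. by move=> Uy cx; exact: (Ck_differentiable (cx 0%N)). Qed.

Lemma smooth_on_cextdir (g : C -> R[i]) : smooth_on CV0 g ->
  smooth_on CV0 (fun q => g (q.1, dir q.2)).
Proof.
apply: (@smooth_on_pair _ _ _ CV0 CV0 (fun q => q.1) (fun q => dir q.2)).
- exact: openCV0.
- by move=> q q0; rewrite /CV0 /= scaler_eq0 invr_eq0 negb_or gt_eqF ?nrm_gt0.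
- exact: Coo_fst.
- by move=> k; apply: Coo_dir => //; [exact: openCV0|move=> j; exact: Coo_snd].
Qed.

(** Composing any local smooth extension of [F] with [(r, x) |-> (r, x / |x|)] gives [cext F], so
    this one extension decides. *)
Lemma smooth_cylinderP F : smooth_cylinder F <-> smooth_on CV0 (cext F).
Proof.
split=> [sF|sF [r w]]; last first.
  exists CV0, (cext F); split => //; first exact: openCV0.
    exact: sphere_neq0.
  by move=> [r' w'] _; rewrite cext_val.
apply: smooth_on_local => q q0.
have [U [g [oU Uq sg Fg]]] := sF (q.1, sph q0).
pose f (q : C) : C := (q.1, dir q.2).
exists [set q | CV0 q /\ U (f q)]; split => //.
  apply: open_preimage_in => //; first exact: openCV0.
  move=> y y0; apply: continuous_pair; first exact: (Coo_differentiable y0 (@Coo_fst CV0)).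
  move=> k; apply: (Coo_differentiable y0); apply: Coo_dir => //; first exact: openCV0.
  by move=> j; exact: Coo_snd.
have oW : open [set q | CV0 q /\ U (f q)].
  apply: open_preimage_in => //; first exact: openCV0.
  move=> y y0; apply: continuous_pair; first exact: (Coo_differentiable y0 (@Coo_fst CV0)).
  move=> k; apply: (Coo_differentiable y0); apply: Coo_dir => //; first exact: openCV0.
  by move=> j; exact: Coo_snd.
apply: (@smooth_on_eq _ _ _ (fun q => g (f q))) => //.
  by move=> y [y0 Uy]; rewrite (cextE F y0) Fg.
apply: smooth_on_pair sg => //.
- by move=> y [].
- exact: Coo_fst.
- by move=> k; apply: Coo_dir => //; [move=> y []|move=> j; exact: Coo_snd].
Qed.

Lemma smooth_cylinderD F K : smooth_cylinder F -> smooth_cylinder K ->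
  smooth_cylinder (fun q => F q + K q).
Proof.
move=> /smooth_cylinderP sF /smooth_cylinderP sK; apply/smooth_cylinderP.
have -> : cext (fun q => F q + K q) = fun q => cext F q + cext K q.
  by apply/funext => q; exact: radial_extensionD.
by apply: smooth_onD => //; exact: openCV0.
Qed.

Lemma smooth_cylinderM F K : smooth_cylinder F -> smooth_cylinder K ->
  smooth_cylinder (fun q => F q * K q).
Proof.
move=> /smooth_cylinderP sF /smooth_cylinderP sK; apply/smooth_cylinderP.
have -> : cext (fun q => F q * K q) = fun q => cext F q * cext K q.
  by apply/funext => q; exact: radial_extensionM.
by apply: smooth_onM => //; exact: openCV0.
Qed.

Lemma smooth_sphere_cylinder u : smooth_sphere u -> smooth_cylinder (fun q => u q.2).
Proof.
move=> su [r w]; have [U [g [oU Uw sg ug]]] := su w.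
have oU' : open (@snd R V @^-1` U).
  by apply: open_comp => // q _; exact: cvg_snd.
exists (@snd R V @^-1` U), (fun q => g q.2); split => //.
  by apply: smooth_on_row sg => // k; exact: Coo_snd.
by move=> [r' w'] /ug.
Qed.

Lemma smooth_sphere_val (h : V -> R[i]) : smooth_on setT h ->
  smooth_sphere (fun w => h (val w)).
Proof. by move=> sh w; exists setT, h; split => //; exact: openT. Qed.

Definition rd F : R * S -> R[i] := radial_derive 1 F.
Definition fd X F : R * S -> R[i] := spherical_derive (field_derive X) F.

Lemma rdE F q : rd F q = dirderive ((1, 0) : C) (cext F) (cpt q).
Proof.
case: q => r w.
have H (g : R[i] -> R) : derive1 (fun r => g (F (r, w))) r =
   'D_((1, 0) : C) (g \o cext F) ((r, val w) : C).
  rewrite derive1E; apply: (@derive_eq_line _ R^o) => h /=.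
  by rewrite /cext /= scaler0 add0r radial_ext_val -[_ *: 1]/(h * 1).
by rewrite /rd /radial_derive !derive1n1 !H.
Qed.

Lemma fdE X F q : fd X F q = dirderive ((0, X q.2) : C) (cext F) (cpt q).
Proof.
case: q => r w; rewrite /fd /spherical_derive /field_derive /=.
have H (g : R[i] -> R) :
   'D_(X w) (g \o radial_extension (fun w => F (r, w))) (val w) =
   'D_((0, X w) : C) (g \o cext F) ((r, val w) : C).
  by apply: derive_eq_line => h /=; rewrite /cext /= scaler0 add0r.
by rewrite /dirderive !H.
Qed.

Lemma cext_rd F (q : C) : CV0 q -> cext (rd F) q = dirderive ((1, 0) : C) (cext F) q.
Proof.
case: q => r x q0; rewrite (cextE _ q0) rdE /=.
have E (g : R[i] -> R) : 'D_((1, 0) : C) (g \o cext F) ((r, dir x) : C) =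
   'D_((1, 0) : C) (g \o cext F) ((r, x) : C).
  by apply: derive_eq_line => h /=; rewrite /cext /= scaler0 !add0r radial_extension_dir.
by rewrite /dirderive !E.
Qed.

Lemma smooth_rd F : smooth_cylinder F -> smooth_cylinder (rd F).
Proof.
move=> /smooth_cylinderP sF; apply/smooth_cylinderP.
apply: (@smooth_on_eq _ _ _ (dirderive ((1, 0) : C) (cext F))); first exact: openCV0.
  by move=> q q0; rewrite cext_rd.
exact: smooth_on_dirderive.
Qed.

Lemma cyl_cdiff F q : smooth_cylinder F -> cdiff (cext F) (cpt q).
Proof. by move=> /smooth_cylinderP sF; apply: (smooth_on_cdiff sF); exact: sphere_neq0. Qed.

Lemma fd_sum X F q : smooth_cylinder F ->
  fd X F q = \sum_j (X q.2 0 j)%:C * dirderive ((0, delta_mx 0 j) : C) (cext F) (cpt q).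
Proof.
move=> sF; rewrite fdE -dirderive_lin; last exact: cyl_cdiff.
apply: (f_equal (fun v : C => dirderive v (cext F) (cpt q))).
rewrite [LHS]surjective_pairing [RHS]surjective_pairing; congr pair.
  by rewrite /= raddf_sum /= big1// => j _; rewrite -[LHS]/(_ * 0) mulr0.
by rewrite /= raddf_sum /= {1}(row_sum_delta (X q.2)).
Qed.

Lemma smooth_fd X F : smooth_tangent_field X -> smooth_cylinder F ->
  smooth_cylinder (fd X F).
Proof.
move=> [_ sX] sF.
have -> : fd X F = fun q => \sum_j (X q.2 0 j)%:C * dirderive ((0, delta_mx 0 j) : C) (cext F) (cpt q).
  by apply/funext => q; rewrite fd_sum.
apply/smooth_cylinderP.
(* The extension of [fd X F] is constant along rays, so the derivatives of [cext F] have to be read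
   at the normalised point [(q.1, dir q.2)]. *)
apply: (@smooth_on_eq _ _ _ (fun q => \sum_j cext (fun q => (X q.2 0 j)%:C) q *
   dirderive ((0, delta_mx 0 j) : C) (cext F) (q.1, dir q.2))); first exact: openCV0.
  by move=> q q0; rewrite cextE; apply: eq_bigr => j _; rewrite cextE.
apply: smooth_on_sum => [|j]; first exact: openCV0.
apply: smooth_onM; first exact: openCV0.
  exact/smooth_cylinderP/(smooth_sphere_cylinder (sX j)).
by apply: smooth_on_cextdir; apply: smooth_on_dirderive; exact/smooth_cylinderP.
Qed.

Lemma cext_cpt F q : cext F (cpt q) = F q.
Proof. by case: q => r w; exact: cext_val. Qed.

Lemma dirderive_cextD (v : C) F K q : smooth_cylinder F -> smooth_cylinder K ->
  dirderive v (cext (fun q => F q + K q)) (cpt q) =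
  dirderive v (cext F) (cpt q) + dirderive v (cext K) (cpt q).
Proof.
move=> sF sK; have -> : cext (fun q => F q + K q) = fun q => cext F q + cext K q.
  by apply/funext => p; exact: radial_extensionD.
by rewrite dirderiveD//; exact: cyl_cdiff.
Qed.

Lemma dirderive_cextM (v : C) F K q : smooth_cylinder F -> smooth_cylinder K ->
  dirderive v (cext (fun q => F q * K q)) (cpt q) =
  dirderive v (cext F) (cpt q) * K q + F q * dirderive v (cext K) (cpt q).
Proof.
move=> sF sK; have -> : cext (fun q => F q * K q) = fun q => cext F q * cext K q.
  by apply/funext => p; exact: radial_extensionM.
by rewrite dirderiveM ?cext_cpt//; exact: cyl_cdiff.
Qed.

Lemma rdD F K q : smooth_cylinder F -> smooth_cylinder K ->
  rd (fun q => F q + K q) q = rd F q + rd K q.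
Proof. by move=> sF sK; rewrite !rdE dirderive_cextD. Qed.

Lemma rdM F K q : smooth_cylinder F -> smooth_cylinder K ->
  rd (fun q => F q * K q) q = rd F q * K q + F q * rd K q.
Proof. by move=> sF sK; rewrite !rdE dirderive_cextM. Qed.

Lemma fdD X F K q : smooth_cylinder F -> smooth_cylinder K ->
  fd X (fun q => F q + K q) q = fd X F q + fd X K q.
Proof. by move=> sF sK; rewrite !fdE dirderive_cextD. Qed.

Lemma fdM X F K q : smooth_cylinder F -> smooth_cylinder K ->
  fd X (fun q => F q * K q) q = fd X F q * K q + F q * fd X K q.
Proof. by move=> sF sK; rewrite !fdE dirderive_cextM. Qed.

Lemma rd_sphere u q : rd (fun q => u q.2) q = 0.
Proof.
case: q => r w; rewrite /rd /radial_derive !derive1n1 /= !derive1_cst//.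
Qed.

Lemma radial_deriveS l F : radial_derive l.+1 F = rd (radial_derive l F).
Proof.
by apply/funext => -[r w]; rewrite /rd {2}/radial_derive !derive1n1 /radial_derive !derive1nS.
Qed.

Lemma radial_derive0 F : radial_derive 0 F = F.
Proof. by apply/funext => -[r w]; rewrite /radial_derive -eta_complex. Qed.

Lemma radial_deriveSr l F : radial_derive l.+1 F = radial_derive l (rd F).
Proof.
elim: l => [|l IH]; first by rewrite radial_derive0.
by rewrite radial_deriveS IH -radial_deriveS.
Qed.

Lemma smooth_radial_derive l F : smooth_cylinder F -> smooth_cylinder (radial_derive l F).
Proof.
move=> sF; elim: l => [|l IH]; first by rewrite radial_derive0.
by rewrite radial_deriveS; exact: smooth_rd.
Qed.

Lemma smooth_spherical D F : sphere_diffop D -> smooth_cylinder F ->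
  smooth_cylinder (spherical_derive D F).
Proof.
move=> dD; elim: dD F => {D} [a sa|X tX|D1 D2 _ IH1 _ IH2|D1 D2 _ IH1 _ IH2] F sF.
- rewrite (_ : spherical_derive _ F = fun q => a q.2 * F q).
    by apply: smooth_cylinderM => //; exact: smooth_sphere_cylinder.
  by apply/funext => -[].
- exact: smooth_fd.
- by apply: smooth_cylinderD; [exact: IH1|exact: IH2].
- exact: (IH1 _ (IH2 _ sF)).
Qed.

(** For fixed [w] both are derivatives of [cext F] in the constant directions [(1, 0)] and
    [(0, X w)], which commute. *)
Lemma rd_fd X F q : smooth_tangent_field X -> smooth_cylinder F ->
  rd (fd X F) q = fd X (rd F) q.
Proof.
case: q => r w tX sF.
have /smooth_cylinderP sG := sF.
rewrite (fdE X (rd F)) /=.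
have -> : dirderive ((0, X w) : C) (cext (rd F)) (r, val w) =
    dirderive ((0, X w) : C) (dirderive ((1, 0) : C) (cext F)) (r, val w).
  apply: dirderive_eq_open openCV0 _ (@cext_rd F); exact: sphere_neq0.
have -> := @dirderive_comm R _ CV0 (cext F) (r, val w) ((1, 0) : C) ((0, X w) : C)
  openCV0 (sphere_neq0 w) sG.
have H (g : R[i] -> R) : derive1 (fun r => g (fd X F (r, w))) r =
   'D_((1, 0) : C) (g \o dirderive ((0, X w) : C) (cext F)) ((r, val w) : C).
  rewrite derive1E; apply: (@derive_eq_line _ R^o) => h.
  rewrite fdE; apply: (f_equal (fun p => g (dirderive ((0, X w) : C) (cext F) p))).
  by rewrite -[RHS]/(h *: 1 + r, h *: 0 + val w) scaler0 add0r.
by rewrite /rd /radial_derive !derive1n1 !H.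
Qed.

Lemma rd_spherical D F : sphere_diffop D -> smooth_cylinder F ->
  rd (spherical_derive D F) = spherical_derive D (rd F).
Proof.
move=> dD; elim: dD F => {D} [a sa|X tX|D1 D2 d1 IH1 d2 IH2|D1 D2 d1 IH1 d2 IH2] F sF.
- apply/funext => q; rewrite -[LHS]/(rd (fun q => a q.2 * F q) q) rdM//.
    by rewrite rd_sphere mul0r add0r; case: q.
  exact: smooth_sphere_cylinder.
- by apply/funext => q; exact: rd_fd.
- have s1 := smooth_spherical d1 sF; have s2 := smooth_spherical d2 sF.
  apply/funext => q; rewrite -[LHS]/(rd (fun q => spherical_derive D1 F q + spherical_derive D2 F q) q).
  by rewrite rdD// IH1// IH2.
- by rewrite -[LHS]/(rd (spherical_derive D1 (spherical_derive D2 F))) IH1 ?IH2//; exact: smooth_spherical.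
Qed.

Lemma radial_derive_spherical l D F : sphere_diffop D -> smooth_cylinder F ->
  radial_derive l (spherical_derive D F) = spherical_derive D (radial_derive l F).
Proof.
move=> dD sF; elim: l => [|l IH]; first by rewrite !radial_derive0.
by rewrite !radial_deriveS IH rd_spherical//; exact: smooth_radial_derive.
Qed.

End cylinder_calculus.

(** Compactness in near-covering form, with the candidate bound [M] running to [+oo] as a second
    parameter beside [y']. *)
Lemma compact_param_bound (R : realType) (T Y : topologicalType) (K : set T)
    (f : T * Y -> R) (y : Y) : compact K ->
  (forall t, K t -> {for (t, y), continuous f}) ->
  exists M, \forall y' \near y, forall t, K t -> `|f (t, y')| <= M.
Proof.
move=> cK cf; have /compact_near_coveringP ncK := cK.
have := ncK (R * Y)%type (filter_prod (pinfty_nbhs R) (nbhs y))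
  (fun i t => `|f (t, i.2)| <= i.1) _.
case.
  move=> t Kt; have /cvgrPdist_le/(_ 1 ltr01)[[A B] /= [At By] AB] := cf t Kt.
  exists (A, [set M | `|f (t, y)| + 1 <= M] `*` B) => /=.
    split => //; exists ([set M | `|f (t, y)| + 1 <= M], B) => //=; split => //.
    by apply: nbhs_pinfty_ge; rewrite num_real.
  move=> [t' [M y']] /= [At' [/= MM By']]; apply: le_trans MM.
  have := AB (t', y') (conj At' By').
  rewrite /= distrC => /(lerD (lexx `|f (t, y)|)); apply: le_trans.
  rewrite (le_trans _ (ler_normD _ _))// (_ : f (t, y) + _ = f (t', y'))//.
  by rewrite addrC subrK.
move=> [A B] /= [AM By] AB.
have [M AMM] : exists M, A M.
  have [M0 [_ H]] := AM; exists (M0 + 1); apply: H; rewrite ltrDl//.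
exists M; apply: filterS By => y' By' t Kt.
exact: (AB (M, y') (conj AMM By') t Kt).
Qed.

(** * Homogeneous polynomials as functions *)

Section homogeneous_functions.
Context {R : realType} {n : nat}.
Local Notation V := 'rV[R]_n.
Implicit Types (p q : V -> R[i]) (x : V).

(** The degree is an index, so that Euler's identity and the degree of a derivative are proved by
    induction, away from monomials. The zero function receives every degree, to account for empty
    sums and vanishing derivatives. *)
Inductive hpoly : nat -> (V -> R[i]) -> Prop :=
| hpoly_cst c : hpoly 0 (fun=> c)
| hpoly_zero k : hpoly k (fun=> 0)
| hpoly_add k p q : hpoly k p -> hpoly k q -> hpoly k (fun x => p x + q x)
| hpoly_coord k j p : hpoly k p -> hpoly k.+1 (fun x => (x 0 j)%:C * p x).

Lemma hpoly_scale c k p : hpoly k p -> hpoly k (fun x => c * p x).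
Proof.
elim=> {k p} [a|k|k p q _ IHp _ IHq|k j p _ IHp].
- exact: hpoly_cst.
- by rewrite (_ : (fun=> _) = fun=> 0); [exact: hpoly_zero|apply/funext => x; rewrite mulr0].
- rewrite (_ : (fun=> _) = fun x => c * p x + c * q x); first exact: hpoly_add.
  by apply/funext => x; rewrite mulrDr.
- rewrite (_ : (fun=> _) = fun x => (x 0 j)%:C * (c * p x)); first exact: hpoly_coord.
  by apply/funext => x; rewrite mulrCA.
Qed.

Lemma hpoly_sum k (I : eqType) (s : seq I) (p : I -> V -> R[i]) :
  (forall i, i \in s -> hpoly k (p i)) -> hpoly k (fun x => \sum_(i <- s) p i x).
Proof.
elim: s => [|i s IH] H.
  by rewrite (_ : (fun=> _) = fun=> 0); [exact: hpoly_zero|apply/funext => x; rewrite big_nil].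
rewrite (_ : (fun=> _) = fun x => p i x + \sum_(i <- s) p i x).
  by apply: hpoly_add; [apply: H; rewrite mem_head|apply: IH => j js; apply: H; rewrite in_cons js orbT].
by apply/funext => x; rewrite big_cons.
Qed.

Lemma hpoly_monomial (m : 'I_n -> nat) (s : seq 'I_n) :
  hpoly (\sum_(j <- s) m j)%N (fun x => \prod_(j <- s) (x 0 j)%:C ^+ m j).
Proof.
elim: s => [|j s IH].
  rewrite big_nil (_ : (fun=> _) = fun=> 1); first exact: hpoly_cst.
  by apply/funext => x; rewrite big_nil.
rewrite big_cons (_ : (fun=> _) = fun x =>
  (x 0 j)%:C ^+ m j * \prod_(j <- s) (x 0 j)%:C ^+ m j); last first.
  by apply/funext => x; rewrite big_cons.
elim: (m j) => [|k IHk].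
  by rewrite add0n (_ : (fun=> _) = fun x => \prod_(j <- s) (x 0 j)%:C ^+ m j)//;
    apply/funext => x; rewrite mul1r.
rewrite addSn (_ : (fun=> _) = fun x =>
  (x 0 j)%:C * ((x 0 j)%:C ^+ k * \prod_(j <- s) (x 0 j)%:C ^+ m j)).
  exact: hpoly_coord.
by apply/funext => x; rewrite exprS mulrA.
Qed.

Lemma hpoly_mpoly k p : hpoly k p -> exists2 P : mpoly n R[i],
  P \is ishomog1 k (@mdeg n) & forall x, p x = meval (fun j => (x 0 j)%:C) P.
Proof.
elim=> {k p} [c|k|k p q _ [P hP pP] _ [Q hQ qQ]|k j p _ [P hP pP]].
- exists (mpolyC n c); last by move=> x; rewrite mevalC.
  rewrite -[mpolyC n c]mulr1 mul_mpolyC; apply: dhomogZ; exact: dhomog1.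
- exists 0; first exact: dhomog0.
  by move=> x; rewrite raddf0.
- exists (P + Q); first exact: dhomogD.
  by move=> x; rewrite mevalD pP qQ.
- exists (mpolyX _ (mnm1 j) * P); last by move=> x; rewrite mevalM mevalXU pP.
  rewrite -add1n; apply: dhomogM => //.
  by rewrite dhomogX; apply/eqP; exact: mdeg1.
Qed.

Lemma mpoly_hpoly k (P : mpoly n R[i]) : P \is ishomog1 k (@mdeg n) ->
  hpoly k (fun x => meval (fun j => (x 0 j)%:C) P).
Proof.
move=> /dhomogP hP.
under eq_fun do rewrite mevalE.
apply: hpoly_sum => m mP; apply: hpoly_scale.
have <- : (\sum_i m i)%N = k by rewrite -(hP m mP); exact/esym/mdegE.
exact: hpoly_monomial.
Qed.

Lemma hpoly_smooth k p : hpoly k p -> smooth_on setT p.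
Proof.
elim=> {k p} [c|k|k p q _ IHp _ IHq|k j p _ IHp].
- exact: smooth_on_cst.
- exact: smooth_on_cst.
- by apply: smooth_onD => //; exact: openT.
- by apply: smooth_onM => //; [exact: openT|exact: smooth_coord].
Qed.

Lemma hpoly_cdiff k p x : hpoly k p -> cdiff p x.
Proof. by move=> /hpoly_smooth sp; exact: smooth_on_cdiff sp I. Qed.

Lemma hpoly_euler k p x : hpoly k p -> dirderive x p x = k%:R * p x.
Proof.
elim=> {k p} [c|k|k p q hp IHp hq IHq|k j p hp IHp].
- by rewrite dirderive_cst mul0r.
- by rewrite dirderive_cst mulr0.
- by rewrite dirderiveD ?IHp ?IHq ?mulrDr//; [exact: hpoly_cdiff hp|exact: hpoly_cdiff hq].
- rewrite dirderiveM ?dirderive_coord ?IHp.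
  + by rewrite -natr1; ring.
  + exact: smooth_on_cdiff (smooth_coord j) I.
  + exact: hpoly_cdiff hp.
Qed.

Lemma hpoly0_cst p : hpoly 0 p -> exists c, p = fun=> c.
Proof.
suff H k : hpoly k p -> k = 0%N -> exists c, p = fun=> c by move=> /H; exact.
elim=> {k p} [c|k|k p q _ IHp _ IHq|k j p _ IHp] // k0.
- by exists c.
- by exists 0.
- by have [a ->] := IHp k0; have [b ->] := IHq k0; exists (a + b).
Qed.

Lemma hpoly_dirderive k p v : hpoly k.+1 p -> hpoly k (dirderive v p).
Proof.
move e : k.+1 => k' hp; elim: hp k e => {k' p} [c|k'|k' p q hp IHp hq IHq|k' j p hp IHp] // k kk'.
- rewrite (_ : dirderive v _ = fun=> 0); first exact: hpoly_zero.
  by apply/funext => x; rewrite dirderive_cst.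
- rewrite (_ : dirderive v _ = fun x => dirderive v p x + dirderive v q x).
    by apply: hpoly_add; [exact: IHp|exact: IHq].
  by apply/funext => x; rewrite dirderiveD//; [exact: hpoly_cdiff hp|exact: hpoly_cdiff hq].
- move: kk' => [kk']; rewrite {}kk'.
  rewrite (_ : dirderive v _ = fun x => (v 0 j)%:C * p x + (x 0 j)%:C * dirderive v p x).
    apply: hpoly_add; first exact: hpoly_scale.
    (* In degree one the second term has no lower degree to come from; it vanishes because [p] is
       constant. *)
    case: k' hp IHp => [/hpoly0_cst[c ->] _|k' hp IHp]; last by apply: hpoly_coord; exact: IHp.
    rewrite (_ : (fun=> _) = fun=> 0); first exact: hpoly_zero.
    by apply/funext => x; rewrite dirderive_cst mulr0.
  apply/funext => x; rewrite dirderiveM ?dirderive_coord//.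
    exact: smooth_on_cdiff (smooth_coord j) I.
  exact: hpoly_cdiff hp.
Qed.

End homogeneous_functions.

(** * From the Schwartz space to the cylinder *)

Section polar.
Context {R : realType} {n : nat}.
Local Notation V := 'rV[R]_n.
Local Notation S := (sphere R n).
Local Notation C := (R * V)%type.
Local Notation E := (V -> R[i]).
Implicit Types (x : V) (w : S) (u a : S -> R[i]) (F K : R * S -> R[i]) (X : S -> V) (g h : E).

Definition cpoint (q : R * S) : V := q.1 *: val q.2.
Definition polar g : R * S -> R[i] := fun q => g (cpoint q).

Lemma smooth_polar g : smooth_on setT g -> smooth_cylinder (polar g).
Proof.
move=> sg q; exists setT, (fun p : C => g (p.1 *: p.2)); split => //; first exact: openT.
apply: (@smooth_on_row _ _ _ setT setT (fun p : C => p.1 *: p.2)) => //; first exact: openT.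
move=> j k; rewrite (_ : (fun p : C => _) = fun p : C => p.1 * p.2 0 j).
  by apply: CkM; [exact: openT|exact: Coo_fst|exact: Coo_snd].
by apply/funext => p; rewrite mxE.
Qed.

Lemma rd_polar g q : rd (polar g) q = dirderive (val q.2) g (cpoint q).
Proof.
case: q => r w.
have H (f : R[i] -> R) : derive1 (fun r => f (polar g (r, w))) r =
   'D_(val w) (f \o g) (cpoint (r, w)).
  rewrite derive1E; apply: (@derive_eq_line _ R^o) => h.
  by rewrite /polar /cpoint /= -[h *: 1]/(h * 1) mulr1 scalerDl.
by rewrite /rd /radial_derive !derive1n1 !H.
Qed.

Lemma dirderive_scale b v h x : cdiff h x -> dirderive (b *: v) h x = b%:C * dirderive v h x.
Proof.
by move=> dh; have := dirderive_lin [:: tt] (fun=> b) (fun=> v) dh; rewrite !big_seq1.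
Qed.

Lemma dirderive_coord_sum v h x : cdiff h x ->
  dirderive v h x = \sum_j (v 0 j)%:C * dirderive (delta_mx 0 j) h x.
Proof. by move=> dh; rewrite {1}(row_sum_delta v) dirderive_lin. Qed.

Lemma derive_dotp_self (v x : V) : 'D_v (fun y : V => dotp y y) x = 2 * dotp x v.
Proof.
pose c j : E := fun y => (y 0 j)%:C.
have cc j y : cdiff (c j) y by exact: smooth_on_cdiff (smooth_coord j) I.
have [_] := @dirderive_sum _ _ _ (index_enum 'I_n) (fun j y => c j y * c j y) x v
  (fun j => cdiffM (cc j x) (cc j x)).
move=> /(f_equal cRe); rewrite /= => H.
transitivity (cRe (\sum_(j <- index_enum 'I_n) dirderive v (fun y => c j y * c j y) x)).
  rewrite -H /=; apply: (f_equal (fun f : V -> R => 'D_v f x)); apply/funext => y /=.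
  by rewrite Re_sum; apply: eq_bigr => j _; rewrite Re_mulc /= mulr0 subr0.
rewrite Re_sum /dotp mulr_sumr; apply: eq_bigr => j _.
rewrite dirderiveM// dirderive_coord Re_addc !Re_mulc /c /=.
by ring.
Qed.

(** Along a tangent vector the norm is stationary at [w], so there the normalisation has the
    identity as derivative. *)
Lemma derive_dir w v k : dotp v (val w) = 0 -> 'D_v (fun y : V => dir y 0 k) (val w) = v 0 k.
Proof.
move=> vw; have w1 := sphere_dotp w.
have dd : differentiable (fun y : V => dotp y y) (val w).
  apply: (@Coo_differentiable _ _ setT _ _ I) => l.
  by apply: Ck_sum => [|j]; [exact: openT|apply: CkM; [exact: openT|exact: Coo_coord|exact: Coo_coord]].
have ds : differentiable (fun r : R => (Num.sqrt r)^-1) (dotp (val w) (val w) : R^o).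
  apply: (@Coo_differentiable _ R^o [set r : R | 0 < r] _ (dotp (val w) (val w))).
    by rewrite /= w1.
  move=> l; apply: CkV; [exact: open_gt|by move=> r /= r0; rewrite gt_eqF// sqrtr_gt0|exact: Ck_sqrt].
have dn : differentiable (fun y : V => (nrm y)^-1) (val w) by exact: (differentiable_comp dd ds).
have D0 : 'D_v (fun y : V => (nrm y)^-1) (val w) = 0.
  rewrite (derive_comp1 (g := fun r => (Num.sqrt r)^-1) v dd ds).
  by rewrite derive_dotp_self dotpC vw mulr0 mul0r.
have dk : differentiable (fun y : V => y 0 k) (val w) by exact: differentiable_coord.
have Dk : 'D_v (fun y : V => y 0 k) (val w) = v 0 k.
  by have := f_equal cRe (dirderive_coord k v (val w)).
rewrite (_ : (fun y : V => _) = (fun y : V => (nrm y)^-1 * y 0 k)); last first.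
  by apply/funext => y; rewrite mxE.
have -> := deriveM (diff_derivable dn) (diff_derivable dk).
by rewrite D0 Dk scaler0 addr0 nrm_sphere invr1 scale1r.
Qed.

(** Off the origin the radial extension of [u] is [h \o dir], and [dir] acts as the identity on
    tangent directions. Hence dilates of functions on [R^n], polynomials and constants can all serve
    as extensions. *)
Lemma field_derive_ext X u h w : dotp (X w) (val w) = 0 -> (forall w', u w' = h (val w')) ->
  cdiff h (val w) -> field_derive X u w = dirderive (X w) h (val w).
Proof.
move=> tX uh dh.
have -> : field_derive X u w = dirderive (X w) (fun y => h (dir y)) (val w).
  apply: (dirderive_eq_open _ open_neq0); first exact: sphere_neq0.
  by move=> y y0; rewrite (radial_extE u y0) uh.
have dd k : differentiable (fun y : V => dir y 0 k) (val w).
  apply: (Coo_differentiable (sphere_neq0 w : [set x : V | x != 0] (val w))).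
  by apply: Coo_dir => //; [exact: open_neq0|move=> j; exact: Coo_coord].
have dh' : cdiff h (dir (val w)) by rewrite dir_sphere.
have [_ ->] := dirderive_row (X w) dd dh'; rewrite dir_sphere.
apply: (f_equal (fun v => dirderive v h (val w))); apply/rowP => k.
by rewrite mxE derive_dir.
Qed.

Lemma fd_polar X h q : dotp (X q.2) (val q.2) = 0 -> cdiff h (cpoint q) ->
  fd X (polar h) q = q.1%:C * dirderive (X q.2) h (cpoint q).
Proof.
case: q => r w /= tX dh.
have dd k : differentiable (fun y : V => (r *: y) 0 k) (val w).
  rewrite (_ : (fun y => _) = fun y : V => r * y 0 k); last by apply/funext => y; rewrite mxE.
  by apply: differentiableM => //; exact: differentiable_coord.
have [d1 d2] := dirderive_row (X w) dd dh.
rewrite -[LHS]/(field_derive X (fun w => h (r *: val w)) w).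
rewrite (@field_derive_ext X _ (fun y => h (r *: y)))// d2.
rewrite -[RHS](@dirderive_scale r (X w) h (cpoint (r, w)) dh).
apply: (f_equal (fun v => dirderive v h (cpoint (r, w)))).
apply/rowP => k; rewrite !mxE.
have := f_equal cRe (@dirderiveM _ _ _ _ (val w) (X w) (cdiff_cst r%:C (val w : V))
   (smooth_on_cdiff (smooth_coord k) (I : setT (val w)))).
rewrite dirderive_cst mul0r add0r dirderive_coord Re_mulc /= mul0r subr0 => <-.
apply: (f_equal (fun f : V -> R => 'D_(X w) f (val w))); apply/funext => y.
by rewrite mxE /= mul0r subr0.
Qed.

Lemma cpoint_sum q : q.1 = \sum_j (val q.2 : V) 0 j * cpoint q 0 j.
Proof.
transitivity (q.1 * dotp (val q.2) (val q.2)); first by rewrite sphere_dotp mulr1.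
rewrite /dotp mulr_sumr.
by apply: eq_bigr => j _; rewrite mxE mulrCA.
Qed.

Lemma smooth_cyl_coord j : smooth_cylinder (fun q : R * S => ((val q.2 : V) 0 j)%:C).
Proof.
apply: (@smooth_sphere_cylinder _ _ (fun w : S => ((val w : V) 0 j)%:C)).
exact: (smooth_sphere_val (smooth_coord j)).
Qed.

Lemma smooth_cylinder_cst (c : R[i]) : smooth_cylinder (fun _ : R * S => c).
Proof.
apply: (@smooth_sphere_cylinder _ _ (fun _ : S => c)).
by apply: (@smooth_sphere_val R n (fun=> c)); exact: smooth_on_cst.
Qed.

Lemma smooth_cylinder_sum (I : Type) (s : seq I) (F : I -> R * S -> R[i]) :
  (forall i, smooth_cylinder (F i)) -> smooth_cylinder (fun q => \sum_(i <- s) F i q).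
Proof.
move=> sF; elim: s => [|i s IH].
  rewrite (_ : (fun=> _) = fun=> 0); first exact: smooth_cylinder_cst.
  by apply/funext => q; rewrite big_nil.
rewrite (_ : (fun=> _) = fun q => F i q + \sum_(i <- s) F i q); first exact: smooth_cylinderD.
by apply/funext => q; rewrite big_cons.
Qed.

Lemma rd_sum (I : Type) (s : seq I) (F : I -> R * S -> R[i]) q :
  (forall i, smooth_cylinder (F i)) ->
  rd (fun q => \sum_(i <- s) F i q) q = \sum_(i <- s) rd (F i) q.
Proof.
move=> sF; elim: s => [|i s IH].
  rewrite big_nil -[RHS](rd_sphere (fun _ : S => 0) q); congr (rd _ q).
  by apply/funext => p; rewrite big_nil.
rewrite big_cons -IH -rdD//; last exact: smooth_cylinder_sum.
by congr (rd _ q); apply/funext => p; rewrite big_cons.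
Qed.

Lemma radial_derive_lin (I : Type) (s : seq I) (u : I -> S -> R[i]) (F : I -> R * S -> R[i]) k q :
  (forall i, smooth_cylinder (fun q => u i q.2)) -> (forall i, smooth_cylinder (F i)) ->
  radial_derive k (fun q => \sum_(i <- s) u i q.2 * F i q) q =
  \sum_(i <- s) u i q.2 * radial_derive k (F i) q.
Proof.
move=> su sF; elim: k q => [|k IH] q.
  by rewrite radial_derive0; apply: eq_bigr => i _; rewrite radial_derive0.
rewrite radial_deriveS.
rewrite (_ : radial_derive k _ = fun q => \sum_(i <- s) u i q.2 * radial_derive k (F i) q); last first.
  by apply/funext => p; rewrite IH.
have sk i : smooth_cylinder (radial_derive k (F i)) by exact: smooth_radial_derive.
rewrite rd_sum => [|i]; last exact: smooth_cylinderM.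
by apply: eq_bigr => i _; rewrite rdM// rd_sphere mul0r add0r -radial_deriveS.
Qed.

(* Operators [g |-> a(w) (Q g)(r w)], whose sums are stable under all the
   derivatives of the cylinder: the factor [r] brought out by a vector field is
   [sum_i w_i x_i] at the point [x = r w]. *)
Definition pol_op (T : E -> R * S -> R[i]) : Prop :=
  exists L : seq ((S -> R[i]) * (E -> E)),
    (forall t, List.In t L -> smooth_cylinder (fun q => t.1 q.2) /\ sop t.2) /\
    forall g, is_schwartz g -> T g = fun q => \sum_(t <- L) t.1 q.2 * polar (t.2 g) q.

Lemma pol_op_eq T T' : (forall g, is_schwartz g -> T g = T' g) -> pol_op T -> pol_op T'.
Proof. by move=> TT' [L [gL LE]]; exists L; split => // g Sg; rewrite -TT'// LE. Qed.

Lemma pol_op_term a Q : smooth_cylinder (fun q => a q.2) -> sop Q ->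
  pol_op (fun g q => a q.2 * polar (Q g) q).
Proof.
move=> sa sQ; exists [:: (a, Q)]; split; first by move=> t [<-|[]].
by move=> g _; apply/funext => q; rewrite big_seq1.
Qed.

Lemma pol_opD T U : pol_op T -> pol_op U -> pol_op (fun g q => T g q + U g q).
Proof.
move=> [L [gL LE]] [M [gM ME]]; exists (L ++ M); split.
  by move=> t tLM; case: (List.in_app_or _ _ _ tLM); [exact: gL|exact: gM].
by move=> g Sg; apply/funext => q; rewrite LE// ME// big_cat.
Qed.

Lemma pol_op0 : pol_op (fun _ _ => 0).
Proof.
by exists [::]; split => // g _; apply/funext => q; rewrite big_nil.
Qed.

Lemma pol_op_sum (I : Type) (s : seq I) (T : I -> E -> R * S -> R[i]) :
  (forall i, pol_op (T i)) -> pol_op (fun g q => \sum_(i <- s) T i g q).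
Proof.
move=> pT; elim: s => [|i s IH].
  apply: pol_op_eq pol_op0 => g _; by apply/funext => q; rewrite big_nil.
apply: pol_op_eq (pol_opD (pT i) IH) => g _.
by apply/funext => q; rewrite big_cons.
Qed.

(** Membership in [pol_op] prescribes the values on Schwartz functions only, whence the first
    premise: [P] has to respect equality on them. *)
Lemma pol_op_ind (P : (E -> R * S -> R[i]) -> Prop) :
  (forall T T', (forall g, is_schwartz g -> T g = T' g) -> P T -> P T') ->
  P (fun _ _ => 0) ->
  (forall a Q T, smooth_cylinder (fun q => a q.2) -> sop Q -> pol_op T -> P T ->
     P (fun g q => a q.2 * polar (Q g) q + T g q)) ->
  forall T, pol_op T -> P T.
Proof.
move=> PE P0 PS T [L [gL LE]]; apply: (PE _ _ (fun g Sg => esym (LE g Sg))).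
elim: L gL {LE T} => [|[a Q] L IH] gL.
  by apply: (PE (fun _ _ => 0)) => // g _; apply/funext => q; rewrite big_nil.
have [sa sQ] := gL _ (or_introl erefl).
have gL' t : List.In t L -> smooth_cylinder (fun q => t.1 q.2) /\ sop t.2.
  by move=> tL; apply: gL; right.
apply: (PE (fun g q => a q.2 * polar (Q g) q + \sum_(t <- L) t.1 q.2 * polar (t.2 g) q)).
  by move=> g _; apply/funext => q; rewrite big_cons.
by apply: PS => //; [exists L|exact: IH].
Qed.

Lemma schwartz_polar_smooth g : is_schwartz g -> smooth_cylinder (polar g).
Proof. by move=> [sg _]; exact: smooth_polar. Qed.

Lemma pol_op_smooth T : pol_op T -> forall g, is_schwartz g -> smooth_cylinder (T g).
Proof.
move: T; apply: pol_op_ind => [T T' TT' sT g Sg||a Q T sa sQ _ IH g Sg].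
- by rewrite -TT'//; exact: sT.
- by move=> _ _; exact: smooth_cylinder_cst.
- apply: smooth_cylinderD; last exact: IH.
  by apply: smooth_cylinderM => //; exact: schwartz_polar_smooth (sQ.1 g Sg).
Qed.

Lemma pol_op_rd T : pol_op T -> pol_op (fun g => rd (T g)).
Proof.
move: T; apply: pol_op_ind => [T T' TT' sT||a Q T sa sQ pT IH].
- by apply: pol_op_eq sT => g Sg; rewrite TT'.
- apply: pol_op_eq pol_op0 => g _; apply/funext => q.
  by rewrite (rd_sphere (fun _ : S => 0)).
- apply: pol_op_eq (pol_opD (pol_op_sum (index_enum 'I_n) (fun j =>
    @pol_op_term (fun w => a w * ((val w : V) 0 j)%:C) _
      (smooth_cylinderM sa (smooth_cyl_coord j)) (sop_comp sQ (sop_partial j)))) IH) => g Sg.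
  have sQg := schwartz_polar_smooth (sQ.1 g Sg).
  apply/funext => q; rewrite rdD; [|exact: smooth_cylinderM|exact: pol_op_smooth].
  congr (_ + _); rewrite rdM// rd_sphere mul0r add0r rd_polar dirderive_coord_sum.
    by rewrite mulr_sumr; apply: eq_bigr => j _; rewrite mulrA.
  exact: smooth_on_cdiff (schwartz_smooth (sQ.1 g Sg)) I.
Qed.

Lemma pol_op_fd X T : smooth_tangent_field X -> pol_op T -> pol_op (fun g => fd X (T g)).
Proof.
move=> tX; move: T; apply: pol_op_ind => [T T' TT' sT||a Q T sa sQ pT IH].
- by apply: pol_op_eq sT => g Sg; rewrite TT'.
- apply: pol_op_eq pol_op0 => g _; apply/funext => q.
  rewrite -[RHS]/(field_derive X (fun=> 0) q.2).
  by rewrite (@field_derive_ext X _ (fun=> 0)) ?dirderive_cst//; [exact: tX.1|exact: cdiff_cst].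
- have sX j : smooth_cylinder (fun q => (X q.2 0 j)%:C) by exact: smooth_sphere_cylinder (tX.2 j).
  have p1 := @pol_op_term (field_derive X a) Q (smooth_fd tX sa) sQ.
  have p2 := pol_op_sum (index_enum 'I_n) (fun j => pol_op_sum (index_enum 'I_n) (fun i =>
    @pol_op_term (fun w => a w * ((X w 0 j)%:C * ((val w : V) 0 i)%:C)) _
      (smooth_cylinderM sa (smooth_cylinderM (sX j) (smooth_cyl_coord i)))
      (sop_comp sQ (sop_comp (sop_partial j) (sop_mulx i))))).
  apply: pol_op_eq (pol_opD (pol_opD p1 p2) IH) => g Sg.
  have sQg := schwartz_polar_smooth (sQ.1 g Sg).
  have dQ x : cdiff (Q g) x by exact: smooth_on_cdiff (schwartz_smooth (sQ.1 g Sg)) I.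
  apply/funext => q; rewrite fdD; [|exact: smooth_cylinderM|exact: pol_op_smooth].
  congr (_ + _); rewrite fdM//; congr (_ + _).
  rewrite (fd_polar (tX.1 q.2) (dQ _)) dirderive_coord_sum// (cpoint_sum q).
  rewrite rmorph_sum/= mulr_suml mulr_sumr exchange_big/=; apply: eq_bigr => i _.
  rewrite !mulr_sumr; apply: eq_bigr => j _; rewrite /polar /= /mulx rmorphM/=.
  by ring.
Qed.

Lemma pol_op_mul a T : smooth_cylinder (fun q => a q.2) -> pol_op T ->
  pol_op (fun g q => a q.2 * T g q).
Proof.
move=> sa; move: T; apply: pol_op_ind => [T T' TT' sT||b Q T sb sQ pT IH].
- by apply: pol_op_eq sT => g Sg; rewrite TT'.
- by apply: pol_op_eq pol_op0 => g _; apply/funext => q; rewrite mulr0.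
- apply: pol_op_eq (pol_opD (@pol_op_term (fun w => a w * b w) Q (smooth_cylinderM sa sb) sQ) IH) => g Sg.
  by apply/funext => q; rewrite mulrDr mulrA.
Qed.

Lemma pol_op_sph D T : sphere_diffop D -> pol_op T -> pol_op (fun g => spherical_derive D (T g)).
Proof.
move=> dD; elim: dD T => {D} [a sa|X tX|D1 D2 _ IH1 _ IH2|D1 D2 _ IH1 _ IH2] T pT.
- apply: pol_op_eq (pol_op_mul (smooth_sphere_cylinder sa) pT) => g _.
  by apply/funext => -[].
- exact: (pol_op_fd tX pT).
- exact: (pol_opD (IH1 _ pT) (IH2 _ pT)).
- exact: (IH1 _ (IH2 _ pT)).
Qed.

Lemma pol_op_radial l T : pol_op T -> pol_op (fun g => radial_derive l (T g)).
Proof.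
move=> pT; elim: l => [|l IH].
  by apply: pol_op_eq pT => g _; rewrite radial_derive0.
by apply: pol_op_eq (pol_op_rd IH) => g _; rewrite radial_deriveS.
Qed.

Lemma pol_op_polar : pol_op polar.
Proof.
apply: pol_op_eq (@pol_op_term (fun=> 1) id (smooth_cylinder_cst 1) sop_id) => g _.
by apply/funext => q; rewrite mul1r.
Qed.

Lemma sphere_coef_bounded a : smooth_cylinder (fun q => a q.2) ->
  exists2 M, 0 <= M & forall w, normc (a w) <= M.
Proof.
move=> /smooth_cylinderP sa.
have H (f : R[i] -> R) : (forall q, CV0 q -> {for q, continuous (f \o cext (fun q => a q.2))}) ->
    exists M, forall w, `|f (a w)| <= M.
  move=> cf; pose A : set V := [set x | dotp x x = 1].
  have cdot : continuous (fun x : V => dotp x x).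
    move=> x; apply: differentiable_continuous; apply: (@Coo_differentiable _ _ setT _ _ I) => l.
    by apply: Ck_sum => [|j]; [exact: openT|apply: CkM; [exact: openT|exact: Coo_coord|exact: Coo_coord]].
  have cA : compact A.
    apply: bounded_closed_compact.
      exists 1; split => // M M1 x Ax.
      apply: (le_trans _ (ltW M1)); rewrite [leLHS]mx_normrE; apply: bigmax_le => // -[i j] _ /=.
      by rewrite (ord1 i) (le_trans (coord_le_nrm x j))// /nrm Ax sqrtr1.
    rewrite (_ : A = (fun x : V => dotp x x) @^-1` [set 1])//.
    apply: closed_comp => [x _|]; first exact: cdot.
    exact/accessible_closed_set1/hausdorff_accessible/norm_hausdorff.
  (* The real parameter is a dummy frozen at [0]; the bound comes from compactness of the sphere
     [A]. *)
  have [|M /nbhs_singleton HM] := @compact_param_bound R V R A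
      (fun t => f (cext (fun q => a q.2) (t.2, t.1))) 0 cA.
    move=> x Ax; apply: (@continuous_comp _ _ _ (fun t : V * R => (t.2, t.1))
      (f \o cext (fun q => a q.2)) (x, 0)).
      exact: (@swap_continuous V R (x, 0)).
    apply: cf; rewrite /CV0 /=; apply/eqP => x0; move: Ax; rewrite /A x0 /= /dotp big1 => [/eqP|j _].
      by rewrite eq_sym oner_eq0.
    by rewrite mxE mul0r.
  exists M => w; have := HM (val w) (sphere_dotp w).
  by rewrite -[(0, val w)]/(cpt (0, w)) cext_cpt.
have [|M1 H1] := H cRe.
  by move=> q q0; have [] := cdiff_continuous (smooth_on_cdiff sa q0).
have [|M2 H2] := H cIm.
  by move=> q q0; have [] := cdiff_continuous (smooth_on_cdiff sa q0).
exists (`|M1| + `|M2|); first exact: addr_ge0.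
move=> w; rewrite (le_trans (normc_le_ReIm _))// lerD//.
  by rewrite (le_trans (H1 w))// ler_norm.
by rewrite (le_trans (H2 w))// ler_norm.
Qed.

Lemma sop_radial k : exists2 P, @sop R n P &
  forall g x, P g x = ((1 + dotp x x) ^+ k)%:C * g x.
Proof.
have sum_sop (s : seq 'I_n) : exists2 P, @sop R n P &
    forall g x, P g x = (1 + \sum_(j <- s) x 0 j * x 0 j)%:C * g x.
  elim: s => [|j s [P sP PE]].
    by exists id; [exact: sop_id|move=> g x; rewrite big_nil addr0 mul1r].
  exists (fun g x => P g x + mulx j (mulx j g) x).
    by apply: sopD => //; apply: sop_comp; exact: sop_mulx.
  move=> g x; rewrite PE big_cons /mulx mulrA -rmorphM -mulrDl -rmorphD/=.
  by congr (_%:C * _); ring.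
elim: k => [|k [P sP PE]].
  by exists id; [exact: sop_id|move=> g x; rewrite expr0 mul1r].
have [Q sQ QE] := sum_sop (index_enum 'I_n).
exists (Q \o P); first exact: sop_comp.
by move=> g x; rewrite /= QE PE mulrA -rmorphM/= exprS.
Qed.

Lemma dotp_cpoint q : dotp (cpoint q) (cpoint q) = q.1 ^+ 2.
Proof. by rewrite dotpZl dotpZr sphere_dotp mulr1. Qed.

(** At [x = r w] the weight [(1 + r^2)^k] is multiplication by [(1 + |x|^2)^k], an operator to be
    composed with [Q]. Each term then needs one estimate in [index0], times a bound of its
    coefficient on the sphere. *)
Lemma pol_op_bounded T k : pol_op T -> exists (J : seq (@schwartz_index n)) (A : R),
  0 <= A /\ forall g B, is_schwartz g -> 0 <= B ->
    weights_le (@schwartz_weight R n) J g B -> forall q,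
    (1 + q.1 ^+ 2) ^+ k * normc (T g q) <= A * B.
Proof.
move: T; apply: pol_op_ind => [T T' TT' [J [A [A0 H]]]||a Q T sa sQ pT [J [A [A0 H]]]].
- by exists J, A; split => // g B Sg B0 gB q; rewrite -TT'//; exact: H.
- exists [::], 0; split => // g B _ _ _ q.
  by rewrite ComplexField.Normc.normc0 mulr0 mul0r.
- have [M M0 aM] := sphere_coef_bounded sa.
  have [P sP PE] := sop_radial k.
  have [SPQ bPQ] := sop_comp sQ sP.
  have [J' [A' [A'0 H']]] := bPQ index0.
  exists (J' ++ J), (M * A' + A); split; first by rewrite addr_ge0// mulr_ge0.
  move=> g B Sg B0 gB q; have [b1 b2] := weights_le_cat gB.
  have k0 : 0 <= (1 + q.1 ^+ 2) ^+ k by rewrite exprn_ge0// addr_ge0// sqr_ge0.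
  rewrite (le_trans (ler_wpM2l k0 (le_normcD _ _)))// mulrDr mulrDl lerD//; last exact: H.
  have := H' g B Sg B0 b1 (cpoint q).
  rewrite schwartz_weight0 -[(P \o Q) g _]/(P (Q g) _) PE dotp_cpoint normcZr ger0_norm// => h.
  rewrite ComplexField.Normc.normcM mulrCA -mulrA; apply: ler_pM => //; first exact: normc_ge0.
  by rewrite mulr_ge0// normc_ge0.
Qed.

Local Notation sw := (@schwartz_weight R n).
Local Notation hw := (@schwartzH_weight R n).

Lemma polar_bounded : bounded_op (@is_schwartz R n) sw hw polar.
Proof.
move=> [[k l] [D dD]].
have [J [A [A0 H]]] := pol_op_bounded k (pol_op_radial l (pol_op_sph dD pol_op_polar)).
by exists J, A; split => // g B Sg B0 gB q; exact: H.
Qed.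

(** The radial derivative of [g (r w)] is the sum of the [w_j (d_j g) (r w)]: each derivative raises
    the degree in [w] by one, and at [r = 0] only constants remain beside the factors [w_j]. *)
Lemma polar_homogeneous k g : smooth_on setT g ->
  exists2 p, hpoly k p & forall w, radial_derive k (polar g) (0, w) = p (val w).
Proof.
elim: k g => [|k IH] g sg.
  exists (fun=> g 0); first exact: hpoly_cst.
  by move=> w; rewrite radial_derive0 /polar /cpoint scale0r.
have /choice[p hp] j : exists p, hpoly k p /\
    forall w, radial_derive k (polar (dirderive (delta_mx 0 j) g)) (0, w) = p (val w).
  by have [p hp pE] := IH _ (smooth_on_dirderive (delta_mx 0 j) sg); exists p.
exists (fun x => \sum_j (x 0 j)%:C * p j x).
  by apply: hpoly_sum => j _; apply: hpoly_coord; exact: (hp j).1.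
move=> w; rewrite radial_deriveSr.
rewrite (_ : rd (polar g) = fun q => \sum_j ((val q.2 : V) 0 j)%:C *
   polar (dirderive (delta_mx 0 j) g) q).
  rewrite (radial_derive_lin _ (u := fun j w => ((val w : V) 0 j)%:C)).
  - by apply: eq_bigr => j _; rewrite (hp j).2.
  - exact: smooth_cyl_coord.
  - by move=> j; apply: smooth_polar; exact: smooth_on_dirderive.
apply/funext => q; rewrite rd_polar dirderive_coord_sum//.
exact: smooth_on_cdiff sg I.
Qed.

Lemma polar_schwartzH g : is_schwartz g -> is_schwartzH (polar g).
Proof.
move=> Sg; split.
- exact: schwartz_polar_smooth.
- by move=> r w; rewrite /polar /cpoint /= scaleNr scalerN opprK.
- move=> k; have [p hp pE] := polar_homogeneous k (schwartz_smooth Sg).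
  have [P hP PE] := hpoly_mpoly hp; exists P => // w.
  by rewrite pE PE.
- move=> i; have [B HB] := bounded_op_bounds polar_bounded Sg (schwartz_bounds Sg) i.
  by exists B => _ [q _ <-].
Qed.

End polar.

(** * Division by the radial variable *)

Section hadamard_quotient.
Context {R : realType} {n : nat}.
Local Notation V := 'rV[R]_n.
Local Notation S := (sphere R n).
Local Notation C := (R * V)%type.
Local Notation RT := (measurableTypeR R).
Local Notation leb := (@lebesgue_measure R).
Local Notation I01 := (`[0, 1]%classic : set RT).
Implicit Types (Phi : C -> R) (q : C).

Definition dil (t : R) q : C := (t * q.1, q.2).

(** Each radial derivative of [Phi (t r, x)] brings out a factor [t]; with all powers [t ^+ m] the
    family is closed under differentiation, which makes the induction in [radial_mean_Ck]
    possible. *)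
Definition radial_mean (m : nat) Phi q : R := \int[leb]_(t in I01) (t ^+ m * Phi (dil t q)).

Lemma CV0_dil t q : CV0 q -> CV0 (dil t q). Proof. by []. Qed.

Lemma Coo_smooth (U : set C) Phi : Coo U Phi <-> smooth_on U (fun q => (Phi q)%:C).
Proof.
split; first exact: smooth_on_real.
by move=> /smooth_onP[].
Qed.

Lemma Coo_derive (U : set C) Phi (v : C) : Coo U Phi -> Coo U ('D_v Phi).
Proof. by move=> cP k; have [_] := cP k.+1; apply. Qed.

Lemma Coo_dil t Phi : Coo CV0 Phi -> Coo CV0 (fun q => Phi (dil t q)).
Proof.
move=> cP; apply/Coo_smooth.
apply: (@smooth_on_pair _ _ _ CV0 CV0 (fun q : C => t * q.1) (fun q : C => q.2)
  (fun q => (Phi q)%:C)) => //.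
- exact: openCV0.
- by move=> k; apply: CkZ; [exact: openCV0|exact: Coo_fst].
- by move=> k; exact: Coo_snd.
- exact/Coo_smooth.
Qed.

Lemma derive_dil t Phi (v q : C) :
  'D_v (fun q => Phi (dil t q)) q = 'D_(dil 0 v + t *: ((v.1, 0) : C)) Phi (dil t q).
Proof.
apply: (@derive_eq_line _ C C) => h; congr (Phi _).
rewrite /dil [LHS]surjective_pairing [RHS]surjective_pairing; congr pair => /=.
  rewrite mul0r add0r -[t *: v.1]/(t * v.1) -[h *: v.1]/(h * v.1) -[h *: _]/(h * _).
  by ring.
by rewrite scaler0 addr0.
Qed.

Lemma derive_split t Phi (v q : C) : CV0 q -> Coo CV0 Phi ->
  'D_v (fun q => Phi (dil t q)) q =
  'D_((0, v.2) : C) Phi (dil t q) + t * (v.1 * 'D_((1, 0) : C) Phi (dil t q)).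
Proof.
move=> q0 cP; rewrite derive_dil.
have dP := Coo_differentiable (CV0_dil t q0) cP.
have -> : dil 0 v + t *: ((v.1, 0) : C) = dil 0 v + (t * v.1) *: ((1, 0) : C).
  congr (_ + _); rewrite -[LHS]/(t * v.1, t *: (0 : V)).
  by rewrite -[RHS]/((t * v.1) * 1, (t * v.1) *: (0 : V)) mulr1 !scaler0.
rewrite !deriveE// linearD linearZ /= mulrA; congr ('d _ _ _ + _).
by rewrite /dil mul0r.
Qed.

Lemma continuous_dil : continuous (fun p : R * C => dil p.1 p.2).
Proof.
move=> [t q].
have c1 : (fun p : R * C => p.1 * p.2.1) @ (t, q) --> t * q.1.
  apply: (@cvgM _ _ _ _ (fun p : R * C => p.1) (fun p : R * C => p.2.1)); first exact: cvg_fst.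
  apply: (@cvg_comp _ _ _ (fun p : R * C => p.2) (fun q : C => q.1) _ (nbhs q)); first exact: cvg_snd.
  exact: cvg_fst.
have c2 : (fun p : R * C => p.2.2) @ (t, q) --> q.2.
  apply: (@cvg_comp _ _ _ (fun p : R * C => p.2) (fun q : C => q.2) _ (nbhs q)); first exact: cvg_snd.
  exact: cvg_snd.
exact: (@cvg_pair _ _ _ (nbhs (t, q)) (nbhs (t * q.1)) (nbhs q.2) _ _ _ _ _ c1 c2).
Qed.

Lemma dil_bound Phi q : CV0 q -> Coo CV0 Phi ->
  exists2 M, 0 <= M & \forall z \near q, forall t, `[0, 1]%classic t -> `|Phi (dil t z)| <= M.
Proof.
move=> q0 cP.
have [|M HM] := @compact_param_bound R R C `[0, 1]%classic (fun p => Phi (dil p.1 p.2)) q (@segment_compact R 0 1).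
  move=> t _; apply: (@continuous_comp _ _ _ (fun p : R * C => dil p.1 p.2) Phi (t, q)).
    exact: continuous_dil.
  by apply: differentiable_continuous; exact: (Coo_differentiable (CV0_dil t q0) cP).
exists `|M| => //; apply: filterS HM => z Hz t t01.
by rewrite (le_trans (Hz t t01))// ler_norm.
Qed.

Lemma continuous_in_dil Phi q : CV0 q -> Coo CV0 Phi -> continuous (fun t : R => Phi (dil t q)).
Proof.
move=> q0 cP t; apply: (@continuous_comp _ _ _ (fun t : R => dil t q) Phi t).
  apply: (@continuous_comp _ _ _ (fun t : R => (t, q)) (fun p : R * C => dil p.1 p.2) t); last exact: continuous_dil.
  exact: (@cvg_pair _ _ _ (nbhs t) (nbhs t) (nbhs q) _ _ _ _ _ (@cvg_id _ _) (@cvg_cst _ _ _ _ _)).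
by apply: differentiable_continuous; exact: (Coo_differentiable (CV0_dil t q0) cP).
Qed.

Lemma continuous_expn m : continuous (fun t : R => t ^+ m).
Proof. by move=> t; exact: exprn_continuous. Qed.

Lemma radial_mean_integrable m Phi q : CV0 q -> Coo CV0 Phi ->
  leb.-integrable I01 (EFin \o (fun t : RT => t ^+ m * Phi (dil t q))).
Proof.
move=> q0 cP; apply: continuous_compact_integrable; first exact: segment_compact.
apply: continuous_subspaceT; apply: continuous_funM; first exact: continuous_expn.
exact: continuous_in_dil.
Qed.

Definition pair_lin (j : 'I_n.+1) : {linear C -> R} :=
  oapp (@snd_lin R n) (@fst_lin R n) (unlift ord0 j).

Lemma pair_linE (j : 'I_n.+1) (v : C) : pair_lin j v = pair_coef v.1 v.2 j.
Proof. by rewrite /pair_lin /pair_coef; case: unliftP. Qed.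

Lemma pair_lin_sum (v : C) : v = \sum_j pair_lin j v *: pair_basis j.
Proof.
rewrite {1}(surjective_pairing v) pair_sum.
by apply: eq_bigr => j _; rewrite pair_linE.
Qed.

Lemma pair_lin_le (j : 'I_n.+1) (v : C) : `|pair_lin j v| <= `|v|.
Proof.
rewrite pair_linE prod_normE le_max /pair_coef; case: unliftP => [k _|_] /=.
  by rewrite row_coord_le orbT.
by rewrite lexx.
Qed.

Lemma Rintegral_lincomb (f g : RT -> R) (a : R) :
  leb.-integrable I01 (EFin \o f) -> leb.-integrable I01 (EFin \o g) ->
  \int[leb]_(t in I01) (f t + a * g t) =
  \int[leb]_(t in I01) f t + a * \int[leb]_(t in I01) g t.
Proof.
by move=> fi gi; rewrite -RintegralZl// RintegralD//; exact: integrable_realZ.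
Qed.

Lemma radial_mean_differentiable m Phi q : CV0 q -> Coo CV0 Phi ->
  differentiable (radial_mean m Phi) q /\
  forall v : C, 'D_v (radial_mean m Phi) q =
    radial_mean m ('D_((0, v.2) : C) Phi) q + v.1 * radial_mean m.+1 ('D_((1, 0) : C) Phi) q.
Proof.
move=> q0 cP.
pose F (z : C) (t : RT) : R := t ^+ m * Phi (dil t z).
have [M0 M00 H0] := dil_bound q0 cP.
have c1 := Coo_derive ((1, 0) : C) cP.
have c2 (j : 'I_n.+1) := Coo_derive ((0, (pair_basis j : C).2) : C) cP.
have [M1 M10 H1] := dil_bound q0 c1.
have /choice[N HN] (j : 'I_n.+1) : exists N, 0 <= N /\ \forall z \near q, forall t, `[0, 1]%classic t ->
    `|'D_((0, (pair_basis j : C).2) : C) Phi (dil t z)| <= N.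
  by have [N N0 HN] := dil_bound q0 (c2 j); exists N.
have N0 j := (HN j).1.
have HNa := filter_forall (nbhs_filter q) (fun j => (HN j).2).
have H3 : \forall z \near q, CV0 z by apply: open_nbhs_nbhs; split => //; exact: openCV0.
have Hall := @filterI _ (nbhs q) _ _ _ (@filterI _ (nbhs q) _ _ _ H0 H1)
  (@filterI _ (nbhs q) _ _ _ HNa H3).
have [r /= r0 Hr] := (@nbhs_ballP R C q _).1 (Hall (nbhs_filter q) (nbhs_filter q) (nbhs_filter q)).
have sN0 : 0 <= \sum_j N j by exact: sumr_ge0.
pose G (t : RT) : R := M0 + M1 + \sum_j N j.
have G0 t : 0 <= G t by rewrite !addr_ge0.
have F_Coo t : Coo CV0 (F ^~ t).
  by move=> k; apply: CkZ; [exact: openCV0|exact: (Coo_dil t cP)].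
have DF v t z : CV0 z -> 'D_v (F ^~ t) z = t ^+ m *
   ('D_((0, v.2) : C) Phi (dil t z) + t * (v.1 * 'D_((1, 0) : C) Phi (dil t z))).
  move=> z0; rewrite -derive_split//.
  have dz := diff_derivable (Coo_differentiable z0 (Coo_dil t cP)) : derivable _ z v.
  exact: (deriveZ (t ^+ m) dz).
have t1 (t : R) : `[0, 1]%classic t -> `|t| <= 1.
  by rewrite /= in_itv/= => /andP[a b]; rewrite ger0_norm.
have tm (t : R) k : `[0, 1]%classic t -> `|t ^+ k| <= 1.
  by move=> /t1 ?; rewrite normrX exprn_ile1.
have pb1 (j : 'I_n.+1) : `|(pair_basis j : C).1| <= 1.
  by rewrite /pair_basis; case: unliftP => [k _|_] /=; rewrite ?normr0 ?normr1.
have [] := @differentiable_integral_param R C _ RT leb I01 (measurable_itv _) n.+1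
  (@pair_basis R n) pair_lin pair_lin_sum pair_lin_le F G q r r0.
- by move=> z /Hr[_ [_ z0]]; exact: radial_mean_integrable.
- by move=> z t /Hr[_ [_ z0]] _; exact: (Coo_differentiable z0 (F_Coo t)).
- apply: continuous_compact_integrable; first exact: segment_compact.
  by apply: continuous_subspaceT; exact: cst_continuous.
- exact: G0.
- move=> z t /Hr[[h0 h1] [h2 h3]] t01; rewrite normrM.
  rewrite (le_trans (ler_piMl _ (tm t m t01)))// (le_trans (h0 t t01))//.
  by rewrite /G -addrA lerDl addr_ge0.
- move=> j z t /Hr[[h0 h1] [h2 h3]] t01; rewrite DF// normrM.
  rewrite (le_trans (ler_piMl _ (tm t m t01)))// (le_trans (ler_normD _ _))//.
  rewrite /G [leRHS]addrC lerD//.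
    rewrite (le_trans (h2 j t t01))// (bigD1 j)//= lerDl sumr_ge0//.
  rewrite !normrM (le_trans (ler_piMl _ (t1 t t01)))//.
  rewrite (le_trans (ler_piMl _ (pb1 j)))// (le_trans (h1 t t01))//.
  by rewrite lerDr.
- move=> j t t01; apply: differentiable_continuous.
  exact: (Coo_differentiable q0 (Coo_derive (pair_basis j) (F_Coo t))).
move=> dF HF; split; first exact: dF.
move=> v; have [_ ->] := HF v.
have i1 := radial_mean_integrable m q0 (Coo_derive ((0, v.2) : C) cP).
have i2 := radial_mean_integrable m.+1 q0 c1.
rewrite -(Rintegral_lincomb v.1 i1 i2).
by apply: eq_Rintegral => t _; rewrite DF//; move: ('D_ _ _ _) ('D_ _ _ _) => a b; rewrite exprSr; ring.
Qed.

Lemma radial_mean_Ck k m Phi : Coo CV0 Phi -> Ck k CV0 (radial_mean m Phi).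
Proof.
elim: k m Phi => [|k IH] m Phi cP.
  by split => // q q0; have [] := radial_mean_differentiable m q0 cP.
split; first by move=> q q0; have [] := radial_mean_differentiable m q0 cP.
move=> v; apply: (@Ck_eq _ _ _ _ (fun q => radial_mean m ('D_((0, v.2) : C) Phi) q +
    v.1 * radial_mean m.+1 ('D_((1, 0) : C) Phi) q)).
- exact: openCV0.
- by move=> q q0; have [_ ->] := radial_mean_differentiable m q0 cP.
- apply: CkD; first exact: openCV0.
    by apply: IH; exact: Coo_derive.
  by apply: CkZ; [exact: openCV0|apply: IH; exact: Coo_derive].
Qed.

Implicit Types (F K H : R * S -> R[i]).
Local Notation RS := (R * S)%type.

(** For [r != 0] this is the quotient [(K (r, w) - K (0, w)) / r]; in integral form it is smooth
    across [r = 0]. *)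
Definition hadamard K : RS -> R[i] := fun q : RS =>
  (\int[leb]_(t in I01) cRe (rd K (t * q.1, q.2))) +i*
  (\int[leb]_(t in I01) cIm (rd K (t * q.1, q.2))).

Lemma smooth_hadamard K : smooth_cylinder K -> smooth_cylinder (hadamard K).
Proof.
move=> sK; have /smooth_cylinderP/smooth_onP[cr ci] := smooth_rd sK.
apply/smooth_cylinderP.
apply: (@smooth_on_eq _ _ _ (fun q => radial_mean 0 (cRe \o cext (rd K)) q +i*
  radial_mean 0 (cIm \o cext (rd K)) q)); first exact: openCV0.
  move=> q q0; rewrite cextE /hadamard; congr (_ +i* _); apply: eq_Rintegral => t _.
    by rewrite expr0 mul1r /= cextE.
  by rewrite expr0 mul1r /= cextE.
by apply/smooth_onP; split => k; exact: radial_mean_Ck.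
Qed.

Lemma is_derive_rd F r w : smooth_cylinder F ->
  is_derive (r : R) 1 (fun s => cRe (F (s, w))) (cRe (rd F (r, w))) /\
  is_derive (r : R) 1 (fun s => cIm (F (s, w))) (cIm (rd F (r, w))).
Proof.
move=> sF; have [dr di] := cyl_cdiff (r, w) sF.
have H (f : R[i] -> R) : differentiable (f \o cext F) (cpt (r, w)) ->
    is_derive (r : R) 1 (fun s => f (F (s, w))) (derive1 (fun s => f (F (s, w))) r).
  move=> df; have dv : is_derive ((0, val w) + r *: ((1, 0) : C)) ((1, 0) : C) (f \o cext F)
     ('D_((1, 0) : C) (f \o cext F) ((0, val w) + r *: ((1, 0) : C))).
    apply: derivableP; apply: diff_derivable.
    rewrite (_ : (0, val w) + _ = cpt (r, w))//.
    by rewrite -[LHS]/(0 + r * 1, val w + r *: (0 : V)) add0r mulr1 scaler0 addr0.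
  have [h _] := is_derive_line dv.
  have -> : (fun s => f (F (s, w))) = (fun t => (f \o cext F) ((0, val w) + t *: ((1, 0) : C))).
    apply/funext => s; rewrite -[_ + _]/(0 + s * 1, val w + s *: (0 : V)).
    by rewrite add0r mulr1 scaler0 addr0 /= cext_val.
  by rewrite derive1E; exact: derivableP.
by split; [have := H cRe dr|have := H cIm di]; rewrite /rd /radial_derive !derive1n1.
Qed.

Lemma FTC_dil (f f' : R -> R) r : (forall s : R, is_derive s 1 f (f' s)) -> continuous f' ->
  r * \int[leb]_(t in I01) f' (t * r) = f r - f 0.
Proof.
move=> df cf'.
have dh (t : R) : is_derive t 1 (fun t => f (t * r)) (r * f' (t * r)).
  have dl : is_derive t 1 (fun t => t * r) r.
    have := @is_deriveZ R R^o R^o id r t 1 1 (is_derive_id t 1).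
    rewrite -[_ *: 1]/(_ * 1) mulr1; congr (is_derive _ _ _ _).
    by apply/funext => s; rewrite -[LHS]/(r * s) mulrC.
  by have := @is_derive1_comp R f (fun t => t * r) t _ _ (df (t * r)) dl; rewrite mulrC.
have cmul : continuous (fun t : R => t * r).
  by apply: continuous_funM; [move=> t; exact: cvg_id|exact: cst_continuous].
have cg : continuous (fun t : R => f' (t * r)).
  by move=> t; apply: (continuous_comp (cmul t)); exact: cf'.
have ch : continuous (fun t : R => r * f' (t * r)).
  by apply: continuous_funM => //; exact: cst_continuous.
have ct (t : R) : {for t, continuous (fun t : R => f (t * r))}.
  by apply: differentiable_continuous; apply/derivable1_diffP; have [] := dh t.
have ig : leb.-integrable I01 (EFin \o (fun t : RT => f' (t * r))).
  apply: continuous_compact_integrable; first exact: segment_compact.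
  exact: continuous_subspaceT.
rewrite -RintegralZl// /Rintegral.
rewrite (@continuous_FTC2 R (fun t => r * f' (t * r)) (fun t => f (t * r)) 0 1)//=.
- by rewrite mul1r mul0r.
- exact: continuous_subspaceT.
- split.
  + by move=> t _; have [] := dh t.
  + by apply: cvg_at_right_filter; exact: ct.
  + by apply: cvg_at_left_filter; exact: ct.
- by move=> t _; rewrite derive1E; have [_ ->] := dh t.
Qed.

Lemma hadamard_mul K r w : smooth_cylinder K ->
  r%:C * hadamard K (r, w) = K (r, w) - K (0, w).
Proof.
move=> sK; have sK' := smooth_rd sK.
have cR : continuous (fun s => cRe (rd K (s, w))).
  move=> s; apply: differentiable_continuous; apply/derivable1_diffP.
  by have [[]] := is_derive_rd s w sK'.
have cI : continuous (fun s => cIm (rd K (s, w))).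
  move=> s; apply: differentiable_continuous; apply/derivable1_diffP.
  by have [_ []] := is_derive_rd s w sK'.
apply: complex_eq.
  rewrite Re_mulc /= mul0r subr0.
  rewrite (FTC_dil r (fun s => (is_derive_rd s w sK).1) cR).
  by case: (K (r, w)) (K (0, w)) => a b [].
rewrite Im_mulc /= mul0r addr0.
rewrite (FTC_dil r (fun s => (is_derive_rd s w sK).2) cI).
by case: (K (r, w)) (K (0, w)) => a b [].
Qed.

Definition rc : RS -> R[i] := fun q : RS => q.1%:C.

Lemma smooth_rc : smooth_cylinder rc.
Proof.
move=> q; exists setT, (fun p : C => p.1%:C); split => //; first exact: openT.
by apply: smooth_on_real; exact: Coo_fst.
Qed.

Lemma rd_rc (q : RS) : rd rc q = 1.
Proof.
case: q => r w; rewrite /rd /radial_derive !derive1n1 /rc /=.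
by rewrite derive1_id derive1_cst.
Qed.

Lemma fd_rc X (q : RS) : smooth_tangent_field X -> fd X rc q = 0.
Proof.
move=> tX; rewrite /fd /spherical_derive.
rewrite (@field_derive_ext _ _ X _ (fun=> q.1%:C)) ?dirderive_cst//; [exact: tX.1|exact: cdiff_cst].
Qed.

(** Leibniz's rule; at [r = 0] it reads the radial derivatives of [K] off those of [r K]. *)
Lemma radial_derive_rcM K l (q : RS) : smooth_cylinder K ->
  radial_derive l.+1 (fun q : RS => rc q * K q) q =
  rc q * radial_derive l.+1 K q + l.+1%:R * radial_derive l K q.
Proof.
move=> sK; have sR m : smooth_cylinder (radial_derive m K) by exact: smooth_radial_derive.
elim: l q => [|l IH] q.
  by rewrite -[LHS]/(rd _ q) rdM ?rd_rc//; [rewrite radial_derive0 addrC|exact: smooth_rc].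
rewrite radial_deriveS (_ : radial_derive l.+1 _ = fun q : RS => rc q * radial_derive l.+1 K q +
   (fun _ : S => l.+1%:R) q.2 * radial_derive l K q); last by apply/funext => p; rewrite IH.
have sc : smooth_cylinder (fun q : RS => (fun _ : S => l.+1%:R : R[i]) q.2) by exact: smooth_cylinder_cst.
rewrite rdD; [|by apply: smooth_cylinderM => //; exact: smooth_rc|exact: smooth_cylinderM].
rewrite rdM//; last exact: smooth_rc.
have -> : rd (fun q : RS => l.+1%:R * radial_derive l K q) q = l.+1%:R * radial_derive l.+1 K q.
  transitivity (rd (fun q : RS => (fun _ : S => l.+1%:R) q.2) q * radial_derive l K q +
    l.+1%:R * rd (radial_derive l K) q); first exact: (rdM q sc (sR l)).
  by rewrite (rd_sphere (fun _ : S => l.+1%:R)) mul0r add0r radial_deriveS.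
by rewrite rd_rc -!radial_deriveS -[l.+2%:R]natr1; ring.
Qed.

Lemma spherical_rcM D K : sphere_diffop D -> smooth_cylinder K ->
  spherical_derive D (fun q : RS => rc q * K q) = fun q : RS => rc q * spherical_derive D K q.
Proof.
move=> dD; elim: dD K => {D} [a sa|X tX|D1 D2 d1 IH1 d2 IH2|D1 D2 d1 IH1 d2 IH2] K sK;
  apply/funext => q.
- by rewrite /spherical_derive mulrCA.
- rewrite -[LHS]/(fd X (fun q : RS => rc q * K q) q) fdM//; last exact: smooth_rc.
  by rewrite fd_rc// mul0r add0r.
- rewrite -[LHS]/(spherical_derive D1 (fun q : RS => rc q * K q) q + spherical_derive D2 (fun q : RS => rc q * K q) q).
  by rewrite IH1// IH2// -mulrDr.
- rewrite -[LHS]/(spherical_derive D1 (spherical_derive D2 (fun q : RS => rc q * K q)) q).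
  by rewrite IH2// IH1//; exact: smooth_spherical.
Qed.

Lemma is_derive_scal1 (f : R^o -> R) (x v d : R^o) : is_derive x 1 f d -> is_derive x v f (v * d).
Proof.
move=> [df <-]; have dd : differentiable f x by apply/derivable1_diffP.
by rewrite -(derive_scal1 v dd); apply: derivableP; exact: diff_derivable.
Qed.

(** The function [s^(l+1) h s] vanishes at [0], so by the mean value theorem its value at [r] is
    [r (s r)^l f (s r)] for some [0 < s < 1]. Dividing by [r^(l+1)] leaves [h r = s^l f (s r)]. *)
Lemma real_quotient_bound (f h : R -> R) l r B :
  (forall s : R, is_derive s 1 (fun s => s ^+ l.+1 * h s) (s ^+ l * f s)) ->
  r != 0 -> (forall s, `|f s| <= B) -> `|h r| <= B.
Proof.
move=> dh r0 fB.
have ct (t : R) : {for t, continuous (fun s : R => s ^+ l.+1 * h s)}.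
  by apply: differentiable_continuous; apply/derivable1_diffP; have [] := dh t.
have [||s s01] := @MVT_line R R^o (fun s => s ^+ l.+1 * h s) 0 r
    (fun s => r * ((s *: (r : R^o)) ^+ l * f (s *: (r : R^o)))).
- by move=> s _; rewrite add0r; exact: (is_derive_scal1 r (dh _)).
- apply: continuous_subspaceT => s.
  apply: (@continuous_comp _ _ _ (fun s : R => 0 + s *: (r : R^o)) (fun s : R => s ^+ l.+1 * h s) s).
    apply: continuous_addf; first exact: cst_continuous.
    by apply: continuous_funM; [move=> t; exact: cvg_id|exact: cst_continuous].
  exact: ct.
rewrite add0r expr0n mul0r subr0 -[s *: _]/(s * r) exprS -mulrA => /(mulfI r0) E.
have rl : r ^+ l != 0 by rewrite expf_neq0.
have /(mulfI rl) -> : r ^+ l * h r = r ^+ l * (s ^+ l * f (s * r)).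
  by rewrite E exprMn mulrCA mulrA.
have s1 : `|s| <= 1.
  by move: s01; rewrite in_itv/= => /andP[a b]; rewrite ger0_norm ltW.
by rewrite normrM normrX (le_trans (ler_piMl (normr_ge0 _) _))// exprn_ile1.
Qed.

Lemma natr_real (m : nat) : (m%:R : R[i]) = (m%:R : R)%:C.
Proof. by rewrite rmorph_nat. Qed.

Lemma is_derive_expn (l : nat) (s : R) : is_derive s 1 (fun s => s ^+ l.+1) (l.+1%:R * s ^+ l).
Proof.
elim: l => [|l IH].
  by rewrite expr0 mulr1; exact: is_derive_id.
have := is_deriveM (is_derive_id s 1) IH.
rewrite -![_ *: _]/(_ * _) mulr1 mulrCA -exprS.
rewrite (_ : _ + _ = l.+2%:R * s ^+ l.+1); last by rewrite -[l.+2%:R]natr1; ring.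
by congr (is_derive _ _ _ _); apply/funext => t; rewrite [RHS]exprS.
Qed.

(* Since [K = r H], the derivative of [r^(l+1) H^(l)] is [r^l K^(l+1)]. *)
Lemma radial_quotient_bound H K l B : smooth_cylinder H -> (forall q : RS, K q = rc q * H q) ->
  (forall q : RS, normc (radial_derive l.+1 K q) <= B) ->
  forall q : RS, normc (radial_derive l H q) <= 2 * B.
Proof.
move=> sH KH KB [r w]; have B0 : 0 <= B := le_trans (normc_ge0 _) (KB (0, w)).
have E s : radial_derive l.+1 K (s, w) = s%:C * radial_derive l.+1 H (s, w) +
    (l.+1%:R : R)%:C * radial_derive l H (s, w).
  have -> : K = fun q : RS => rc q * H q by apply/funext.
  by rewrite radial_derive_rcM// natr_real.
(* At [r = 0] Leibniz's rule gives [(l + 1) H^(l) = K^(l+1)] at once. Elsewhere the factor [2] pays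
   for treating real and imaginary parts separately. *)
have [->|r0] := eqVneq r 0.
  have := KB (0, w); rewrite E mul0r add0r normcZr normr_nat => h.
  rewrite (le_trans _ (_ : B <= _))//; last by rewrite mulr2n mulrDl mul1r lerDl.
  by apply: le_trans h; rewrite ler_peMl ?normc_ge0// ler1n.
have sl := smooth_radial_derive l sH.
rewrite (le_trans (normc_le_ReIm _))// mulr2n mulrDl mul1r lerD//.
  apply: (@real_quotient_bound (fun s => cRe (radial_derive l.+1 K (s, w)))
    (fun s => cRe (radial_derive l H (s, w))) l r B) => //.
    move=> s; have [h _] := is_derive_rd s w sl.
    apply: is_derive_eq (is_deriveM (is_derive_expn l s) h) _.
    rewrite E -radial_deriveS Re_addc !Re_mulc /= !mul0r !subr0 -![_ *: _]/(_ * _).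
    by rewrite exprS; ring.
  by move=> s; rewrite (le_trans (Re_le_normc _)).
apply: (@real_quotient_bound (fun s => cIm (radial_derive l.+1 K (s, w)))
  (fun s => cIm (radial_derive l H (s, w))) l r B) => //.
  move=> s; have [_ h] := is_derive_rd s w sl.
  apply: is_derive_eq (is_deriveM (is_derive_expn l s) h) _.
  rewrite E -radial_deriveS Im_addc !Im_mulc /= !mul0r !addr0 -![_ *: _]/(_ * _).
  by rewrite exprS; ring.
by move=> s; rewrite (le_trans (Im_le_normc _)).
Qed.

(* For [1 <= |r|] use [r H^(l) = K^(l) - l H^(l-1)] and induction on [l]. *)
Lemma radial_quotient_decay k l : exists2 A : R, 0 <= A & forall H K B,
  smooth_cylinder H -> (forall q : RS, K q = rc q * H q) -> 0 <= B ->
  (forall m, (m <= l.+1)%N -> forall q : RS, (1 + q.1 ^+ 2) ^+ k * normc (radial_derive m K q) <= B) ->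
  forall q : RS, (1 + q.1 ^+ 2) ^+ k * normc (radial_derive l H q) <= A * B.
Proof.
have ge1 (r : R) : 1 <= (1 + r ^+ 2) ^+ k by rewrite exprn_ege1// lerDl sqr_ge0.
have drop (r c B : R) : 0 <= c -> (1 + r ^+ 2) ^+ k * c <= B -> c <= B.
  by move=> c0; apply: le_trans; rewrite ler_peMl.
elim: l => [|l [A A0 IH]].
  (* For [|r| <= 1] the weight is at most [2 ^+ k], and the other [2] is that of
     [radial_quotient_bound]; the [1] serves [|r| > 1], where [|H| <= |K|]. *)
  exists (2 ^+ k * 2 + 1); first by rewrite addr_ge0// mulr_ge0// exprn_ge0.
  move=> H K B sH KH B0 KB q.
  have hb := @radial_quotient_bound H K 0 B sH KH
    (fun q : RS => drop q.1 _ _ (normc_ge0 _) (KB 1%N isT q)) q.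
  have k0 : 0 <= (1 + q.1 ^+ 2) ^+ k by rewrite (le_trans ler01).
  have [r1|r1] := leP `|q.1| 1.
    apply: (@le_trans _ _ (2 ^+ k * 2 * B)); last by rewrite ler_wpM2r// lerDl.
    rewrite -mulrA; apply: ler_pM => //; first exact: normc_ge0.
    rewrite lerXn2r ?nnegrE ?addr_ge0 ?sqr_ge0// -[2]/(1 + 1) lerD2l.
    by rewrite -(real_normK (num_real _)) expr_le1.
  apply: (@le_trans _ _ B); last by rewrite ler_peMl// lerDr mulr_ge0// exprn_ge0.
  apply: le_trans (KB 0%N isT q); rewrite ler_wpM2l// !radial_derive0 KH /rc normcZr.
  by rewrite ler_peMl ?normc_ge0// ltW.
(* For [|r| > 1] the [1] accounts for the derivative of [K] of order [l + 1], and [l.+1%:R * A] for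
   the derivative of [H] of order [l]. *)
exists (2 ^+ k * 2 + (1 + l.+1%:R * A)).
  by rewrite addr_ge0// ?mulr_ge0 ?exprn_ge0// addr_ge0// mulr_ge0.
move=> H K B sH KH B0 KB q.
have hb := @radial_quotient_bound H K l.+1 B sH KH
  (fun q : RS => drop q.1 _ _ (normc_ge0 _) (KB l.+2 (leqnn _) q)) q.
have k0 : 0 <= (1 + q.1 ^+ 2) ^+ k by rewrite (le_trans ler01).
have lA0 : 0 <= 1 + l.+1%:R * A by rewrite addr_ge0// mulr_ge0.
have [r1|r1] := leP `|q.1| 1.
  apply: (@le_trans _ _ (2 ^+ k * 2 * B)); last by rewrite ler_wpM2r// lerDl.
  rewrite -mulrA; apply: ler_pM => //; first exact: normc_ge0.
  rewrite lerXn2r ?nnegrE ?addr_ge0 ?sqr_ge0// -[2]/(1 + 1) lerD2l.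
  by rewrite -(real_normK (num_real _)) expr_le1.
apply: (@le_trans _ _ ((1 + l.+1%:R * A) * B)).
  have h1 := KB l.+1 (leqnSn _) q.
  have h2 := IH H K B sH KH B0 (fun m ml => KB m (leqW ml)) q.
  rewrite mulrDl mul1r -mulrA.
  apply: le_trans (lerD h1 (ler_wpM2l (ler0n _ _) h2)).
  rewrite mulrCA -mulrDr ler_wpM2l//.
  apply: (@le_trans _ _ (`|q.1| * normc (radial_derive l.+1 H q))).
    by rewrite ler_peMl ?normc_ge0// ltW.
  rewrite -normcZr.
  have -> : q.1%:C * radial_derive l.+1 H q = radial_derive l.+1 K q +
      (- (l.+1%:R : R))%:C * radial_derive l H q.
    have {1}-> : K = fun q : RS => rc q * H q by apply/funext.
    by rewrite radial_derive_rcM// natr_real rmorphN/= mulNr addrK.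
  rewrite (le_trans (le_normcD _ _))// lerD2l normcZr normrN normr_nat//.
by rewrite ler_wpM2r// lerDr mulr_ge0// exprn_ge0.
Qed.

End hadamard_quotient.

Lemma mem_In (T : eqType) (x : T) (s : seq T) : x \in s -> List.In x s.
Proof.
by elim: s => // y s IH; rewrite in_cons => /orP[/eqP ->|/IH]; [left|right].
Qed.

Lemma Re_realM (R : realType) (a : R) (z : R[i]) : cRe (a%:C * z) = a * cRe z.
Proof. by rewrite Re_mulc /= mul0r subr0. Qed.

Lemma Im_realM (R : realType) (a : R) (z : R[i]) : cIm (a%:C * z) = a * cIm z.
Proof. by rewrite Im_mulc /= mul0r addr0. Qed.

Section cylinder_linearity.
Context {R : realType} {n : nat}.
Local Notation RS := (R * sphere R n)%type.
Implicit Types (F K : RS -> R[i]).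

Lemma radial_deriveD l F K q : smooth_cylinder F -> smooth_cylinder K ->
  radial_derive l (fun q => F q + K q) q = radial_derive l F q + radial_derive l K q.
Proof.
move=> sF sK; elim: l q => [|l IH] q; first by rewrite !radial_derive0.
rewrite !radial_deriveS -rdD; try exact: smooth_radial_derive.
by congr (rd _ q); apply/funext => p; exact: IH.
Qed.

Lemma radial_derive_sphereM l (u : sphere R n -> R[i]) F q :
  smooth_cylinder (fun q => u q.2) -> smooth_cylinder F ->
  radial_derive l (fun q => u q.2 * F q) q = u q.2 * radial_derive l F q.
Proof.
move=> su sF; elim: l q => [|l IH] q; first by rewrite !radial_derive0.
rewrite !radial_deriveS (_ : radial_derive l _ = fun q => u q.2 * radial_derive l F q).
  by rewrite rdM ?rd_sphere ?mul0r ?add0r//; exact: smooth_radial_derive.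
by apply/funext => p; exact: IH.
Qed.

Lemma spherical_deriveD D F K : sphere_diffop D -> smooth_cylinder F -> smooth_cylinder K ->
  spherical_derive D (fun q => F q + K q) =
  fun q => spherical_derive D F q + spherical_derive D K q.
Proof.
move=> dD; elim: dD F K => {D} [a sa|X tX|D1 D2 d1 IH1 d2 IH2|D1 D2 d1 IH1 d2 IH2] F K sF sK;
  apply/funext => q.
- by rewrite /spherical_derive mulrDr.
- by rewrite -[LHS]/(fd X (fun q => F q + K q) q) fdD.
- rewrite -[LHS]/(spherical_derive D1 (fun q => F q + K q) q + spherical_derive D2 (fun q => F q + K q) q).
  by rewrite IH1// IH2// addrACA.
- rewrite -[LHS]/(spherical_derive D1 (spherical_derive D2 (fun q => F q + K q)) q).
  by rewrite IH2// IH1//; exact: smooth_spherical.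
Qed.

Lemma sphere_diffop1 : @sphere_diffop R n (fun u w => 1 * u w).
Proof.
by apply: diffop_mul; apply: (@smooth_sphere_val R n (fun=> 1)); exact: smooth_on_cst.
Qed.

Definition diffop1 : {D : (sphere R n -> R[i]) -> sphere R n -> R[i] | sphere_diffop D} :=
  exist _ _ sphere_diffop1.

Lemma schwartzH_weightE k l D (dD : sphere_diffop D) F q :
  schwartzH_weight (k, l, exist _ D dD) F q =
  (1 + q.1 ^+ 2) ^+ k * normc (radial_derive l (spherical_derive D F) q).
Proof. by []. Qed.

Lemma schwartzH_weight1 k l F q :
  schwartzH_weight (k, l, diffop1) F q = (1 + q.1 ^+ 2) ^+ k * normc (radial_derive l F q).
Proof.
rewrite /schwartzH_weight /=; congr (_ * normc (radial_derive l _ q)).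
by apply/funext => -[r w]; rewrite /spherical_derive mul1r.
Qed.

Lemma schwartzH_bounds F : is_schwartzH F -> forall i, exists B, forall q, schwartzH_weight i F q <= B.
Proof. by move=> [_ _ _ b] i; have [B HB] := b i; exists B => q; apply: HB; exists q. Qed.

End cylinder_linearity.

(** * From the cylinder to the Schwartz space *)

Section unpolar.
Context {R : realType} {n : nat}.
Local Notation V := 'rV[R]_n.
Local Notation S := (sphere R n).
Local Notation C := (R * V)%type.
Local Notation RS := (R * S)%type.
Local Notation sw := (@schwartz_weight R n).
Local Notation hw := (@schwartzH_weight R n).
Variable w0 : S.
Implicit Types (x : V) (w : S) (F K : RS -> R[i]) (j : 'I_n).

(** [dir 0] is not on the sphere, so the origin gets the default direction [w0]. On the cylinder
    space [F (0, _)] is constant, and [unpolar F 0] does not depend on this choice. *)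
Definition proj x : S := insubd w0 (dir x).

Lemma projE x (x0 : x != 0) : proj x = sph x0.
Proof. by apply/val_inj; rewrite /proj val_insubd (dirP x0). Qed.

Definition unpolar F : V -> R[i] := fun x => F (nrm x, proj x).

Lemma nrm0 : nrm (0 : V) = 0.
Proof. by rewrite -(scale0r (0 : V)) nrmZ normr0 mul0r. Qed.

Lemma cpoint_polar x : cpoint (nrm x, proj x) = x.
Proof.
have [->|x0] := eqVneq x 0; first by rewrite /cpoint /= nrm0 scale0r.
rewrite /cpoint /= (projE x0) /= /dir scalerA divff ?scale1r//.
by rewrite gt_eqF// nrm_gt0.
Qed.

Lemma cpoint_neq0 (q : RS) : q.1 != 0 -> cpoint q != 0.
Proof. by move=> r0; rewrite scaler_eq0 negb_or r0 sphere_neq0. Qed.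

Lemma unpolar_cext F x : x != 0 -> unpolar F x = cext F (nrm x, x).
Proof. by move=> x0; rewrite /unpolar (projE x0) (cextE _ (q := (nrm x, x)) x0). Qed.

Lemma unpolar_polar g : unpolar (polar g) = g.
Proof. by apply/funext => x; rewrite /unpolar /polar cpoint_polar. Qed.

Lemma schwartzH_hpoly F k : is_schwartzH F ->
  exists2 p, hpoly k p & forall w, radial_derive k F (0, w) = p (val w).
Proof.
move=> [_ _ H _]; have [P hP PE] := H k.
by exists (fun x => meval (fun j => (x 0 j)%:C) P); [exact: mpoly_hpoly|].
Qed.

Lemma schwartzH_cst F : is_schwartzH F -> exists c, forall w, F (0, w) = c.
Proof.
move=> SF; have [p /hpoly0_cst[c pc] Fp] := schwartzH_hpoly 0 SF.
by exists c => w; have := Fp w; rewrite radial_derive0 pc.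
Qed.

(** [unpolar] only looks at radii [r >= 0]: evenness recovers the values at [r < 0], and the
    homogeneity condition in degree zero those at [r = 0]. *)
Lemma polar_unpolar F : is_schwartzH F -> polar (unpolar F) = F.
Proof.
move=> SF; have [c Fc] := schwartzH_cst SF; have [_ Fe _ _] := SF.
apply/funext => -[r w]; rewrite /polar /unpolar /cpoint /=.
have [->|r0] := eqVneq r 0; first by rewrite scale0r nrm0 !Fc.
have rw0 := @cpoint_neq0 (r, w) r0; rewrite (projE rw0) nrmZ nrm_sphere mulr1.
have [rpos|rneg] := ltP 0 r.
  rewrite gtr0_norm//; congr (F (r, _)); apply/val_inj => /=.
  by rewrite /dir nrmZ nrm_sphere mulr1 gtr0_norm// scalerA mulVf// scale1r.
rewrite ler0_norm// Fe opprK; congr (F (r, _)); apply/val_inj => /=.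
rewrite /dir nrmZ nrm_sphere mulr1 ler0_norm// scalerA invrN mulNr mulVf//.
by rewrite scaleN1r opprK.
Qed.

Lemma smooth_unpolar F : smooth_cylinder F -> smooth_on [set x : V | x != 0] (unpolar F).
Proof.
move=> /smooth_cylinderP sF.
apply: (@smooth_on_eq _ _ _ (fun x => cext F (nrm x, x))); first exact: open_neq0.
  by move=> x x0; rewrite unpolar_cext.
apply: (@smooth_on_pair _ _ _ _ CV0 (@nrm R n) id) => //; first exact: open_neq0.
  by apply: Coo_nrm => //; [exact: open_neq0|move=> j; exact: Coo_coord].
by move=> j; exact: Coo_coord.
Qed.

(* The tangential part of the [j]-th coordinate field: in polar coordinates
   [d/dx_j = w_j d/dr + r^-1 X_j]. *)
Definition tangent_coord j w : V := delta_mx 0 j - (val w : V) 0 j *: val w.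

Lemma smooth_sphere_coord j : smooth_sphere (fun w : S => ((val w : V) 0 j)%:C).
Proof. exact: (smooth_sphere_val (smooth_coord j)). Qed.

Lemma tangent_coord_field j : smooth_tangent_field (tangent_coord j).
Proof.
split.
  move=> w; rewrite /tangent_coord dotpDl dotpC dotp_delta -scaleNr dotpZl sphere_dotp.
  by rewrite mulr1 subrr.
move=> i; have -> : (fun w => (tangent_coord j w 0 i)%:C) =
    (fun w : S => (fun x : V => ((delta_mx 0 j : V) 0 i - x 0 j * x 0 i)%:C) (val w)).
  by apply/funext => w; rewrite /tangent_coord !mxE.
apply: (@smooth_sphere_val R n (fun x : V => ((delta_mx 0 j : V) 0 i - x 0 j * x 0 i)%:C)).
apply: smooth_on_real => k.
apply: CkB; [exact: openT|exact: Ck_cst|].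
by apply: CkM; [exact: openT|exact: Coo_coord|exact: Coo_coord].
Qed.

(* The partial derivative [d/dx_j] in polar coordinates, extended to [r = 0]. *)
Definition coord_derive j F : RS -> R[i] := fun q =>
  ((val q.2 : V) 0 j)%:C * rd F q + hadamard (fd (tangent_coord j) F) q.

Lemma fd_origin X F w : is_schwartzH F -> smooth_tangent_field X -> fd X F (0, w) = 0.
Proof.
move=> SF tX; have [c Fc] := schwartzH_cst SF; rewrite /fd /spherical_derive /=.
by rewrite (@field_derive_ext _ _ X _ (fun=> c)) ?dirderive_cst//; [exact: tX.1|exact: cdiff_cst].
Qed.

Lemma smooth_schwartzH F : is_schwartzH F -> smooth_cylinder F. Proof. by case. Qed.

Lemma smooth_fd_coord j F : is_schwartzH F -> smooth_cylinder (fd (tangent_coord j) F).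
Proof. by move=> SF; apply: smooth_fd; [exact: tangent_coord_field|exact: smooth_schwartzH]. Qed.

Lemma hadamard_fd j F (q : RS) : is_schwartzH F ->
  fd (tangent_coord j) F q = rc q * hadamard (fd (tangent_coord j) F) q.
Proof.
case: q => r w SF; rewrite /rc /= hadamard_mul; last exact: smooth_fd_coord.
by rewrite (fd_origin w SF (tangent_coord_field j)) subr0.
Qed.

Lemma dirderiveDv (u v : V) (h : V -> R[i]) x : cdiff h x ->
  dirderive (u + v) h x = dirderive u h x + dirderive v h x.
Proof.
move=> dh; have := dirderive_lin [:: u; v] (fun=> 1) id dh.
by rewrite !big_cons !big_nil !scale1r !mul1r !addr0.
Qed.

Lemma dirderive_tangent j w (h : V -> R[i]) x : cdiff h x ->
  dirderive (delta_mx 0 j) h x =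
  ((val w : V) 0 j)%:C * dirderive (val w) h x + dirderive (tangent_coord j w) h x.
Proof.
move=> dh.
have <- := @dirderive_scale R n ((val w : V) 0 j) (val w) h x dh.
have <- := @dirderiveDv ((val w : V) 0 j *: val w) (tangent_coord j w) h x dh.
apply: (f_equal (fun v : V => dirderive v h x)).
by rewrite /tangent_coord addrC subrK.
Qed.

Lemma smooth_coord_derive j F : is_schwartzH F -> smooth_cylinder (coord_derive j F).
Proof.
move=> SF; apply: smooth_cylinderD; last by apply: smooth_hadamard; exact: smooth_fd_coord.
apply: smooth_cylinderM; first exact: smooth_cyl_coord.
by apply: smooth_rd; exact: smooth_schwartzH.
Qed.

Lemma unpolar_cdiff_neq0 F x : is_schwartzH F -> x != 0 -> cdiff (unpolar F) x.
Proof. by move=> SF x0; exact: (smooth_on_cdiff (smooth_unpolar (smooth_schwartzH SF)) x0). Qed.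

Lemma coord_derive_polar j F (q : RS) : is_schwartzH F -> q.1 != 0 ->
  coord_derive j F q = dirderive (delta_mx 0 j) (unpolar F) (cpoint q).
Proof.
move=> SF r0; have dg := unpolar_cdiff_neq0 SF (cpoint_neq0 r0).
have FE := polar_unpolar SF.
have E1 : rd F q = dirderive (val q.2) (unpolar F) (cpoint q) by rewrite -rd_polar FE.
have E2 : fd (tangent_coord j) F q = q.1%:C * dirderive (tangent_coord j q.2) (unpolar F) (cpoint q).
  by rewrite -fd_polar ?FE//; exact: (tangent_coord_field j).1.
have r0' : q.1%:C != 0 :> R[i] by rewrite (inj_eq (@complexI R)).
have -> : coord_derive j F q = ((val q.2 : V) 0 j)%:C * dirderive (val q.2) (unpolar F) (cpoint q) +
    dirderive (tangent_coord j q.2) (unpolar F) (cpoint q).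
  rewrite /coord_derive E1; congr (_ + _); apply: (mulfI r0').
  by rewrite -E2 (hadamard_fd j q SF).
by rewrite (dirderive_tangent j q.2 dg).
Qed.

(* If [p] is the coefficient of degree [k+1] of [F], then [k+1] times that of
   degree [k] of the Hadamard quotient is [X_j p = d_j p - w_j (k+1) p] on the
   sphere, by Euler's identity. *)
Lemma coord_derive_hpoly j F k : is_schwartzH F ->
  exists2 p, hpoly k p & forall w, radial_derive k (coord_derive j F) (0, w) = p (val w).
Proof.
move=> SF; have [p hp pE] := schwartzH_hpoly k.+1 SF.
have k1 : (k.+1%:R : R[i]) != 0 by rewrite pnatr_eq0.
exists (fun x => k.+1%:R^-1 * dirderive (delta_mx 0 j) p x).
  by apply: hpoly_scale; exact: hpoly_dirderive.
move=> w; have sF := smooth_schwartzH SF; have sK := smooth_fd_coord j SF.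
have sH := smooth_hadamard sK; have tX := tangent_coord_field j.
have dp := hpoly_cdiff (val w) hp.
rewrite radial_deriveD//; last first.
  by apply: smooth_cylinderM; [exact: smooth_cyl_coord|exact: smooth_rd].
rewrite (@radial_derive_sphereM _ _ k (fun w : S => ((val w : V) 0 j)%:C) (rd F))//; last first.
- exact: smooth_rd.
- exact: smooth_cyl_coord.
rewrite -radial_deriveSr pE.
have E : k.+1%:R * radial_derive k (hadamard (fd (tangent_coord j) F)) (0, w) =
    dirderive (tangent_coord j w) p (val w).
  have h := radial_derive_rcM k (0, w) sH.
  rewrite /rc /= mul0r add0r in h; rewrite -h.
  rewrite (_ : (fun q => _) = fd (tangent_coord j) F); last first.
    by apply/funext => q; rewrite [RHS](hadamard_fd j q SF).
  rewrite (radial_derive_spherical k.+1 (diffop_field tX) sF).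
  by rewrite /spherical_derive /= (@field_derive_ext _ _ _ _ p)//; exact: tX.1.
apply: (mulfI k1); rewrite mulrDr E [RHS]mulrA mulfV// mul1r.
by rewrite (dirderive_tangent j w dp) (hpoly_euler _ hp); ring.
Qed.

Lemma coord_derive_schwartzH_bounded j : bounded_op (@is_schwartzH R n) hw hw (coord_derive j).
Proof.
have b1 : bounded_op (@is_schwartzH R n) hw hw (fun F q => ((val q.2 : V) 0 j)%:C * rd F q).
  move=> [[k l] [D dD]].
  (* Multiplication by [w_j] is itself a differential operator on the sphere, so this term is
     bounded by a single seminorm, of radial order [l + 1]. *)
  have dD' := diffop_comp dD (diffop_mul (smooth_sphere_coord j)).
  exists [:: ((k, l.+1), exist _ _ dD')], 1; split => // F B SF B0 FB q.
  rewrite mul1r; have := FB _ (or_introl erefl) q; rewrite !schwartzH_weightE.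
  have -> // : radial_derive l.+1 (spherical_derive (fun u => D (fun w => ((val w : V) 0 j)%:C * u w)) F) q =
    radial_derive l (spherical_derive D (fun q => ((val q.2 : V) 0 j)%:C * rd F q)) q.
  rewrite (radial_derive_spherical l.+1 dD' (smooth_schwartzH SF)) radial_deriveSr.
  rewrite -(radial_derive_spherical l dD' (smooth_rd (smooth_schwartzH SF))).
  by congr (radial_derive l _ q); apply/funext => -[].
have b2 : bounded_op (@is_schwartzH R n) hw hw (fun F => hadamard (fd (tangent_coord j) F)).
  move=> [[k l] [D dD]]; have [A A0 HA] := @radial_quotient_decay R n k l.
  have dD' := diffop_comp dD (diffop_field (tangent_coord_field j)).
  (* [radial_quotient_decay] uses all radial orders [m <= l + 1] of the undivided function, hence
     [l.+2] indices. *)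
  exists [seq ((k, m), exist _ _ dD') | m <- iota 0 l.+2], A; split => // F B SF B0 FB q.
  have sH := smooth_hadamard (smooth_fd_coord j SF).
  (* [D] commutes with multiplication by [r], so [D] of the quotient is the quotient of
     [D (fd (tangent_coord j) F)]. *)
  apply: (HA _ (spherical_derive D (fd (tangent_coord j) F))) => //.
  - exact: smooth_spherical.
  - move=> p; rewrite -[RHS]/((fun q : RS => rc q * spherical_derive D _ q) p).
    rewrite -spherical_rcM//; congr (spherical_derive D _ p).
    by apply/funext => p'; rewrite {1}(hadamard_fd j p' SF).
  - move=> m ml p.
    have mi : List.In m (iota 0 l.+2) by apply: mem_In; rewrite mem_iota.
    apply: (FB ((k, m), exist _ _ dD')).
    exact: (List.in_map (fun m => (k, m, exist (@sphere_diffop R n) _ dD')) _ _ mi).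
apply: (bounded_op_add b1 b2) => -[[k l] [D dD]] F q SF; rewrite !schwartzH_weightE.
have sH := smooth_hadamard (smooth_fd_coord j SF).
have sM : smooth_cylinder (fun q : RS => ((val q.2 : V) 0 j)%:C * rd F q).
  apply: smooth_cylinderM; first exact: smooth_cyl_coord.
  by apply: smooth_rd; exact: smooth_schwartzH.
rewrite spherical_deriveD// radial_deriveD; [|exact: smooth_spherical|exact: smooth_spherical].
by rewrite -mulrDr ler_wpM2l ?le_normcD// exprn_ge0// addr_ge0// sqr_ge0.
Qed.

Lemma coord_derive_schwartzH j F : is_schwartzH F -> is_schwartzH (coord_derive j F).
Proof.
move=> SF; split.
- exact: smooth_coord_derive.
(* At [r = 0] the coefficient of degree zero is constant. Elsewhere both sides are the same partial
   derivative of [unpolar F], at the common point [r w]. *)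
- move=> r w; have [->|r0] := eqVneq r 0.
    have [p /hpoly0_cst[c pc] Fp] := coord_derive_hpoly j 0 SF.
    by have := Fp w; have := Fp (sphere_opp w); rewrite oppr0 !radial_derive0 pc => -> ->.
  have r0' : - r != 0 by rewrite oppr_eq0.
  rewrite (@coord_derive_polar j F (r, w) SF r0) (@coord_derive_polar j F (- r, sphere_opp w) SF r0').
  apply: (f_equal (dirderive (delta_mx 0 j : V) (unpolar F))).
  by rewrite /cpoint /= scaleNr scalerN opprK.
- move=> k; have [p hp pE] := coord_derive_hpoly j k SF.
  have [P hP PE] := hpoly_mpoly hp; exists P => // w.
  by rewrite pE PE.
- move=> i; have [B HB] := bounded_op_bounds (coord_derive_schwartzH_bounded j) SF (schwartzH_bounds SF) i.
  by exists B => _ [q _ <-].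
Qed.

Lemma coord_derive_unpolar j F x : is_schwartzH F -> x != 0 ->
  dirderive (delta_mx 0 j) (unpolar F) x = unpolar (coord_derive j F) x.
Proof.
move=> SF x0; rewrite /unpolar [RHS]coord_derive_polar//=; last by rewrite gt_eqF// nrm_gt0.
by rewrite cpoint_polar.
Qed.

Lemma real_lipschitz_radial (f f' : R -> R) M : (forall s : R, is_derive s 1 f (f' s)) ->
  (forall s, `|f' s| <= M) -> forall r, `|f r - f 0| <= M * `|r|.
Proof.
move=> df f'M r.
have ct (t : R) : {for t, continuous f}.
  by apply: differentiable_continuous; apply/derivable1_diffP; have [] := df t.
have [||s s01] := @MVT_line R R^o f 0 r (fun s => r * f' (s *: (r : R^o))).
- by move=> s _; rewrite add0r; exact: (is_derive_scal1 r (df _)).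
- apply: continuous_subspaceT => s.
  apply: (@continuous_comp _ _ _ (fun s : R => 0 + s *: (r : R^o)) f s); last exact: ct.
  apply: continuous_addf; first exact: cst_continuous.
  by apply: continuous_funM; [move=> t; exact: cvg_id|exact: cst_continuous].
by rewrite add0r => ->; rewrite normrM mulrC ler_wpM2r.
Qed.

(** The radial derivative is bounded along each ray from the origin, and constancy of [F (0, _)]
    makes all rays start from the same value. *)
Lemma unpolar_lipschitz0 F : is_schwartzH F ->
  exists2 M, 0 <= M & forall x, normc (unpolar F x - unpolar F 0) <= M * nrm x.
Proof.
move=> SF; have [c Fc] := schwartzH_cst SF; have sF := smooth_schwartzH SF.
have [B HB] := schwartzH_bounds SF (0%N, 1%N, diffop1).
have rB q : normc (rd F q) <= `|B|.
  by have := HB q; rewrite schwartzH_weight1 expr0 mul1r => /le_trans; apply; exact: ler_norm.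
exists (`|B| + `|B|); first exact: addr_ge0.
move=> x; have -> : unpolar F 0 = F (0, proj x) by rewrite /unpolar nrm0 !Fc.
rewrite /unpolar -[X in _ * X]ger0_norm ?nrm_ge0// mulrDl.
move: (nrm x) (proj x) => r w.
rewrite (le_trans (normc_le_ReIm _))// lerD//.
  have -> : cRe (F (r, w) - F (0, w)) = cRe (F (r, w)) - cRe (F (0, w)).
    by case: (F (r, w)) (F (0, w)) => a b [].
  apply: real_lipschitz_radial (fun s => (is_derive_rd s w sF).1) _ r => s.
  by rewrite (le_trans (Re_le_normc _)).
have -> : cIm (F (r, w) - F (0, w)) = cIm (F (r, w)) - cIm (F (0, w)).
  by case: (F (r, w)) (F (0, w)) => a b [].
apply: real_lipschitz_radial (fun s => (is_derive_rd s w sF).2) _ r => s.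
by rewrite (le_trans (Im_le_normc _)).
Qed.

Lemma continuous_nrm0 : nrm x @[x --> (0 : V)] --> (0 : R).
Proof.
rewrite -nrm0; apply: (@continuous_comp _ _ _ (fun x : V => dotp x x) (@Num.sqrt R) 0).
  apply: differentiable_continuous; apply: (@Coo_differentiable _ _ setT _ _ I) => l.
  by apply: Ck_sum => [|j]; [exact: openT|apply: CkM; [exact: openT|exact: Coo_coord|exact: Coo_coord]].
exact: sqrt_continuous.
Qed.

Lemma unpolar_near0 F e : is_schwartzH F -> 0 < e ->
  \forall x \near (0 : V), normc (unpolar F x - unpolar F 0) <= e.
Proof.
move=> SF e0; have [M M0 HM] := unpolar_lipschitz0 SF.
have eM : 0 < e / (M + 1) by rewrite divr_gt0// ltr_wpDl.
have /cvgrPdist_le/(_ _ eM) := continuous_nrm0; apply: filterS => x.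
rewrite sub0r normrN ger0_norm ?nrm_ge0// ler_pdivlMr ?ltr_wpDl// mulrC => h.
apply: le_trans (HM x) (le_trans _ h); rewrite ler_wpM2r ?nrm_ge0//.
by rewrite lerDl.
Qed.

Lemma dotp_diff_le (a b v : V) e : 0 < e ->
  (forall j, `|a 0 j - b 0 j| <= e / n.+1%:R) -> `|dotp a v - dotp b v| <= e * `|v|.
Proof.
move=> e0 ab; rewrite /dotp -sumrB (le_trans (ler_norm_sum _ _ _))//.
apply: (@le_trans _ _ (\sum_(j < n) e / n.+1%:R * `|v|)).
  apply: ler_sum => j _; rewrite -mulrBl normrM; apply: ler_pM => //; exact: row_coord_le.
rewrite -mulr_suml ler_wpM2r// sumr_const card_ord -[X in X <= _]mulr_natr.
by rewrite mulrAC ler_pdivrMr// ler_pM2l// ler_nat.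
Qed.

(* [unpolar F] is not yet known to be smooth at the origin: its partial
   derivatives elsewhere extend continuously there. *)
Lemma unpolar_cdiff0 (pr : R[i] -> R) F :
  (forall z, `|pr z| <= normc z) -> (forall y z, pr (y - z) = pr y - pr z) ->
  (forall x v, x != 0 -> is_derive x v (pr \o unpolar F)
     (\sum_j v 0 j * pr (unpolar (coord_derive j F) x))) -> is_schwartzH F ->
  differentiable (pr \o unpolar F) (0 : V) /\
  forall v, 'D_v (pr \o unpolar F) (0 : V) = \sum_j v 0 j * pr (unpolar (coord_derive j F) 0).
Proof.
move=> pr_le prB dF SF.
have [c cj] : exists c : V -> V, forall x j, c x 0 j = pr (unpolar (coord_derive j F) x).
  by exists (fun x => \row_j pr (unpolar (coord_derive j F) x)) => x j; rewrite mxE.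
have cE x v : dotp (c x) v = \sum_j v 0 j * pr (unpolar (coord_derive j F) x).
  by apply: eq_bigr => j _; rewrite cj mulrC.
pose L : {linear V -> R} := HB.pack (dotp (c 0) : V -> R)
  (GRing.isLinear.Build _ _ _ _ _ (dotp_linear_proof (c 0))).
have near0 K e : is_schwartzH K -> 0 < e ->
    \forall x \near (0 : V), `|pr (unpolar K x) - pr (unpolar K 0)| <= e.
  move=> SK e0; apply: filterS (unpolar_near0 SK e0) => x; rewrite -prB.
  by apply: le_trans.
have [|||||df dE] := @differentiable_of_derive R V (pr \o unpolar F) 0 (fun x v => dotp (c x) v) L.
- by [].
- exact: continuous_dotp.
- have cF : (pr \o unpolar F) x @[x --> (0 : V)] --> pr (unpolar F 0).
    have FF : Filter (nbhs (0 : V)) := nbhs_filter (0 : V).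
    apply/(@cvgrPdist_le _ _ _ _ FF) => e e0; apply: filterS (near0 F e SF e0) => x.
    by rewrite distrC.
  exact: cF.
- apply: (@filterS _ (nbhs (0 : V)) (nbhs_filter (0 : V)) setT) => [x _ x0 v|].
    by rewrite cE; exact: dF.
  exact: (@filterT _ (nbhs (0 : V)) (nbhs_filter (0 : V))).
- move=> e e0; have en : 0 < e / n.+1%:R by rewrite divr_gt0.
  have Hn := filter_forall (nbhs_filter (0 : V)) (fun j => near0 _ _ (coord_derive_schwartzH j SF) en).
  apply: (@filterS _ (nbhs (0 : V)) (nbhs_filter (0 : V)) _ _ _ Hn) => x Hx v.
  have h j : `|c x 0 j - c 0 0 j| <= e / n.+1%:R.
    rewrite (cj x) (cj 0).
    exact: (Hx j).
  exact: (@dotp_diff_le (c x) (c 0) v e e0 h).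
split => // v; rewrite deriveE//.
by rewrite -[LHS]/(('d (pr \o unpolar F) 0 : V -> R) v) dE cE.
Qed.

Lemma unpolar_dirderive F x : is_schwartzH F ->
  cdiff (unpolar F) x /\
  forall v, dirderive v (unpolar F) x = \sum_j (v 0 j)%:C * unpolar (coord_derive j F) x.
Proof.
move=> SF.
have H y v : y != 0 -> dirderive v (unpolar F) y =
    \sum_j (v 0 j)%:C * unpolar (coord_derive j F) y.
  move=> y0; rewrite dirderive_coord_sum; last exact: unpolar_cdiff_neq0.
  by apply: eq_bigr => j _; rewrite coord_derive_unpolar.
have [->|x0] := eqVneq x 0; last by split; [exact: unpolar_cdiff_neq0|move=> v; exact: H].
have DR y v : y != 0 -> is_derive y v (cRe \o unpolar F)
    (\sum_j v 0 j * cRe (unpolar (coord_derive j F) y)).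
  move=> y0; have [dy _] := unpolar_cdiff_neq0 SF y0.
  apply: is_derive_eq; first by apply: derivableP; exact: diff_derivable.
  rewrite -[LHS]/(cRe (dirderive v (unpolar F) y)) H// Re_sum.
  by apply: eq_bigr => j _; rewrite Re_realM.
have DI y v : y != 0 -> is_derive y v (cIm \o unpolar F)
    (\sum_j v 0 j * cIm (unpolar (coord_derive j F) y)).
  move=> y0; have [_ dy] := unpolar_cdiff_neq0 SF y0.
  apply: is_derive_eq; first by apply: derivableP; exact: diff_derivable.
  rewrite -[LHS]/(cIm (dirderive v (unpolar F) y)) H// Im_sum.
  by apply: eq_bigr => j _; rewrite Im_realM.
have ReB (y z : R[i]) : cRe (y - z) = cRe y - cRe z by case: y z => a b [].
have ImB (y z : R[i]) : cIm (y - z) = cIm y - cIm z by case: y z => a b [].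
have [dr Er] := unpolar_cdiff0 (@Re_le_normc R) ReB DR SF.
have [di Ei] := unpolar_cdiff0 (@Im_le_normc R) ImB DI SF.
split => // v; apply: complex_eq.
  rewrite [LHS]Er Re_sum; apply: eq_bigr => j _.
  by rewrite Re_realM.
rewrite [LHS]Ei Im_sum; apply: eq_bigr => j _.
by rewrite Im_realM.
Qed.

Lemma unpolar_smooth F : is_schwartzH F -> smooth_on setT (unpolar F).
Proof.
move=> SF; apply/smooth_onP.
suff H k : forall F, is_schwartzH F -> Ck k setT (cRe \o unpolar F) /\
    Ck k setT (cIm \o unpolar F) by split => k; have [] := H k F SF.
elim: k => [|k IH] {}F {}SF.
  by do 2 split => //; move=> x _; have [[]] := unpolar_dirderive x SF.
have SD j := coord_derive_schwartzH j SF.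
split; (split; first by move=> x _; have [[]] := unpolar_dirderive x SF) => v.
  apply: (@Ck_eq _ _ _ _ (fun x => \sum_j v 0 j * (cRe \o unpolar (coord_derive j F)) x)).
  - exact: openT.
  - move=> x _; rewrite -[RHS]/(cRe (dirderive v (unpolar F) x)).
    rewrite (unpolar_dirderive x SF).2 Re_sum.
    by apply: eq_bigr => j _; rewrite Re_realM.
  - apply: Ck_sum => [|j]; first exact: openT.
    by apply: CkZ; [exact: openT|exact: (IH _ (SD j)).1].
apply: (@Ck_eq _ _ _ _ (fun x => \sum_j v 0 j * (cIm \o unpolar (coord_derive j F)) x)).
- exact: openT.
- move=> x _; rewrite -[RHS]/(cIm (dirderive v (unpolar F) x)).
  rewrite (unpolar_dirderive x SF).2 Im_sum.
  by apply: eq_bigr => j _; rewrite Im_realM.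
- apply: Ck_sum => [|j]; first exact: openT.
  by apply: CkZ; [exact: openT|exact: (IH _ (SD j)).2].
Qed.

Lemma iter_coord_derive_schwartzH s F : is_schwartzH F ->
  is_schwartzH (foldr coord_derive F s).
Proof. by move=> SF; elim: s => [|j s IH]; [exact: SF|exact: (coord_derive_schwartzH j IH)]. Qed.

Lemma iter_coord_derive_bounded s :
  bounded_op (@is_schwartzH R n) hw hw (fun F => foldr coord_derive F s).
Proof.
elim: s => [|j s IH].
  move=> i; exists [:: i], 1; split => // F B _ _ FB q.
  by rewrite mul1r; apply: FB; left.
apply: (bounded_op_comp (S2 := @is_schwartzH R n) _ IH (coord_derive_schwartzH_bounded j)).
by move=> F; exact: iter_coord_derive_schwartzH.
Qed.

Lemma partial_unpolar s F : is_schwartzH F ->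
  partial s (unpolar F) = unpolar (foldr coord_derive F s).
Proof.
move=> SF; elim: s => // j s IH; rewrite /partial /= -/(partial s _) IH.
apply/funext => x; rewrite (unpolar_dirderive x (iter_coord_derive_schwartzH s SF)).2.
rewrite (bigD1 j)//= mxE !eqxx mul1r big1 ?addr0// => i ij.
by rewrite mxE (negbTE ij) andbF mul0r.
Qed.

(** Each factor obeys [|x_j| <= |x| <= 1 + |x|^2], so the total degree is a sufficient exponent. *)
Lemma prod_coord_le (a : 'I_n -> nat) x :
  `|\prod_j x 0 j ^+ a j| <= (1 + nrm x ^+ 2) ^+ (\sum_j a j)%N.
Proof.
have h : nrm x <= 1 + nrm x ^+ 2.
  rewrite -subr_ge0 (_ : _ - _ = (nrm x - 2^-1) ^+ 2 + 3 / 4); last by field.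
  by rewrite addr_ge0// sqr_ge0.
rewrite normr_prod expr_sum; apply: ler_prod => j _; rewrite normr_ge0 normrX/=.
by rewrite lerXn2r// ?nnegrE ?addr_ge0 ?sqr_ge0// (le_trans (coord_le_nrm x j)).
Qed.

Lemma unpolar_bounded : bounded_op (@is_schwartzH R n) hw sw unpolar.
Proof.
move=> [a s]; have [J [A [A0 H]]] := iter_coord_derive_bounded s ((\sum_j a j)%N, 0%N, diffop1).
exists J, A; split => // F B SF B0 FB x.
have := H F B SF B0 FB (nrm x, proj x); rewrite schwartzH_weight1 radial_derive0 /=.
apply: le_trans; rewrite /schwartz_weight /= partial_unpolar// normcZr.
by rewrite ler_wpM2r ?normc_ge0// prod_coord_le.
Qed.

Lemma unpolar_schwartz F : is_schwartzH F -> is_schwartz (unpolar F).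
Proof.
move=> SF; split; first exact: unpolar_smooth.
move=> i; have [B HB] := bounded_op_bounds unpolar_bounded SF (schwartzH_bounds SF) i.
by exists B => _ [x _ <-].
Qed.

End unpolar.

(** * Continuity for the seminorm topologies and the isomorphism *)

Lemma finite_set_list (I : Type) (J : set I) : finite_set J ->
  exists s : seq I, forall i, J i -> List.In i s.
Proof.
move=> /(@finite_seqP {classic I})[s ->]; exists s => i /=.
exact: (@mem_In {classic I}).
Qed.

Lemma list_finite_set (I : Type) (s : seq I) : finite_set [set i | List.In i s].
Proof.
elim: s => [|i s IH].
  by rewrite (_ : [set i | _] = set0)//; apply/seteqP; split.
rewrite (_ : [set k | _] = [set i] `|` [set k | List.In k s]).
  by rewrite finite_setU; split => //; exact: finite_set1.
by apply/seteqP; split => k [] //=; [left|right|left|right].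
Qed.

(** The spaces are records without linear structure; linearity is replaced by the hypothesis that
    [Phi] sends differences to differences of images. Finitely many target seminorms are then
    controlled by finitely many source seminorms. *)
Lemma bounded_op_open (R : realType) (I1 I2 P1 P2 T1 T2 : Type) (E1 E2 : zmodType)
    (emb1 : T1 -> E1) (emb2 : T2 -> E2) (w1 : I1 -> E1 -> P1 -> R) (w2 : I2 -> E2 -> P2 -> R)
    (S : E1 -> Prop) (Phi : E1 -> E2) (T : T1 -> T2) (y0 : P2) :
  (forall f g, S (emb1 g - emb1 f)) ->
  (forall f, S f -> forall i, has_ubound (range (w1 i f))) ->
  bounded_op S w1 w2 Phi ->
  (forall f g, emb2 (T g) - emb2 (T f) = Phi (emb1 g - emb1 f)) ->
  forall U, seminorm_open emb2 (fun i f => sup (range (w2 i f))) U ->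
    seminorm_open emb1 (fun i f => sup (range (w1 i f))) (T @^-1` U).
Proof.
move=> SB w1_ub bPhi TPhi U oU f UTf.
have [J2 [e [/finite_set_list[L2 JL2] e0 H]]] := oU _ UTf.
have [L1 [A [A0 HA]]] := bounded_op_seq bPhi L2.
have A1 : 0 < A + 1 by rewrite ltr_wpDl.
(* [A + 1] because [A] may vanish and the inequality [A * d < e] has to be strict. *)
pose d := e / (A + 1).
have d0 : 0 < d by rewrite divr_gt0.
exists [set i | List.In i L1], d; split => //; first exact: list_finite_set.
move=> g gf; apply: H => i /JL2 iL2; rewrite TPhi.
have w1d : weights_le w1 L1 (emb1 g - emb1 f) d.
  move=> k kL1 x; apply: le_trans (ltW (gf k kL1)).
  by apply: ub_le_sup; [exact: w1_ub|exists x].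
apply: (@le_lt_trans _ _ (A * d)).
  (* Bounding a supremum by an upper bound asks for a nonempty range, which [y0] provides. *)
  apply: ge_sup; first by exists (w2 i (Phi (emb1 g - emb1 f)) y0), y0.
  by move=> _ [y _ <-]; exact: (HA _ _ (SB f g) (ltW d0) w1d).
by rewrite /d mulrA ltr_pdivrMr// mulrC ltr_pM2l// ltrDl.
Qed.

Section fourier_isomorphism.
Context {R : realType} {n : nat}.
Local Notation V := 'rV[R]_n.
Local Notation sw := (@schwartz_weight R n).
Local Notation hw := (@schwartzH_weight R n).
Implicit Types (f g : V -> R[i]).

Lemma schwartzB f g : is_schwartz f -> is_schwartz g -> is_schwartz (f - g).
Proof.
move=> Sf Sg; have [sf bf] := Sf; have [sg bg] := Sg.
have fgE : f - g = fun x => f x + -1 * g x.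
  by apply/funext => x; rewrite mulN1r.
have sNg : smooth_on setT (fun x => -1 * g x).
  by apply: smooth_onM => //; [exact: openT|exact: smooth_on_cst].
rewrite fgE; split; first by apply: smooth_onD => //; exact: openT.
move=> i; have [B HB] := schwartz_bounds Sf i; have [B' HB'] := schwartz_bounds Sg i.
exists (B + B') => _ [x _ <-]; apply: le_trans (lerD (HB x) (HB' x)).
rewrite /schwartz_weight partialD// partialZ// mulN1r mulrBr.
by rewrite (le_trans (le_normcD _ _))// normcN.
Qed.

Lemma fourierB c f g : is_schwartz f -> is_schwartz g ->
  fourier c (f - g) = fourier c f - fourier c g.
Proof.
move=> Sf Sg; have [A hA] := schwartz_cdom Sf; have [B hB] := schwartz_cdom Sg.
have [A' hA'] := schwartz_cdom ((sopZ (-1) sop_id).1 g Sg).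
apply/funext => x.
have -> : f - g = fun x => f x + -1 * g x by apply/funext => y; rewrite mulN1r.
by rewrite (fourierD _ _ hA hA') (fourierZ _ _ _ hB) mulN1r.
Qed.

Lemma fourierK c f : c ^+ 2 = (2 * pi) ^+ 2 -> is_schwartz f ->
  fourier (- c) (fourier c f) = f.
Proof.
move=> c2 Sf; apply/funext => x.
have c0 : c != 0.
  rewrite -sqrf_eq0 c2 sqrf_eq0 mulf_neq0 ?pnatr_eq0//.
  by rewrite gt_eqF// pi_gt0.
have [A hA] := schwartz_cdom Sf.
have [B hB] := schwartz_cdom ((sop_fourier c0).1 f Sf).
exact: (fourier_inversion x c2 hA hB).
Qed.

Lemma fourierG_polar f : fourierG f = polar (fourier (- (2 * pi)) f).
Proof.
apply/funext => -[r w]; rewrite /fourierG /polar /fourier /cpoint /=.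
congr integral_Rn; apply/funext => x; congr (_ * expi _).
by rewrite dotpZr !mulNr mulrA.
Qed.

Lemma schwartz_ext (f g : schwartz R n) : schwartz_fun f = schwartz_fun g -> f = g.
Proof.
case: f g => f Sf [g Sg] /= fg; subst g.
by rewrite (Prop_irrelevance Sf Sg).
Qed.

Lemma schwartzH_ext (F G : schwartzH R n) : schwartzH_fun F = schwartzH_fun G -> F = G.
Proof.
case: F G => F SF [G SG] /= FG; subst G.
by rewrite (Prop_irrelevance SF SG).
Qed.

End fourier_isomorphism.

Theorem theorem5p4 (R : realType) (n : nat) (n_ge2 : (2 <= n)%N) :
  exists (T : schwartz R n -> schwartzH R n) (T' : schwartzH R n -> schwartz R n),
    [/\ forall f : schwartz R n, schwartzH_fun (T f) = fourierG f,
        forall (a : R[i]) (f g : 'rV[R]_n -> R[i]),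
          is_schwartz f -> is_schwartz g ->
          fourierG (a *: f + g) = a *: fourierG f + fourierG g,
        cancel T T' /\ cancel T' T,
        continuous T & continuous T'].
Proof.
have n0 : (0 < n)%N by exact: ltnW.
(* The first coordinate vector, as default direction at the origin. *)
have w0P : dotp (delta_mx 0 (Ordinal n0) : 'rV[R]_n) (delta_mx 0 (Ordinal n0)) == 1.
  by rewrite dotp_delta mxE !eqxx.
pose w0 : sphere R n := exist (fun x : 'rV[R]_n => dotp x x == 1) _ w0P.
(* [- c] is the frequency of the transform and [c] that of its inverse; inversion only asks that the
   square be [(2 * pi) ^+ 2]. *)
pose c : R := 2 * pi.
have c0 : c != 0 by rewrite mulf_neq0 ?pnatr_eq0// gt_eqF// pi_gt0.
have cN0 : - c != 0 by rewrite oppr_eq0.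
have c2 : c ^+ 2 = (2 * pi) ^+ 2 by [].
have cN2 : (- c) ^+ 2 = (2 * pi) ^+ 2 by rewrite sqrrN.
have [SF bF] := @sop_fourier R n _ cN0.
have [SG bG] := @sop_fourier R n _ c0.
pose T (f : schwartz R n) : schwartzH R n :=
  SchwartzH (polar_schwartzH (SF _ (schwartzP f))).
pose T' (F : schwartzH R n) : schwartz R n :=
  Schwartz (SG _ (unpolar_schwartz w0 (schwartzHP F))).
have TK : cancel T T'.
  move=> f; apply: schwartz_ext; rewrite /= unpolar_polar -[X in fourier X]opprK.
  exact: fourierK cN2 (schwartzP f).
have T'K : cancel T' T.
  move=> F; apply: schwartzH_ext; rewrite /=.
  rewrite (fourierK c2 (unpolar_schwartz w0 (schwartzHP F))).
  exact: polar_unpolar (schwartzHP F).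
exists T, T'; split => //.
- by move=> f; rewrite fourierG_polar.
- move=> a f g Sf Sg; rewrite !fourierG_polar; apply/funext => q.
  have [A hA] := schwartz_cdom ((sopZ a sop_id).1 f Sf).
  have [B hB] := schwartz_cdom Sg; have [B' hB'] := schwartz_cdom Sf.
  by rewrite /polar (fourierD _ _ hA hB) (fourierZ _ _ _ hB').
- apply/continuousP => U oU.
  apply: (@bounded_op_open R _ _ _ _ _ _ _ _ (@schwartz_fun R n) (@schwartzH_fun R n)
    (@schwartz_weight R n) (@schwartzH_weight R n) (@is_schwartz R n)
    (@polar R n \o fourier (- c)) T (0, w0) _ _ _ _ U oU).
  + by move=> f g; exact: schwartzB (schwartzP g) (schwartzP f).
  + by move=> f [_].
  + exact: bounded_op_comp SF bF (@polar_bounded R n).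
  + move=> f g; rewrite /= fourierB//; exact: schwartzP.
- apply/continuousP => U oU.
  apply: (@bounded_op_open R _ _ _ _ _ _ _ _ (@schwartzH_fun R n) (@schwartz_fun R n)
    (@schwartzH_weight R n) (@schwartz_weight R n) (@is_schwartzH R n)
    (fourier c \o unpolar w0) T' 0 _ _ _ _ U oU).
  (* A difference in the cylinder space is the image of a difference of Schwartz functions, by the
     bijection already established, so its defining conditions need not be checked again. *)
  + move=> F G; rewrite -[G]T'K -[F]T'K /=.
    have S1 := SF _ (schwartzP (T' F)); have S2 := SF _ (schwartzP (T' G)).
    exact: (polar_schwartzH (schwartzB S2 S1)).
  + by move=> F [].
  + exact: bounded_op_comp (@unpolar_schwartz R n w0) (unpolar_bounded w0) bG.
  + move=> F G; rewrite /= -fourierB//; exact: (unpolar_schwartz w0 (schwartzHP _)).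
Qed.
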